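(* Let $0<\varepsilon\le1$, $\gamma$, $B>0$ be constants and let $0<\alpha<1/2$ be a given constant. Let $s$ be an integer with $|s|\le(1-\varepsilon)n$, let $X_n$ be a random $n\times n$ matrix whose rows are independent and uniform on the set $\mathcal S$ of vectors in $\{-1,1\}^n$ with coordinate sum $s-1$ or $s+1$, and let $F$ be a deterministic complex $n\times n$ matrix with entries bounded in modulus by $n^\gamma$; set $X=X_n+F$. Fix the last $n-1$ rows of $X$, let $c_{1i}(X)$, $1\le i\le n$, be the cofactors of $X$ along its first row (which depend only on the last $n-1$ rows), assume they are not all zero, let $c=(\sum_{i}|c_{1i}(X)|^2)^{1/2}$ and $v_i=c_{1i}(X)/c$. Let $\bar s\in\{s-1,s+1\}$. Assume that $$\rho^\ast_{n^{-A}}(\{v_1,\dots,v_n\})=\sup_{v}\mathbb P_{x_1,\dots,x_n}\Big(\Big|\sum_{i=1}^nx_iv_i-v\Big|\le n^{-A}\Big)\ge n^{-B}$$ for some sufficiently large $A$, where $(x_1,\dots,x_n)$ is uniform over vectors in $\{-1,1\}^n$ with coordinate sum $\bar s$. Then there exist a vector $\mathbf u=(u_1,\dots,u_n)\in\mathbb C^n$ and a real number $\beta$ of the form $n^{-A+k(5B+5+\gamma)}$, where $k\in\mathbb Z$, $0\le k\le A/(10B+10+2\gamma)$, such that: (1) $\|\mathbf u\|\asymp1$ and $|\langle\mathbf u,\mathrm{row}_i(X)\rangle|\le\beta n^{5B+4+\gamma}$ for $n-1$ rows $\mathrm{row}_i(X)$ of $X$; (2) there exists a generalized arithmetic progression $Q^\ast$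 of rank $O_{\alpha,B}(1)$ and size $|Q^\ast|=\max\Big(1,O_{\alpha,B}\big((\rho^\ast_{\beta n^{5B+4+\gamma}}(\{u_1,\dots,u_n\}))^{-1}/n^{\alpha/2}\big)\Big)$ which contains at least $n-n^{1/2+\alpha}$ of the complex numbers $u_i$; (3) all the (real and imaginary) components of the $u_i$ and of the generators of $Q^\ast$ are rational numbers of the form $p/q$ with $|p|,|q|\le n^{A+1}$.
   Context: Complex numbers are identified with $\mathbb R^2$. For a multiset $U=\{u_1,\dots,u_n\}\subset\mathbb C$ and $r>0$, $\rho^\ast_r(U)=\sup_{v\in\mathbb C}\mathbb P_{\mathbf x}(|\sum_i u_ix_i-v|\le r)$, the probability being over $\mathbf x$ uniform on the $(-1,1)$ vectors of coordinate sum $\bar s$. A generalized arithmetic progression (GAP) of rank $r$ in $\mathbb C$ is a set $\{g_0+k_1g_1+\dots+k_rg_r: k_i\in\mathbb Z,\ K_i\le k_i\le K_i'\}$ with $g_0,\dots,g_r\in\mathbb C$ (the generators) and integers $K_i\le K_i'$. $\mathrm{row}_i(X)$ is the $i$-th row of $X$, and $\langle\cdot,\cdot\rangle$ the standard inner product. $\|\mathbf u\|\asymp1$ means $\|\mathbf u\|$ is bounded above and below by positive absolute constants. *)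

(* Defs.v *)
From HB Require Import structures.
From mathcomp Require Import all_boot all_order all_algebra.
From mathcomp Require Import complex.
From mathcomp Require Import all_classical all_reals.
From mathcomp Require Import exp.
Set Implicit Arguments. Unset Strict Implicit. Unset Printing Implicit Defensive.
Import Order.TTheory GRing.Theory Num.Theory.
Local Open Scope ring_scope.
Local Open Scope complex_scope.

Section Defs.
Variable R : realType.
Notation C := (R[i]).

Definition cabs (z : C) : R := Num.sqrt (complex.Re z ^+ 2 + complex.Im z ^+ 2).

Definition cvnorm n (u : 'I_n -> C) : R := Num.sqrt (\sum_(i < n) cabs (u i) ^+ 2).

Definition cinner n (u w : 'I_n -> C) : C := \sum_(j < n) u j * (w j)^*.

Definition sgn (b : bool) : int := if b then 1 else -1.

Definition sumvecs n (sbar : int) : {set {ffun 'I_n -> bool}} :=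
  [set x : {ffun 'I_n -> bool} | \sum_(i < n) sgn (x i) == sbar].

(* P_x(|sum_i u_i x_i - v| <= r), x uniform on sumvecs n sbar
   (defined as 0 if that set is empty) *)
Definition smallball_prob n (sbar : int) (u : 'I_n -> C) (r : R) (v : C) : R :=
  #|[set x in sumvecs n sbar |
      cabs (\sum_(i < n) u i * (sgn (x i))%:~R - v) <= r]|%:R
  / #|sumvecs n sbar|%:R.

Definition rho_star n (sbar : int) (r : R) (u : 'I_n -> C) : R :=
  sup [set p : R | exists v : C, p = smallball_prob sbar u r v].

(* Generalized arithmetic progressions in C:
   g0 + k_1 g_1 + ... + k_r g_r, K_i <= k_i <= K'_i; each generator g_i comes
   with its bounds as a triple (g_i, K_i, K'_i); the rank is the length. *)
Definition int_range (a b : int) : seq int :=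
  [seq a + (k%:Z) | k <- iota 0 `|b - a|%N.+1].

Fixpoint gap_elems (g0 : C) (gens : seq (C * int * int)) : seq C :=
  match gens with
  | [::] => [:: g0]
  | (g, a, b) :: t => [seq x + (k%:~R) * g | x <- gap_elems g0 t, k <- int_range a b]
  end.

Definition gap_wf (gens : seq (C * int * int)) : bool :=
  all (fun t => t.1.2 <= t.2) gens.

Definition gap_rank (gens : seq (C * int * int)) : nat := size gens.

Definition gap_card (g0 : C) (gens : seq (C * int * int)) : nat :=
  size (undup (gap_elems g0 gens)).

Definition small_rat (N : R) (x : R) : Prop :=
  exists p q : int, q != 0 /\ (`|p|%:~R <= N) /\ (`|q|%:~R <= N) /\ x = p%:~R / q%:~R.

Definition small_rat_c (N : R) (z : C) : Prop :=
  small_rat N (complex.Re z) /\ small_rat N (complex.Im z).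

End Defs.

(* Main.v *)
Require Import Defs.
From HB Require Import structures.
From mathcomp Require Import all_boot all_order all_fingroup all_algebra.
From mathcomp Require Import complex.
From mathcomp Require Import all_classical all_reals.
From mathcomp Require Import sequences exp.
From mathcomp Require Import zify ring lra.
Set Implicit Arguments. Unset Strict Implicit. Unset Printing Implicit Defensive.
Import Order.TTheory GRing.Theory Num.Theory.
Local Open Scope ring_scope.

(** The vector [conj v] is orthogonal to all rows but the first.  By pigeonhole
    on [k] there is a scale [beta] such that enlarging the radius from [beta]
    to [beta * N^(5B+5+gam)] multiplies the concentration [rho] by at most
    [N^(1/100)].  Round [conj v] to integer vectors [w_i] at a much finer scale.

    Swapping two coordinates of opposite sign preserves the slice, so disjoint
    pairs [(i,j)] act as independent random signs.  Greedily add pairs whose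
    difference [w_i - w_j] decreases the l2 energy of the law of the sum by a
    factor [1 - c kappa]; since the energy is bounded below by a power of [rho],
    this stops after about [N^(1/2+alpha)] steps.  For the unused indices all
    differences nearly preserve the law in l2, hence so do sums of up to
    [kappa^(-1/2)] of them, and there are only [O(1/rho)] separated such sums.
    Translating by multiples of a longest difference shows that sums of
    [K = N^(1/20)] differences are fewer by a factor [K / kappa^(-1/2)].

    After rounding the differences to a coarse grid, polynomial growth of their
    sums bounds the size of a maximal [N^(1/25)]-independent subfamily, so that
    the coefficient lattice modulo short relations has bounded rank.  The ball of
    its quotient seminorm lies in a progression inside a slightly larger ball
    (iterate: divide by a shortest vector), and every element of that progression
    is a sum of at most [K] differences, which bounds its cardinality. *)

(** * Progressions containing the balls of a seminorm *)

(** The saving [N^(alpha/2)] in the size is a matter of budget. The allowance of [N^(1/2+alpha)]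
    exceptional indices limits the number of extracted pairs, hence [kappa] can be little smaller
    than [N^(-1/2-alpha)] if the energy loss is to beat [ln (1/rho)]. Sums of about
    [N^(1/4+alpha/2)] differences are then still [O(1/rho)] in number, and as the progression only
    uses sums of [N^(1/20)] of them, there is room for [J], about [N^(alpha/2+11/100)], separated
    translates. The surplus [N^(11/100)] pays for [N^(1/10)] lost in rounding and for [N^(1/100)]
    lost between [beta] and the enlarged radius.

    Separation controls sums only up to the resolution of the small ball, whereas a progression is
    counted exactly. The coarse grid bridges the two: distinct rounded sums are separated sums up to
    a factor quadratic in [K].

    Returning from a quotient seminorm to an actual sum costs one rounding per relation. With [n]
    relations this would be ruinous, so the family is first cut down to [O(ln N)] members. *)

Section Seminorm.
Variables (R : realType) (V : zmodType).
Implicit Types (N : V -> R) (b x y : V) (s : seq (V * nat)).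

Definition seminorm N : Prop :=
  (forall x y, N (x + y) <= N x + N y) /\
  (forall x (m : int), N (x *~ m) = `|m|%:~R * N x).

(** Finiteness is asked only modulo null vectors, because the seminorms met later have large
    kernels. It makes a least positive value attained and passes to quotients. *)
Definition finite_balls N : Prop :=
  forall r, exists F : seq V, forall x, N x <= r -> exists2 f, f \in F & N (x - f) = 0.

(* The seminorm induced by [N] on the quotient by the rational line through [b]. *)
Definition qnorm N b x : R :=
  inf [set r | exists (m a : int),
         m != 0 /\ r = N (x *~ m + b *~ a) / `|m|%:~R].

Section Basics.
Variable N : V -> R.
Hypothesis sN : seminorm N.

Lemma semi0 : N 0 = 0.
Proof. by rewrite -(mulr0z (0 : V)) sN.2 normr0 mul0r. Qed.

Lemma semiN x : N (- x) = N x.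
Proof. by rewrite -mulrN1z sN.2 normrN1 mul1r. Qed.

Lemma semi_ge0 x : 0 <= N x.
Proof. have := sN.1 x (- x); rewrite subrr semi0 semiN; lra. Qed.

Lemma semiB x y : N (x - y) <= N x + N y.
Proof. by rewrite -(semiN y) sN.1. Qed.

Lemma semi_congr x y : N (x - y) = 0 -> N x = N y.
Proof.
move=> h; have h1 := sN.1 (x - y) y; have h2 := sN.1 (y - x) x.
move: h1 h2; rewrite !subrK -(opprB x y) semiN h; lra.
Qed.

Lemma semi_nullD x y : N x = 0 -> N y = 0 -> N (x + y) = 0.
Proof.
move=> h1 h2; apply/eqP; rewrite eq_le semi_ge0 andbT.
by have := sN.1 x y; rewrite h1 h2 addr0.
Qed.

Lemma semi_null_trans y x z : N (x - y) = 0 -> N (y - z) = 0 -> N (x - z) = 0.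
Proof. by move=> h1 h2; rewrite -(subrKA y) semi_nullD. Qed.

End Basics.

Section Quotient.
Variables (N : V -> R) (b : V).
Hypothesis sN : seminorm N.
Let Q := qnorm N b.

Lemma qnorm_set_lb x : has_lbound [set r | exists (m a : int),
  m != 0 /\ r = N (x *~ m + b *~ a) / `|m|%:~R].
Proof. by exists 0 => _ [m [a [_ ->]]]; rewrite divr_ge0 ?(semi_ge0 sN) ?ler0z. Qed.

Lemma qnorm_set0 x : nonempty [set r | exists (m a : int),
  m != 0 /\ r = N (x *~ m + b *~ a) / `|m|%:~R].
Proof. by exists (N (x *~ 1 + b *~ 0) / `|1|%:~R), 1, 0. Qed.

Lemma qnorm_lb x (m a : int) :
  m != 0 -> Q x <= N (x *~ m + b *~ a) / `|m|%:~R.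
Proof. by move=> m0; apply: ge_inf; [exact: qnorm_set_lb|exists m, a]. Qed.

Lemma qnorm_ge0 x : 0 <= Q x.
Proof.
apply: lb_le_inf; first exact: qnorm_set0.
by move=> _ [m [a [_ ->]]]; rewrite divr_ge0 ?(semi_ge0 sN) ?ler0z.
Qed.

Lemma qnorm_le x : Q x <= N x.
Proof.
by have := @qnorm_lb x 1 0 isT; rewrite mulr0z addr0 normr1 divr1 mulr1z.
Qed.

Lemma qnorm_approx x e : 0 < e -> exists (m a : int), m != 0 /\
  N (x *~ m + b *~ a) < `|m|%:~R * (Q x + e).
Proof.
move=> e0.
have [|_ [m [a [m0 ->]]] h] := @inf_adherent R _ e e0 (_ : has_inf
  [set r | exists (m a : int), m != 0 /\ r = N (x *~ m + b *~ a) / `|m|%:~R]).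
  by split; [exact: qnorm_set0|exact: qnorm_set_lb].
by exists m, a; split => //; rewrite mulrC -ltr_pdivrMr // ltr0z normr_gt0.
Qed.

Lemma qnorm_seminorm : seminorm Q.
Proof.
split=> [x y|x c].
  apply/ler_addgt0Pr => e e0; have e2 : 0 < e / 2 by rewrite divr_gt0.
  have [m [a [m0 h]]] := qnorm_approx x e2.
  have [m' [a' [m0' h']]] := qnorm_approx y e2.
  have mm : 0 < `|m|%:~R :> R by rewrite ltr0z normr_gt0.
  have mm' : 0 < `|m'|%:~R :> R by rewrite ltr0z normr_gt0.
  apply: le_trans (@qnorm_lb _ (m * m') (a * m' + a' * m) _) _.
    by rewrite mulf_neq0.
  have -> : (x + y) *~ (m * m') + b *~ (a * m' + a' * m) =
      (x *~ m + b *~ a) *~ m' + (y *~ m' + b *~ a') *~ m.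
    rewrite !mulrzDl !mulrzDr -!mulrzA (mulrC m' m); exact: addrACA.
  rewrite normrM intrM ler_pdivrMr ?mulr_gt0 //.
  apply: le_trans (sN.1 _ _) _; rewrite !sN.2.
  have := ler_wpM2l (ltW mm') (ltW h); have := ler_wpM2l (ltW mm) (ltW h'); lra.
have [->|c0] := eqVneq c 0.
  rewrite mulr0z normr0 mul0r; apply/eqP; rewrite eq_le qnorm_ge0 andbT.
  by rewrite -(semi0 sN) qnorm_le.
have cc : 0 < `|c|%:~R :> R by rewrite ltr0z normr_gt0.
apply/eqP; rewrite eq_le; apply/andP; split.
  rewrite mulrC -ler_pdivrMr //; apply: lb_le_inf; first exact: qnorm_set0.
  move=> _ [m [a [m0 ->]]]; rewrite ler_pdivrMr //.
  apply: le_trans (@qnorm_lb _ m (a * c) m0) _.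
  have -> : x *~ c *~ m + b *~ (a * c) = (x *~ m + b *~ a) *~ c.
    by rewrite mulrzDl -!mulrzA (mulrC c).
  by rewrite sN.2 -mulrA mulrC.
apply: lb_le_inf; first exact: qnorm_set0.
move=> _ [m [a [m0 ->]]]; rewrite mulrC -ler_pdivlMr //.
apply: le_trans (@qnorm_lb _ (c * m) a _) _; first by rewrite mulf_neq0.
by rewrite mulrzA normrM intrM invfM -mulrA [_^-1 * _^-1]mulrC.
Qed.

Lemma qnorm_self : Q b = 0.
Proof.
apply/eqP; rewrite eq_le qnorm_ge0 andbT.
have := @qnorm_lb b 1 (-1) isT.
by rewrite mulr1z mulrN1z subrr (semi0 sN) mul0r.
Qed.

Lemma qnorm_null x : N x = 0 -> Q x = 0.
Proof. by move=> h; apply/eqP; rewrite eq_le qnorm_ge0 andbT -h qnorm_le. Qed.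

Lemma qnorm_shift x (q : int) : Q (x + b *~ q - x) = 0.
Proof. by rewrite addrAC subrr add0r qnorm_seminorm.2 qnorm_self mulr0. Qed.

Lemma nearest_div (a m : int) : m != 0 ->
  exists q r : int, a = q * m + r /\ 2 * `|r| <= `|m|.
Proof.
move=> m0; set q := ((2 * a + `|m|) %/ (2 * `|m|))%Z.
have h1 := divz_eq (2 * a + `|m|) (2 * `|m|); rewrite -/q in h1.
have h2 := @modz_ge0 (2 * a + `|m|) (2 * `|m|).
have h3 := @ltz_pmod (2 * a + `|m|) (2 * `|m|).
set r := modz _ _ in h1 h2 h3.
exists (if 0 < m then q else - q), (a - q * `|m|); split; last by lia.
by case: ltP => hm; [rewrite gtr0_norm|rewrite ler0_norm]; lia.
Qed.

(** A nearly optimal pair [m], [a] shows that [x + (a/m) b] has norm close to [Q x]; replacing [a/m]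
    by a nearest integer moves this point by at most [b/2]. *)
Lemma qnorm_round x e : 0 < e ->
  exists q : int, N (x + b *~ q) <= Q x + e + N b / 2.
Proof.
move=> e0; have [m [a [m0 h]]] := qnorm_approx x e0.
have [q [r [ea hr]]] := nearest_div a m0.
have mm : 0 < `|m|%:~R :> R by rewrite ltr0z normr_gt0.
exists q; rewrite -(ler_pM2l mm) -sN.2.
have -> : (x + b *~ q) *~ m = (x *~ m + b *~ a) - b *~ r.
  by rewrite ea mulrzDr mulrzDl mulrzA addrA addrK.
apply: le_trans (semiB sN _ _) _; rewrite sN.2.
have hr' : 2 * `|r|%:~R <= `|m|%:~R :> R by rewrite -[2]/(2%:~R) -intrM ler_int.
have := semi_ge0 sN b; nra.
Qed.

Lemma qnorm_finite_balls : finite_balls N -> finite_balls Q.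
Proof.
move=> fb r; have [F hF] := fb (r + 1 + N b / 2).
exists F => x hx; have [q hq] := @qnorm_round x 1 ltr01.
have [|f fF hf] := hF (x + b *~ q); first by apply: le_trans hq _; lra.
exists f => //; rewrite -(subrKA (x + b *~ q)); apply: (semi_nullD qnorm_seminorm).
- by rewrite -opprB (semiN qnorm_seminorm) qnorm_shift.
- exact: qnorm_null.
Qed.

End Quotient.

(** With [G] the constant of the quotient, the multiples of the shortest vector contribute [1 + 3 G]
    and the lifted generators [3 G]. *)
Fixpoint gap_const (d : nat) : nat :=
  if d is d'.+1 then (1 + 6 * gap_const d')%N else 0%N.

Fixpoint ingap s x : Prop :=
  if s is p :: s' then exists k : int, `|k| <= p.2 /\ ingap s' (x - p.1 *~ k)
  else x = 0.

Definition gap_norm N s : R := \sum_(p <- s) p.2%:R * N p.1.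

Lemma ingap_le N s x : seminorm N -> ingap s x -> N x <= gap_norm N s.
Proof.
move=> sN; elim: s x => [|p s IH] x /=; first by move=> ->; rewrite semi0 // /gap_norm big_nil.
move=> [k [hk /IH h]]; rewrite /gap_norm big_cons -/(gap_norm N s).
have -> : x = (x - p.1 *~ k) + p.1 *~ k by rewrite subrK.
apply: le_trans (sN.1 _ _) _; rewrite addrC lerD // sN.2 ler_wpM2r ?semi_ge0 //.
by rewrite -[p.2%:R]/(p.2%:Z%:~R) ler_int.
Qed.

(** Spanning over the rationals, modulo null vectors: the factor [m] clears denominators, so no
    integral basis has to be found. *)
Definition spanned N d (g : 'I_d -> V) : Prop :=
  forall x, exists (m : int) (c : 'I_d -> int),
    m != 0 /\ N (x *~ m - \sum_i g i *~ c i) = 0.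

(** Exchange argument: as [b] is not null, some generator has a nonzero coefficient in the relation
    that expresses a multiple of [b], and this generator can be eliminated modulo [b]. *)
Lemma spanned_quotient N d (g : 'I_d.+1 -> V) b :
  seminorm N -> spanned N g -> 0 < N b ->
  exists g' : 'I_d -> V, spanned (qnorm N b) g'.
Proof.
move=> sN sp b0; have [mb [e [mb0 hb]]] := sp b.
have [i ei] : exists i, e i != 0.
  apply/existsP; apply: contraT; rewrite negb_exists => /forallP h.
  have h0 : \sum_i g i *~ e i = 0.
    by apply: big1 => i _; move/negbNE/eqP: (h i) => ->; rewrite mulr0z.
  move: hb; rewrite h0 subr0 sN.2 => /eqP; rewrite mulf_eq0 (gt_eqF b0) orbF.
  by rewrite intr_eq0 normr_eq0 (negPf mb0).
exists (fun j => g (lift i j)) => x; have [m [c [m0 hx]]] := sp x.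
exists (m * e i), (fun j => c (lift i j) * e i - e (lift i j) * c i).
split; first by rewrite mulf_neq0.
have sQ := qnorm_seminorm b sN.
have -> : x *~ (m * e i) - \sum_(j < d) g (lift i j) *~ (c (lift i j) * e i - e (lift i j) * c i)
    = (x *~ m - \sum_i g i *~ c i) *~ e i
    - (b *~ mb - \sum_i g i *~ e i) *~ c i + b *~ (mb * c i).
  rewrite !(bigD1_ord i) //= !mulrzBl !mulrzDl -!mulrzA (mulrC (e i)) opprB.
  under eq_bigr do rewrite mulrzBr !mulrzA.
  rewrite sumrB -!mulrz_suml -[RHS]addrA subrK -[RHS]addrA [in RHS]opprD addrACA addNr.
  by rewrite add0r opprB [X in _ = _ + X]addrC.
apply: (semi_nullD sQ); last by rewrite sQ.2 qnorm_self // mulr0.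
rewrite -mulNrz; apply: (semi_nullD sQ); rewrite ?mulNrz ?(semiN sQ) sQ.2 qnorm_null ?mulr0 //.
Qed.

Lemma seq_argmin (T : eqType) (f : T -> R) (s : seq T) :
  s != [::] -> exists2 t, t \in s & forall t', t' \in s -> f t <= f t'.
Proof.
elim: s => // a s IH _; case: (eqVneq s [::]) => [->|/IH [t ts ht]].
  by exists a; rewrite ?mem_head // => t'; rewrite inE => /eqP ->.
case: (leP (f a) (f t)) => h.
  exists a; rewrite ?mem_head // => t'; rewrite inE => /orP[/eqP -> //|/ht].
  exact: le_trans.
exists t; first by rewrite inE ts orbT.
by move=> t'; rewrite inE => /orP[/eqP ->|/ht //]; exact: ltW.
Qed.

Lemma shortest_vector N r : seminorm N -> finite_balls N ->
  (exists x, 0 < N x <= r) ->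
  exists b, 0 < N b <= r /\ forall x, 0 < N x -> N b <= N x.
Proof.
move=> sN /(_ r)[F hF] [x0 /andP[x00 x0r]].
pose F' := [seq f <- F | 0 < N f <= r].
have in_F' x : 0 < N x <= r -> exists2 f, f \in F' & N x = N f.
  move=> /andP[h1 h2]; have [f fF hf] := hF x h2.
  exists f; last exact: semi_congr.
  by rewrite mem_filter fF -(semi_congr sN hf) h1 h2.
have [|b] := @seq_argmin _ N F'.
  have [|f] := in_F' x0; first by rewrite x00.
  by move=> h _; apply: contraTneq h => ->.
rewrite mem_filter => /andP[/andP[b0 br] bF] hb; exists b; split; first by rewrite b0.
move=> x hx; case: (leP (N x) r) => h; last exact: le_trans (ltW h).
by have [|f fF ->] := in_F' x; [rewrite hx|exact: hb].
Qed.

Lemma ingap_map_congr N b (s : seq (V * nat)) (q : V -> int) y :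
  seminorm N -> ingap s y ->
  exists y', ingap [seq (p.1 + b *~ q p.1, p.2) | p <- s] y' /\ exists a, y' = y + b *~ a.
Proof.
move=> sN; elim: s y => [|p s IH] y /=; first by move=> ->; exists 0; split => //; exists 0; rewrite mulr0z addr0.
move=> [k [hk /IH [y' [h1 [a h2]]]]].
exists (y' + (p.1 + b *~ q p.1) *~ k); split; first by exists k; rewrite addrK.
exists (a + q p.1 * k); rewrite h2 mulrzDl mulrzDr mulrzA addrACA; congr (_ + _).
by rewrite subrK.
Qed.

(* A shortest vector [b] generates everything of norm less than [N b], and a
   generator of the quotient by [b] lifts with at most thrice its norm. *)
Lemma ball_in_gap d N (g : 'I_d -> V) r :
  seminorm N -> finite_balls N -> spanned N g -> 0 <= r ->
  exists s : seq (V * nat),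
    [/\ (size s <= d)%N, (forall p, p \in s -> 0 < N p.1 /\ (0 < p.2)%N),
        gap_norm N s <= (gap_const d)%:R * r &
        forall x, N x <= r -> exists y, ingap s y /\ N (x - y) = 0].
Proof.
elim: d N g => [|d IH] N g sN fN sp r0.
  exists [::]; split => //; first by rewrite /gap_norm big_nil mul0r.
  move=> x _; exists 0; split => //; rewrite subr0.
  have [m [c [m0]]] := sp x; rewrite big_ord0 subr0 sN.2 => /eqP.
  by rewrite mulf_eq0 intr_eq0 normr_eq0 (negPf m0) => /eqP.
have [hx|hx] := pselect (exists x, 0 < N x <= r); last first.
  exists [::]; split => //; first by rewrite /gap_norm big_nil mulr_ge0.
  move=> x xr; exists 0; split => //; rewrite subr0.
  apply/eqP/contraT => x0; case: hx; exists x.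
  by rewrite lt0r x0 semi_ge0.
have [b [/andP[b0 br] bmin]] := shortest_vector sN fN hx.
have [g' sp'] := spanned_quotient sN sp b0.
have sQ := qnorm_seminorm b sN; have fQ := qnorm_finite_balls b sN fN.
have [s [hs1 hs2 hs3 hs4]] := IH _ g' sQ fQ sp' r0.
set Q := qnorm N b in sQ fQ hs2 hs3 hs4.
(* Rounding with error [Q x / 2] bounds the norm of the lift by [3/2 Q x + N b / 2]. Minimality of
   [b] bounds [N b] by that same norm, and solving gives the factor 3. *)
have /choice [q hq] : forall x, exists q : int, 0 < Q x -> N (x + b *~ q) <= 3 * Q x.
  move=> x; case: (ltP 0 (Q x)) => Qx; last by exists 0.
  have Qx2 : 0 < Q x / 2 by rewrite divr_gt0.
  have [q h] := qnorm_round b sN x Qx2; exists q => _.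
  have : N b <= N (x + b *~ q); last by rewrite -/Q in h; lra.
  apply: bmin; apply: lt_le_trans (qnorm_le b sN _).
  by rewrite -/Q (@semi_congr _ sQ _ x) //; exact: qnorm_shift.
pose s' := [seq (p.1 + b *~ q p.1, p.2) | p <- s].
have hs' : gap_norm N s' <= 3 * ((gap_const d)%:R * r).
  apply: le_trans (_ : 3 * gap_norm Q s <= _); last by rewrite ler_wpM2l.
  rewrite /gap_norm big_map mulr_sumr big_seq [leRHS]big_seq ler_sum // => p ps /=.
  have [h1 _] := hs2 _ ps; rewrite mulrCA ler_wpM2l //; exact: hq.
(* Bounds the multiple of [b] still missing once [x] has been approximated in the quotient: [r] for
   [x] itself, the rest for the lifted approximation. *)
pose C := (1 + 3 * (gap_const d)%:R) * r.
have C0 : 0 <= C by rewrite mulr_ge0 // addr_ge0 // mulr_ge0.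
pose M := Num.truncn (C / N b).
have hM : (M%:R * N b) <= C by rewrite -ler_pdivlMr // truncn_le // divr_ge0 // ltW.
exists ((b, M) :: s'); split.
- by rewrite /= size_map.
- move=> p; rewrite inE => /orP[/eqP -> /=|/mapP[p' p's -> /=]].
    split => //; rewrite truncn_gt0 ler_pdivlMr // mul1r; apply: le_trans br _.
    by rewrite /C ler_peMl // lerDl mulr_ge0.
  have [h1 h2] := hs2 _ p's; split => //.
  apply: lt_le_trans (qnorm_le b sN _).
  by rewrite -/Q (@semi_congr _ sQ _ p'.1) //; exact: qnorm_shift.
- rewrite /gap_norm big_cons /= -/(gap_norm N s'); apply: le_trans (lerD hM hs') _.
  by rewrite /C natrD natrM; lra.
move=> x xr.
have [|y0 [gy0 hy0]] := hs4 x; first exact: le_trans (qnorm_le _ sN _) xr.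
have [y [gy [a ya]]] := ingap_map_congr b q sN gy0.
have Qz : Q (x - y) = 0.
  apply: (semi_null_trans sQ hy0); rewrite -opprB (semiN sQ) ya; exact: qnorm_shift.
(* The remainder has norm at most [N b / 4 + N b / 2], less than [N b], so by minimality it is
   null. *)
have b4 : 0 < N b / 4 by rewrite divr_gt0.
have [k hk] := qnorm_round b sN (x - y) b4.
have nk : N (x - y + b *~ k) = 0.
  apply/eqP/contraT => h; have := bmin (x - y + b *~ k).
  rewrite lt0r h semi_ge0 // => /(_ isT); rewrite -/Q Qz in hk; lra.
exists (y - b *~ k); split; last by rewrite opprB addrA addrAC in nk *.
exists (- k); split; last by rewrite mulrNz opprK subrK.
have kb : N (b *~ k) <= C.
  rewrite -(semiN sN) -(@semi_congr _ sN (x - y)) ?opprK //.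
  apply: le_trans (semiB sN _ _) _.
  have := ingap_le sN gy; rewrite -/s'; rewrite /C; lra.
rewrite normrN /= -abszE lez_nat truncn_ge_nat; last by rewrite divr_ge0 // ltW.
rewrite ler_pdivlMr //.
have -> : `|k|%N%:R = `|k|%:~R :> R by rewrite -abszE.
by rewrite -sN.2.
Qed.

End Seminorm.

(** * Dividing a seminorm by relations of a homomorphism *)

Definition torsion_free (W : zmodType) : Prop :=
  forall (x : W) (m : int), m != 0 -> x *~ m = 0 -> x = 0.

Section Relations.
Variables (R : realType) (V W : zmodType) (L : {additive V -> W}).
Hypothesis tfW : torsion_free W.

(* If [qnorm N b x = 0], all multiples of [x] lie, modulo [b], in one ball of
   [N], which has finitely many classes: two of them coincide. *)
Lemma qnorm_null_ker (N : V -> R) (b : V) :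
  seminorm N -> finite_balls N -> (forall x, N x = 0 -> L x = 0) -> L b = 0 ->
  forall x, qnorm N b x = 0 -> L x = 0.
Proof.
move=> sN fN kN Lb x Qx.
have [F hF] := fN (1 + N b / 2).
have /choice [q hq] : forall M : nat, exists q : int, N (x *~ M + b *~ q) <= 1 + N b / 2.
  move=> M; have [q hq] := qnorm_round b sN (x *~ M) ltr01; exists q.
  by move: hq; rewrite (qnorm_seminorm b sN).2 Qx mulr0 add0r.
have /choice [f hf] : forall M : nat, exists f, f \in F /\ N (x *~ M + b *~ q M - f) = 0.
  by move=> M; have [f ? ?] := hF _ (hq M); exists f.
have [M1 [M2 [M12 eqf]]] : exists M1 M2 : nat, M1 != M2 /\ f M1 = f M2.
  apply: contrapT => h.
  have inj : {in iota 0 (size F).+1 &, injective f}.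
    move=> a b' _ _ e; apply/eqP/contraT => ne; case: h; by exists a, b'.
  have : (size (map f (iota 0 (size F).+1)) <= size F)%N.
    apply: uniq_leq_size; first by rewrite map_inj_in_uniq ?iota_uniq.
    by move=> _ /mapP[M _ ->]; case: (hf M).
  by rewrite size_map size_iota ltnn.
have h0 : N (x *~ M1 + b *~ q M1 - (x *~ M2 + b *~ q M2)) = 0.
  apply: (semi_null_trans sN (hf M1).2); rewrite eqf -opprB (semiN sN).
  exact: (hf M2).2.
have /kN := h0; rewrite raddfB 2!(raddfD L) !raddfMz Lb !mul0rz !addr0 -mulrzBr.
by apply: tfW; rewrite subr_eq0.
Qed.

Variable N0 : V -> R.
Hypotheses (sN0 : seminorm N0) (fN0 : finite_balls N0).
Hypothesis kN0 : forall x, N0 x = 0 -> L x = 0.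

Definition qnorms (rels : seq V) : V -> R := foldr (fun b N => qnorm N b) N0 rels.

(** The last clause is the way back from the quotient: each relation costs one rounding, at most
    [1 + N0 r], and adding multiples of relations leaves the image under [L] unchanged. *)
Lemma qnorms_spec (rels : seq V) : (forall r, r \in rels -> L r = 0) ->
  let N := qnorms rels in
  [/\ seminorm N /\ finite_balls N, forall x, N x = 0 -> L x = 0,
      forall x, N x <= N0 x, forall r, r \in rels -> N r = 0 &
      forall x, exists x', L x' = L x /\ N0 x' <= N x + \sum_(r <- rels) (1 + N0 r)].
Proof.
elim: rels => [_|b rels IH hL] /=.
  by split => // x; exists x; rewrite big_nil addr0.
have [|[sN fN] kN leN N0r hr] := IH; first by move=> r hr; apply: hL; rewrite inE hr orbT.
have Lb : L b = 0 by apply: hL; rewrite mem_head.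
split.
- by split; [exact: qnorm_seminorm|exact: qnorm_finite_balls].
- exact: qnorm_null_ker.
- by move=> x; apply: le_trans (qnorm_le b sN x) (leN x).
- move=> r; rewrite inE => /orP[/eqP ->|/N0r]; first exact: qnorm_self.
  exact: qnorm_null.
move=> x; have [q hq] := qnorm_round b sN x ltr01.
have [x' [h1 h2]] := hr (x + b *~ q); exists x'; split.
  by rewrite h1 raddfD /= raddfMz /= Lb mul0rz addr0.
rewrite big_cons; have := leN b; have := semi_ge0 sN b; lra.
Qed.

End Relations.

(** * Sums of boundedly many members of a family *)

Section Sums.
Variables (V : zmodType) (I : finType) (y : I -> V).
Implicit Types (c d : {ffun I -> int}) (k m : int).

Definition lin (c : {ffun I -> int}) : V := \sum_i y i *~ c i.

Lemma lin_is_zmod_morphism : zmod_morphism lin.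
Proof.
by move=> c d; rewrite /lin -sumrB; apply: eq_bigr => i _; rewrite !ffunE mulrzBr.
Qed.
HB.instance Definition _ := GRing.isZmodMorphism.Build _ _ lin lin_is_zmod_morphism.

Definition wt (c : {ffun I -> int}) : nat := \sum_i `|c i|%N.

Definition sums (m : nat) (z : V) : Prop :=
  exists c, (wt c <= m)%N /\ z = lin c.

Lemma sums_mono (m m' : nat) z : (m <= m')%N -> sums m z -> sums m' z.
Proof. by move=> h [c [h1 h2]]; exists c; split => //; exact: leq_trans h. Qed.

Lemma abszD_le (a b : int) : (absz (a + b)%R <= absz a + absz b)%N.
Proof. lia. Qed.

Lemma wtD c d : (wt (c + d)%R <= wt c + wt d)%N.
Proof. by rewrite /wt -big_split leq_sum //= => i _; rewrite ffunE abszD_le. Qed.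

Lemma wtMz c m : wt (c *~ m) = (`|m| * wt c)%N.
Proof.
by rewrite /wt big_distrr /=; apply: eq_bigr => i _; rewrite ffunMzE mulrzz abszM mulnC.
Qed.

Lemma wt_le c (m : nat) : (forall i, `|c i| <= m)%N -> (wt c <= #|I| * m)%N.
Proof. by move=> h; rewrite /wt -sum_nat_const leq_sum. Qed.

Lemma wt_eq0 c : wt c = 0%N -> c = 0.
Proof.
move=> /eqP; rewrite sum_nat_eq0 => /forallP h; apply/ffunP => i.
by rewrite ffunE; move: (h i) => /=; rewrite absz_eq0 => /eqP.
Qed.

Lemma sumsD (m m' : nat) z z' : sums m z -> sums m' z' -> sums (m + m') (z + z')%R.
Proof.
move=> [c [h ->]] [c' [h' ->]]; exists (c + c'); split; last by rewrite raddfD.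
exact: leq_trans (wtD _ _) (leq_add h h').
Qed.

Lemma sumsMz (m : nat) z k : sums m z -> sums (`|k| * m) (z *~ k).
Proof.
by move=> [c [h ->]]; exists (c *~ k); rewrite raddfMz wtMz leq_mul2l h orbT.
Qed.

Lemma sums1 i : sums 1 (y i).
Proof.
exists [ffun j => (j == i)%:Z]; split.
  by rewrite /wt (bigD1 i) //= ffunE eqxx big1 // => j /negPf h; rewrite ffunE h.
rewrite /lin (bigD1 i) //= ffunE eqxx mulr1z big1 ?addr0 // => j /negPf h.
by rewrite ffunE h mulr0z.
Qed.

(** Writes a combination as a list of signed generators, the form in which the l2 triangle
    inequality [evar_sum] is applied. *)
Lemma lin_as_seq c :
  exists s : seq V, [/\ size s = wt c, lin c = \sum_(b <- s) b &
    forall b, b \in s -> exists2 i, c i != 0 & b = y i \/ b = - y i].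
Proof.
exists (flatten [seq nseq `|c i|%N (if 0 <= c i then y i else - y i) | i <- enum I]).
split.
- rewrite size_flatten /shape -map_comp sumnE big_map /wt big_enum.
  by apply: eq_bigr => i _ /=; rewrite size_nseq.
- rewrite big_flatten big_map /lin big_enum; apply: eq_bigr => i _ /=.
  rewrite big_nseq iter_addr_0; case: (c i) => k /=; first by rewrite pmulrn.
  by rewrite NegzE mulrNz mulNrn pmulrn.
move=> b /flattenP[_ /mapP[i _ ->]]; rewrite mem_nseq => /andP[h /eqP ->].
exists i; first by rewrite -absz_eq0 -lt0n.
by case: ifP; [left|right].
Qed.

Variable R : realType.
Definition wtR (c : {ffun I -> int}) : R := (wt c)%:R.

Lemma wtR_seminorm : seminorm wtR.
Proof.
split=> [c d|c m]; first by rewrite /wtR -natrD ler_nat wtD.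
by rewrite /wtR wtMz natrM -abszE.
Qed.

Lemma wtR_finite_balls : finite_balls wtR.
Proof.
move=> r; pose M := Num.truncn r.
exists [seq [ffun i => (f i : nat)%:Z - M%:Z] | f : {ffun I -> 'I_(2 * M).+1} <- enum {: {ffun I -> 'I_(2 * M).+1}}].
move=> c hc; exists c; last by rewrite subrr /wtR /wt big1 // => i _; rewrite ffunE.
apply/mapP; exists [ffun i => inord (absz (c i + M%:Z))]; first by rewrite mem_enum.
apply/ffunP => i; rewrite !ffunE.
have : (`|c i| <= M)%N.
  apply: leq_trans (_ : wt c <= M)%N; first by rewrite /wt (bigD1 i) //= leq_addr.
  by rewrite /M truncn_ge_nat // (le_trans _ hc).
by move=> h; rewrite inordK; lia.
Qed.

End Sums.

(** Duplicate-free lists express a cardinality bound for a predicate that is neither decidable nor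
    known in advance to be finite. *)
Definition card_le (T : eqType) (P : T -> Prop) (R : realType) (b : R) : Prop :=
  forall s : seq T, uniq s -> (forall z, z \in s -> P z) -> (size s)%:R <= b.

Section Independence.
Variables (R : realType) (V : zmodType) (I : finType) (y : I -> V).

Lemma absz_subn_le (a b l : nat) :
  (a <= l -> b <= l -> absz (a%:Z - b%:Z)%R <= l)%N.
Proof. lia. Qed.

Definition indep (l : nat) (D : {set I}) : Prop :=
  forall c : {ffun I -> int}, (forall i, i \notin D -> c i = 0) ->
    (forall i, (`|c i| <= l)%N) -> lin y c = 0 -> c = 0.

(** If [D] had [t] elements, the [(l+1)^t] combinations with coefficients between 0 and [l] would be
    distinct, since the difference of two coefficient vectors has entries at most [l] in absolute
    value. *)
Lemma indep_card l (D : {set I}) (b : R) t : indep l D ->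
  card_le (sums y (t * l)) b -> b < (l.+1 ^ t)%:R -> (#|D| < t)%N.
Proof.
move=> ind cb; apply: contraTT; rewrite -leqNgt -leNgt => /card_geqP[s [us ss sD]].
pose cf (f : {ffun I -> 'I_l.+1}) := [ffun i => (f i : nat)%:Z] : {ffun I -> int}.
pose fs := enum (pffun_on (ord0 : 'I_l.+1) (mem s) predT).
have fs0 f i : f \in fs -> i \notin s -> f i = ord0.
  rewrite mem_enum => /pffun_onP[/fintype.subsetP h _]; apply: contraNeq => h1.
  exact: h.
have -> : (l.+1 ^ t)%N = size [seq lin y (cf f) | f <- fs].
  by rewrite size_map -cardE card_pffun_on card_ord -ss (card_uniqP us).
apply: cb.
  rewrite map_inj_in_uniq ?enum_uniq // => f g fF gF h.
  have /ffunP e : cf f - cf g = 0.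
    apply: ind => [i iD|i|]; last by rewrite raddfB /= h subrr.
      have is_ : i \notin s by apply: contra iD; exact: sD.
      by rewrite !ffunE (fs0 f) // (fs0 g).
    by rewrite !ffunE; apply: absz_subn_le; rewrite -ltnS ltn_ord.
  apply/ffunP => i; apply: val_inj; by have := e i; rewrite !ffunE => /eqP; rewrite subr_eq0 => /eqP [].
move=> _ /mapP[f fF ->]; exists (cf f); split => //; rewrite /wt (bigID (mem s)) /=.
rewrite [X in (_ + X)%N]big1 ?addn0; last by move=> i hi; rewrite ffunE (fs0 f).
rewrite -ss -(card_uniqP us) -sum_nat_const leq_sum // => i _.
by rewrite ffunE /= -ltnS ltn_ord.
Qed.

Lemma indep_max l : exists D : {set I}, indep l D /\
  forall i, i \notin D -> exists c : {ffun I -> int},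
    [/\ forall j, j \notin i |: D -> c j = 0, forall j, (`|c j| <= l)%N,
        c i != 0 & lin y c = 0].
Proof.
pose P (A : {set I}) := `[< indep l A >].
have P0 : P finset.set0.
  by apply/asboolP => c h _ _; apply/ffunP => i; rewrite h ?finset.in_set0 ?ffunE.
have [D /maxsetP[/asboolP PD mD] _] := maxset_exists P0.
exists D; split => // i iD.
have nP : ~ indep l (i |: D).
  move=> /asboolP /mD h; have := iD; rewrite -h ?subsetU1 //.
  by rewrite finset.setU11.
apply: contrapT => h; apply: nP => c c1 c2 c3.
have [ci|ci] := eqVneq (c i) 0; last by case: h; exists c.
apply: PD => // j jD; have [->//|ji] := eqVneq j i.
by apply: c1; rewrite in_setU1 negb_or ji.
Qed.

Lemma sums_sum (J : finType) (m : J -> nat) (z : J -> V) :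
  (forall j, sums y (m j) (z j)) -> sums y (\sum_j m j) (\sum_j z j).
Proof.
move=> h; apply: (big_rec2 (fun m z => sums y m z)).
  by exists 0; rewrite raddf0 /wt big1 // => i _; rewrite ffunE.
by move=> j a b _ hb; apply: sumsD.
Qed.

Lemma sums_comp (J : finType) (f : J -> I) m z : sums (y \o f) m z -> sums y m z.
Proof.
move=> [c [cm ->]]; apply: sums_mono cm _; rewrite /lin /wt.
apply: sums_sum => j; rewrite -[X in sums y X _]muln1; apply: sumsMz; exact: sums1.
Qed.

End Independence.

Section GapMap.
Variables (V W : zmodType) (L : {additive V -> W}).

Definition gap_map (s : seq (V * nat)) : seq (W * nat) := [seq (L p.1, p.2) | p <- s].

Lemma ingap_mapP s w : ingap (gap_map s) w <-> exists x, ingap s x /\ L x = w.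
Proof.
elim: s w => [|p s IH] w /=.
  by split=> [->|[x [-> <-]]]; [exists 0; rewrite raddf0|rewrite raddf0].
split=> [[k [hk /IH[x [gx Lx]]]]|[x [[k [hk gx]] <-]]].
  exists (x + p.1 *~ k); rewrite raddfD raddfMz /= Lx subrK; split => //.
  by exists k; rewrite addrK.
by exists k; split => //; apply/IH; exists (x - p.1 *~ k); rewrite raddfB raddfMz.
Qed.

End GapMap.

(** * Progressions containing a family with few sums *)

Section LatticeGap.
Variables (R : realType) (V : zmodType).
Hypothesis tfV : torsion_free V.

(** The first term is the quotient norm of the progression that contains the ball of radius [t]. The
    second lifts back through at most [k] relations, each of l1 norm at most [k * l]. *)
Definition gap_radius (d t k l : nat) : nat :=
  (gap_const d * t + k * (1 + k * l))%N.

(* Each [y i] outside a maximal [l]-independent [J] satisfies a relation with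
   coefficients at most [l].  Dividing the l1 norm on coefficient vectors by
   these relations leaves rank [#|J|]. *)
Lemma small_sums_in_gap (I : finType) (y : I -> V) (l t : nat) :
  exists s (J : {set I}),
    [/\ indep y l J, (size s <= #|J|)%N,
    forall c : {ffun I -> int}, (wt c <= t)%N -> ingap s (lin y c),
    forall z, ingap s z -> sums y (gap_radius #|J| t #|I| l) z &
    forall p, p \in s -> sums y (gap_radius #|J| t #|I| l) p.1].
Proof.
have [J [indJ maxJ]] := indep_max y l.
have /choice [rel hrel] : forall i, exists c : {ffun I -> int}, i \notin J ->
    [/\ forall j, j \notin i |: J -> c j = 0, forall j, (`|c j| <= l)%N,
        c i != 0 & lin y c = 0].
  move=> i; have [iJ|/maxJ[c hc]] := boolP (i \in J); first by exists 0.
  by exists c.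
pose rels := [seq rel i | i <- enum (~: J)].
have memJ i : i \in enum (~: J) -> i \notin J by rewrite mem_enum inE.
have rels0 r : r \in rels -> lin y r = 0 by move=> /mapP[i /memJ /hrel[_ _ _ h] ->].
have ker0 (c : {ffun I -> int}) : wtR R c = 0 -> lin y c = 0.
  by move=> /eqP; rewrite pnatr_eq0 => /eqP /wt_eq0 ->; rewrite raddf0.
have := qnorms_spec tfV (wtR_seminorm I R) (@wtR_finite_balls I R) ker0 rels0.
set N := qnorms _ _ => -[[sN fN] kN leN relN roundN].
pose de (i : I) : {ffun I -> int} := [ffun j => (j == i)%:Z].
have decomp (c : {ffun I -> int}) : c = \sum_i de i *~ c i.
  apply/ffunP => j; rewrite sum_ffunE (bigD1 j) //= big1 => [|i ij].
    by rewrite addr0 ffunMzE ffunE eqxx mulrzz mul1r.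
  by rewrite ffunMzE ffunE eq_sym (negPf ij) mul0rz.
pose g (k : 'I_#|J|) := de (enum_val k).
have spN : spanned N g.
  pose Pr (x : {ffun I -> int}) := exists (m : int) (c : 'I_#|J| -> int),
    m != 0 /\ N (x *~ m - \sum_i g i *~ c i) = 0.
  have Pr0 : Pr 0.
    exists 1, (fun=> 0); split => //; rewrite mul0rz big1 ?subr0 ?semi0 // => i _; exact: mulr0z.
  have PrD x x' : Pr x -> Pr x' -> Pr (x + x').
    move=> [m [c [m0 h]]] [m' [c' [m0' h']]].
    exists (m * m'), (fun i => c i * m' + c' i * m); split; first by rewrite mulf_neq0.
    have -> : (x + x') *~ (m * m') - \sum_i g i *~ (c i * m' + c' i * m) =
       (x *~ m - \sum_i g i *~ c i) *~ m' + (x' *~ m' - \sum_i g i *~ c' i) *~ m.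
      under eq_bigr do rewrite mulrzDr !mulrzA.
      rewrite big_split -!mulrz_suml /= mulrzDl !mulrzBl -!mulrzA (mulrC m' m) opprD.
      by rewrite addrACA.
    by apply: (semi_nullD sN); rewrite sN.2 ?h ?h' mulr0.
  have PrM x k : Pr x -> Pr (x *~ k).
    move=> [m [c [m0 h]]]; exists m, (fun i => c i * k); split => //.
    under eq_bigr do rewrite mulrzA.
    by rewrite -mulrz_suml -!mulrzA (mulrC k) mulrzA -mulrzBl sN.2 h mulr0.
  have PrJ i : i \in J -> Pr (de i).
    move=> iJ; exists 1, (fun j => (j == enum_rank_in iJ i)%:Z); split => //.
    rewrite (bigD1 (enum_rank_in iJ i)) //= eqxx !mulr1z big1 => [|j /negPf ->//].
    by rewrite addr0 /g enum_rankK_in // subrr semi0.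
  (* The relation of an index outside [J] is null for [N] and expresses a nonzero multiple of [de i]
     through [J]. *)
  have PrI i : Pr (de i).
    have [/PrJ//|iJ] := boolP (i \in J).
    have [h1 h2 h3 h4] := hrel i iJ.
    have [m [c [m0 h]]] : Pr (\sum_(j in J) de j *~ rel i j).
      by apply: (big_ind Pr Pr0 PrD) => j jJ; apply: PrM; exact: PrJ.
    exists (rel i i * m), (fun j => - c j); split; first by rewrite mulf_neq0.
    under eq_bigr do rewrite mulrNz.
    rewrite sumrN opprK mulrzA.
    have e : de i *~ rel i i = rel i - \sum_(j in J) de j *~ rel i j.
      rewrite {2}(decomp (rel i)) (bigD1 i) //= (bigID (mem J)) /=.
      rewrite [X in _ + (_ + X)]big1 => [|j /andP[ji jJ]]; last first.
        by rewrite h1 ?mulr0z // in_setU1 negb_or ji.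
      rewrite addr0 (eq_bigl (mem J)) ?addrK // => j /=.
      by case: eqVneq => [->|]; rewrite ?(negPf iJ) ?andbT.
    rewrite e mulrzBl -addrA (addrC (- _)) -[\sum_i _ - _]opprB.
    apply: (semi_nullD sN); last by rewrite (semiN sN).
    by rewrite sN.2 relN ?mulr0 // map_f // mem_enum inE.
  move=> x; rewrite (decomp x); apply: (big_ind Pr Pr0 PrD) => i _; exact: PrM.
have t0 : 0 <= t%:R :> R by [].
have [s [s1 s2 s3 s4]] := ball_in_gap sN fN spN t0.
have bound x : N x <= (gap_const #|J|)%:R * t%:R ->
    sums y (gap_radius #|J| t #|I| l) (lin y x).
  move=> Nx; have [x' [e hx']] := roundN x; exists x'; split => //.
  rewrite -(ler_nat R); apply: le_trans hx' _; rewrite natrD natrM lerD //.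
  rewrite /rels big_map big_seq natrM.
  apply: le_trans (_ : \sum_(i <- enum (~: J)) (1 + #|I| * l)%:R <= _).
    rewrite [leRHS]big_seq ler_sum // => i /memJ /hrel[_ h _ _].
    rewrite natrD lerD2l ler_nat; exact: wt_le.
  rewrite big_const_seq count_predT iter_addr_0 -[_ *+ size _]mulr_natl.
  by rewrite ler_wpM2r // ler_nat -cardE max_card.
exists (gap_map (lin y) s), J; split => //.
- by rewrite size_map.
- move=> c ct; apply/ingap_mapP.
  have [|x [gx hx]] := s4 c; first by apply: le_trans (leN c) _; rewrite ler_nat.
  exists x; split => //; apply/esym/eqP; rewrite -subr_eq0 -raddfB; apply/eqP.
  exact: kN.
- move=> z /ingap_mapP[x [gx <-]]; apply: bound; apply: le_trans s3.
  exact: ingap_le.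
- move=> _ /mapP[p ps -> /=]; apply: bound; apply: le_trans s3.
  have [h1 h2] := s2 p ps.
  rewrite /gap_norm (big_rem p) //=; apply: le_trans (_ : p.2%:R * N p.1 <= _).
    by rewrite ler_peMl ?ler1n //; exact: ltW.
  by rewrite lerDl sumr_ge0 // => i _; rewrite mulr_ge0 ?(semi_ge0 sN).
Qed.

Lemma gap_const_mono : {homo gap_const : a b / (a <= b)%N}.
Proof. by apply: homo_leq (leqnn) leq_trans _ => d /=; lia. Qed.

Lemma gap_radius_mono d d' t k k' l :
  (d <= d')%N -> (k <= k')%N -> (gap_radius d t k l <= gap_radius d' t k' l)%N.
Proof.
move=> hd hk; have := gap_const_mono hd; rewrite /gap_radius => h.
by apply: leq_add; apply: leq_mul => //; rewrite leq_add2l leq_mul.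
Qed.

(** Independence is used at two levels. Level 1 yields fewer than [t] members of which every [y i]
    is a short sum; level [l] among these few bounds the rank by [d]. Without the first reduction
    the lifting cost in [gap_radius] would involve the size of the whole family. *)
Lemma family_in_gap (I : finType) (y : I -> V) (t l d m : nat) (b : R) :
  card_le (sums y m) b -> b < (2 ^ t)%:R -> (t <= m)%N ->
  b < (l.+1 ^ d)%:R -> (d * l <= m)%N ->
  exists s : seq (V * nat),
    [/\ (size s < d)%N, forall i, ingap s (y i),
    forall z, ingap s z -> sums y (gap_radius d t t l) z &
    forall p, p \in s -> sums y (gap_radius d t t l) p.1].
Proof.
move=> cb bt tm bd dm.
have cb' k : (k <= m)%N -> card_le (sums y k) b.
  by move=> km s us hs; apply: cb => // z /hs; apply: sums_mono.
have [D [indD maxD]] := indep_max y 1.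
have Dt : (#|D| < t)%N by apply: (indep_card indD) bt; rewrite muln1; exact: cb'.
pose y0 (k : 'I_#|D|) := y (enum_val k).
have [s [J [indJ sJ inS sumS sumP]]] := small_sums_in_gap y0 l t.
have Jd : (#|J| < d)%N.
  apply: (indep_card indJ) bd => z uz hz; apply: (cb' (d * l)%N) => // x /hz.
  exact: sums_comp.
have lift z : sums y0 (gap_radius #|J| t #|'I_#|D| | l) z -> sums y (gap_radius d t t l) z.
  move=> /sums_comp; apply: sums_mono; apply: gap_radius_mono; first exact: ltnW.
  by rewrite card_ord ltnW.
exists s; split; [exact: leq_ltn_trans sJ Jd| |by move=> z /sumS /lift|by move=> p /sumP /lift].
move=> i.
suff [c [cw ->]] : exists c, (wt c <= t)%N /\ y i = lin y0 c by exact: inS.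
have [iD|iD] := boolP (i \in D).
  have [c [cw e]] := sums1 y0 (enum_rank_in iD i); exists c; split.
    by apply: leq_trans cw _; case: (t) Dt.
  by rewrite -e /y0 enum_rankK_in.
have [c [c1 c2 c3 c4]] := maxD i iD.
(* At level 1 the nonzero coefficient [c i] is 1 or -1, hence its own inverse, and the relation can
   be solved for [y i] over the integers. *)
exists [ffun k => - (c i * c (enum_val k))]; split.
  apply: leq_trans (wt_le (m := 1) _) _; last by rewrite card_ord muln1 ltnW.
  move=> k; rewrite ffunE abszN abszM; have := c2 i; have := c2 (enum_val k); nia.
have ci : c i * c i = 1.
  move: (c2 i) c3; move: (c i) => a h1 h2.
  have [->|->] // : a = 1 \/ a = -1 by lia.
rewrite /lin /y0.
transitivity (- \sum_(j in D) y j *~ (c i * c j)).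
  have e : y i *~ c i = - \sum_(j in D) y j *~ c j.
    apply/eqP; rewrite -addr_eq0 -[X in _ == X]c4 /lin; apply/eqP.
    rewrite [RHS](bigD1 i) //=; congr (_ + _); rewrite [RHS](bigID (mem D)) /= [X in _ = _ + X]big1.
      rewrite addr0; apply: eq_bigl => j.
      by case: eqVneq => [->|]; rewrite ?(negPf iD) ?andbT.
    by move=> j /andP[ji jD]; rewrite c1 ?mulr0z // in_setU1 negb_or ji.
  under eq_bigr do rewrite mulrC mulrzA.
  by rewrite -mulrz_suml -mulNrz -e -mulrzA ci mulr1z.
rewrite -sumrN big_enum_val; apply: eq_bigr => k _.
by rewrite ffunE mulrNz.
Qed.

End LatticeGap.

(** * Energy of partially randomized sums *)

Section Energy.
Variables (R : realType) (n : nat) (G : finZmodType) (w : 'I_n -> G).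
Variables (Om : {set {ffun 'I_n -> bool}}) (p0 : G -> R).
Notation cube := {ffun 'I_n -> bool}.
Implicit Types (x : cube) (i j h : 'I_n) (l : seq ('I_n * 'I_n)) (a b c z : G).

Definition swap i j x : cube := [ffun k => x (tperm i j k)].

Lemma swapK i j : involutive (swap i j).
Proof. by move=> x; apply/ffunP => k; rewrite !ffunE tpermK. Qed.

Hypothesis OmS : forall i j x, (swap i j x \in Om) = (x \in Om).

Definition walk x : G := \sum_i w i *~ sgn (x i).

Definition jump i j x : G := (w i - w j) *~ (sgn (x i) - sgn (x j)).

Lemma walk_swap i j x : i != j -> walk (swap i j x) = walk x - jump i j x.
Proof.
move=> ij; apply: (addIr (jump i j x)); rewrite subrK.
rewrite /walk (reindex_inj (@perm_inj _ (tperm i j))) /=.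
under eq_bigr do rewrite ffunE tpermK.
rewrite [in LHS](bigD1 i) //= [in LHS](bigD1 j) 1?eq_sym //=.
rewrite [in RHS](bigD1 i) //= [in RHS](bigD1 j) 1?eq_sym //=.
rewrite tpermL tpermR (eq_bigr (fun k => w k *~ sgn (x k))); last first.
  by move=> k /andP[ki kj]; rewrite tpermD 1?eq_sym.
rewrite [X in X + _ = _]addrA [RHS]addrA [LHS]addrAC; congr (_ + _).
rewrite /jump mulrzBr !mulrzBl opprB.
by rewrite [LHS]addrC addrACA !subrK.
Qed.

(* Conditionally on [x] outside the pairs of [l], swapping [p.1] and [p.2]
   moves [walk x] by [- jump p.1 p.2 x]; averaging over these swaps turns the
   profile [p0] into [smooth l x]. *)
Fixpoint smooth l x a : R :=
  if l is p :: l' then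
    (smooth l' x a + smooth l' x (a - jump p.1 p.2 x)) / 2
  else p0 a.

Definition used l : seq 'I_n := unzip1 l ++ unzip2 l.

Fixpoint wf l : Prop :=
  if l is p :: l' then
    [/\ p.1 != p.2, p.1 \notin used l', p.2 \notin used l' & wf l']
  else True.

Lemma used_cons p l : used (p :: l) =i [:: p.1, p.2 & used l].
Proof. by move=> i; rewrite /used /= !(inE, mem_cat); do !bool_congr. Qed.

Lemma eq_smooth l x x' : {in used l, x =1 x'} -> smooth l x =1 smooth l x'.
Proof.
elim: l => //= p l IH h a.
have {}IH : smooth l x =1 smooth l x'.
  by apply: IH => i il; apply: h; rewrite used_cons !inE il !orbT.
by rewrite !IH /jump !h // used_cons !inE eqxx ?orbT.
Qed.

Lemma smooth_swap l i j x : i \notin used l -> j \notin used l ->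
  smooth l (swap i j x) =1 smooth l x.
Proof.
move=> il jl; apply: eq_smooth => k kl; rewrite ffunE tpermD //.
  by apply: contraNneq il => ->.
by apply: contraNneq jl => ->.
Qed.

Lemma sum_shift (f : G -> R) b : \sum_a f (a - b) = \sum_a f a.
Proof. by rewrite [RHS](reindex_inj (addIr (- b))). Qed.

Lemma sum_reflect (f : G -> R) b : \sum_a f (b - a) = \sum_a f a.
Proof. by rewrite [RHS](reindex_inj (inj_comp (addrI b) oppr_inj)). Qed.

Lemma smooth_ge0 l x a : (forall a, 0 <= p0 a) -> 0 <= smooth l x a.
Proof. by move=> h; elim: l a => //= p l IH a; rewrite divr_ge0 // addr_ge0. Qed.

Lemma smooth_sum l x : \sum_a smooth l x a = \sum_a p0 a.
Proof.
elim: l => //= p l IH; rewrite -mulr_suml big_split /= sum_shift IH; lra.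
Qed.

Lemma smooth_cover l x (Z : seq G) (M : R) :
  (forall y, \sum_(z <- Z) p0 (y - z) <= M) ->
  forall y, \sum_(z <- Z) smooth l x (y - z) <= M.
Proof.
move=> h; elim: l => //= p l IH y; rewrite -mulr_suml big_split /=.
have h1 := IH y; have h2 := IH (y - jump p.1 p.2 x).
under [X in _ + X]eq_bigr do rewrite addrAC.
lra.
Qed.

Definition energy l : R := \sum_(x in Om) \sum_a smooth l x a ^+ 2.

Definition var l x b : R := \sum_a (smooth l x a - smooth l x (a - b)) ^+ 2.

Definition evar l b : R := \sum_(x in Om) var l x b.

Lemma var_ge0 l x b : 0 <= var l x b.
Proof. by apply: sumr_ge0 => a _; exact: sqr_ge0. Qed.

Lemma varN l x b : var l x (- b) = var l x b.
Proof.
rewrite /var -[LHS](sum_shift _ b); apply: eq_bigr => a _.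
by rewrite opprK subrK -opprB sqrrN.
Qed.

(** The parallelogram identity for a function and its translate, which have the same l2 norm. *)
Lemma energy_step p l :
  energy (p :: l) = energy l - (\sum_(x in Om) var l x (jump p.1 p.2 x)) / 4.
Proof.
rewrite /energy mulr_suml -sumrB; apply: eq_bigr => x _ /=.
have h := sum_shift (fun a => smooth l x a ^+ 2) (jump p.1 p.2 x).
have {h} -> : \sum_a smooth l x a ^+ 2 =
    (\sum_a smooth l x a ^+ 2 + \sum_a smooth l x (a - jump p.1 p.2 x) ^+ 2) / 2.
  by rewrite h; field.
rewrite -big_split /= /var !mulr_suml -sumrB.
by apply: eq_bigr => a _; field.
Qed.

(* A swap with a coordinate [h] of opposite sign turns an unmixed pair into a mixed one. *)
Lemma mixed_weight (g : cube -> R) i j (J : seq 'I_n) (nu : R) :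
  i != j -> 0 < nu -> (forall x, 0 <= g x) ->
  (forall h x, h \notin J -> g (swap i h x) = g x) ->
  (forall x (s : bool), x \in Om ->
     nu * n%:R <= #|[set h | [&& h \notin J, h != i, h != j & x h == s]]|%:R) ->
  \sum_(x in Om) g x <= (1 + nu^-1) * \sum_(x in Om | x i != x j) g x.
Proof.
move=> ij nu0 g0 gS cnt.
rewrite (bigID (fun x => x i != x j)) /= mulrDl mul1r lerD2l.
rewrite ler_pdivlMl // mulr_sumr.
have n0 : 0 < n%:R :> R by rewrite ltr0n (leq_trans _ (ltn_ord i)).
rewrite -(ler_pM2l n0) mulr_sumr.
pose H x := [set h | [&& h \notin J, h != i, h != j & x h == ~~ x i]].
apply: le_trans (_ : \sum_(x in Om | ~~ (x i != x j)) \sum_(h in H x) g x <= _).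
  apply: ler_sum => x /andP[xO _]; rewrite sumr_const -[leRHS]mulr_natl mulrA.
  by rewrite ler_wpM2r // mulrC; apply: cnt.
rewrite (exchange_big_dep predT) //= mulr_natl -[X in _ *+ X](card_ord n) -sumr_const.
apply: ler_sum => h _; have [hJ|hJ] := boolP (h \in J).
  by rewrite big_pred0 ?sumr_ge0 // => x; rewrite inE hJ !andbF.
rewrite (reindex_inj (inv_inj (swapK i h))) /=.
rewrite [leLHS](eq_bigr g) => [|x _]; last exact: gS.
rewrite big_mkcond [leRHS]big_mkcond; apply: ler_sum => x _.
case: ifP => [|_]; last by case: ifP.
rewrite OmS inE !ffunE tpermL tpermR => /andP[/andP[-> /negbNE/eqP e1] /and4P[_ hi hj /eqP e2]].
by move: e1; rewrite tpermD // 1?eq_sym // e2 => ->; case: (x j).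
Qed.

(** The convolution of two smoothed profiles at [walk x - c], summed over the slice. For empty lists
    and the indicator of a box it detects the [x] whose walk is close to [c]. *)
Definition corr l1 l2 c : R :=
  \sum_(x in Om) \sum_a smooth l1 x a * smooth l2 x (walk x - c - a).

Lemma corr_sym l1 l2 c : corr l1 l2 c = corr l2 l1 c.
Proof.
apply: eq_bigr => x _; rewrite -[LHS](sum_reflect _ (walk x - c)).
by apply: eq_bigr => a _; rewrite mulrC opprB addrC subrK.
Qed.

(** The swap of [p] permutes the slice, fixes both profiles and translates the walk by the jump. So
    the two halves of the averaged profile contribute equally. *)
Lemma corr_cons p l1 l2 c : p.1 != p.2 ->
  p.1 \notin used l1 ++ used l2 -> p.2 \notin used l1 ++ used l2 ->
  corr (p :: l1) l2 c = corr l1 l2 c.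
Proof.
rewrite !(mem_cat _ (used l1)) !negb_or => pp /andP[p11 p12] /andP[p21 p22].
have e : corr l1 l2 c =
    \sum_(x in Om) \sum_a smooth l1 x (a - jump p.1 p.2 x) * smooth l2 x (walk x - c - a).
  rewrite /corr (reindex_inj (inv_inj (swapK p.1 p.2))) /=.
  under eq_bigl do rewrite OmS.
  apply: eq_bigr => x _; rewrite -[LHS](sum_shift _ (jump p.1 p.2 x)).
  apply: eq_bigr => a _; rewrite walk_swap // !smooth_swap //.
  by congr (_ * smooth _ _ _); rewrite opprB addrA [_ - c + _]addrAC subrK.
transitivity ((corr l1 l2 c + corr l1 l2 c) / 2); last by field.
rewrite {2}e -big_split /= mulr_suml.
apply: eq_bigr => x _; rewrite -big_split /= mulr_suml; apply: eq_bigr => a _.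
by rewrite mulrAC mulrDl.
Qed.

Lemma corr_wf l1 l2 c : wf (l1 ++ l2) -> corr l1 l2 c = corr [::] [::] c.
Proof.
have used_cat l l' : used (l ++ l') =i used l ++ used l'.
  by move=> i; rewrite /used /unzip1 /unzip2 !map_cat !mem_cat orbACA.
elim: l1 => [|p l1 IH] /=; last first.
  by move=> [h1 h2 h3 /IH <-]; apply: corr_cons => //; rewrite -used_cat.
elim: l2 => //= p l2 IH [h1 h2 h3 /IH <-].
by rewrite corr_sym corr_cons ?cats0 // corr_sym.
Qed.

Lemma corr_le l1 l2 c (t : R) : 0 < t ->
  corr l1 l2 c <= (t * energy l1 + energy l2 / t) / 2.
Proof.
move=> t0; rewrite /energy mulr_sumr mulr_suml -big_split /= mulr_suml.
apply: ler_sum => x _.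
rewrite -(sum_reflect (fun a => smooth l2 x a ^+ 2) (walk x - c)).
rewrite mulr_sumr mulr_suml -big_split /= mulr_suml; apply: ler_sum => a _.
set u := smooth _ _ _; set v := smooth _ _ _.
have : 0 <= (t * u - v) ^+ 2 / t by rewrite divr_ge0 ?sqr_ge0 // ltW.
have -> : (t * u - v) ^+ 2 / t = t * u ^+ 2 + v ^+ 2 / t - 2 * (u * v).
  by field; rewrite gt_eqF.
lra.
Qed.

Lemma evar0 l : evar l 0 = 0.
Proof.
by apply: big1 => x _; apply: big1 => a _; rewrite subr0 subrr expr0n.
Qed.

Lemma evarN l b : evar l (- b) = evar l b.
Proof. by apply: eq_bigr => x _; rewrite varN. Qed.

(** The root of [evar] is an l2 distance between a profile and its translate, so it is subadditive,
    and the squares grow quadratically with the number of terms. *)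
Lemma evar_sum l (s : seq G) (K : R) : (forall b, b \in s -> evar l b <= K) ->
  evar l (\sum_(b <- s) b) <= (size s)%:R ^+ 2 * K.
Proof.
elim: s => [|b s IH] h; first by rewrite big_nil evar0 expr0n mul0r.
rewrite big_cons; have hb := h b (mem_head _ _).
have {}IH := IH (fun b' hb' => h b' (mem_behead (s := b :: s) hb')).
case: s IH {h} => [_|b' s]; first by rewrite big_nil addr0 expr1n mul1r.
set m := (size (b' :: s))%:R; set z := \sum_(_ <- _) _ => IH.
have m0 : 0 < m by rewrite ltr0n.
(* The weights are chosen so that [(1 + m) + (1 + 1/m) m^2 = (1 + m)^2]. *)
have key : evar l (b + z) <= (1 + m) * evar l b + (1 + m^-1) * evar l z.
  rewrite /evar !mulr_sumr -big_split; apply: ler_sum => x _ /=; rewrite /var.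
  rewrite -[X in _ + _ * X](sum_shift _ b) !mulr_sumr -big_split.
  apply: ler_sum => a _ /=; rewrite -addrA -opprD.
  set u := smooth _ _ _; set v := smooth _ _ (a - b); set t := smooth _ _ _.
  have : 0 <= (m * (u - v) - (v - t)) ^+ 2 / m by rewrite divr_ge0 ?sqr_ge0 // ltW.
  have -> : (m * (u - v) - (v - t)) ^+ 2 / m =
     m * (u - v) ^+ 2 + (v - t) ^+ 2 / m - 2 * ((u - v) * (v - t)).
    by field; rewrite gt_eqF.
  lra.
apply: le_trans key _; rewrite [(size _)%:R](_ : _ = 1 + m); last by rewrite -natr1 addrC.
apply: le_trans (lerD (ler_wpM2l _ hb) (ler_wpM2l _ IH)) _.
- by rewrite addr_ge0 // ltW.
- by rewrite addr_ge0 // invr_ge0 ltW.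
by rewrite le_eqVlt; apply/orP; left; apply/eqP; field; rewrite gt_eqF.
Qed.

Lemma energy_ge0 l : 0 <= energy l.
Proof. by apply: sumr_ge0 => x _; apply: sumr_ge0 => a _; exact: sqr_ge0. Qed.

(** The share of mixed configurations guaranteed by [mixed_weight], times the [1/4] of
    [energy_step]. *)
Definition gain (nu : R) : R := (1 + nu^-1)^-1 / 4.

Lemma gain_gt0 nu : 0 < nu -> 0 < gain nu.
Proof. by move=> h; rewrite /gain divr_gt0 // invr_gt0 addr_gt0 // invr_gt0. Qed.

Lemma energy_decrease i j l (nu kappa : R) : i != j ->
  i \notin used l -> j \notin used l -> 0 < nu ->
  (forall x (s : bool), x \in Om ->
     nu * n%:R <= #|[set h | [&& h \notin used l, h != i, h != j & x h == s]]|%:R) ->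
  kappa * energy l < evar l ((w i - w j) *~ 2) ->
  energy ((i, j) :: l) <= (1 - gain nu * kappa) * energy l.
Proof.
move=> ij il jl nu0 cnt hk; rewrite energy_step /=.
have nu1 : 0 < 1 + nu^-1 by rewrite addr_gt0 // invr_gt0.
have h : evar l ((w i - w j) *~ 2) <=
    (1 + nu^-1) * \sum_(x in Om) var l x (jump i j x).
  apply: le_trans (_ : _ <= (1 + nu^-1) * \sum_(x in Om | x i != x j) var l x ((w i - w j) *~ 2)) _.
    apply: (mixed_weight (J := used l)) => // [x|h x hl]; first exact: var_ge0.
    by apply: eq_bigr => a _; rewrite !smooth_swap.
  rewrite ler_pM2l // big_mkcondr; apply: ler_sum => x _.
  case: ifP => [xij|_]; last exact: var_ge0.
  rewrite /jump; case: (x i) (x j) xij => [] [] //= _.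
  by rewrite (_ : - 1 - 1 = - 2) // mulrNz varN.
have {h} h := le_trans (ltW hk) h.
have : kappa * energy l * (1 + nu^-1)^-1 <= \sum_(x in Om) var l x (jump i j x).
  by rewrite ler_pdivrMr // [leRHS]mulrC.
rewrite /gain; lra.
Qed.

Lemma card_avoid (s : seq 'I_n) (A : {set 'I_n}) :
  (#|A| <= #|[set h in A | h \notin s]| + size s)%N.
Proof.
rewrite -(cardsID [set h | h \in s] A) addnC leq_add //.
  by apply: subset_leq_card; apply/fintype.subsetP => h; rewrite !inE andbC.
apply: leq_trans (card_size s); apply: subset_leq_card; apply/fintype.subsetP => h.
by rewrite !inE => /andP[].
Qed.

Lemma size_used l : size (used l) = (2 * size l)%N.
Proof. by rewrite /used size_cat !size_map; lia. Qed.

Definition terminal (kappa : R) (F : seq 'I_n) l : Prop :=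
  forall i j, i != j -> i \notin used l ++ F -> j \notin used l ++ F ->
    evar l ((w i - w j) *~ 2) <= kappa * energy l.

(** [F] reserves the indices of a previous extraction. The summand [2 * T + 2] covers the
    coordinates already in use and the two of the new pair, so that [nu * n] coordinates of each
    sign stay free for [mixed_weight]. *)
Lemma greedy (F : seq 'I_n) (T : nat) (nu kappa : R) :
  0 < nu -> gain nu * kappa <= 1 ->
  (forall x (s : bool), x \in Om ->
     nu * n%:R + (2 * T + 2)%:R <= #|[set h | x h == s]|%:R) ->
  (exists l, [/\ wf l, {in used l, forall i, i \notin F}, (size l <= T)%N & terminal kappa F l]) \/
  (exists l, [/\ wf l, {in used l, forall i, i \notin F}, size l = T &
     energy l <= (1 - gain nu * kappa) ^+ T * energy [::]]).
Proof.
move=> nu0 gk cnt.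
suff H t : (t <= T)%N -> (exists l, [/\ wf l, {in used l, forall i, i \notin F}, (size l <= T)%N & terminal kappa F l]) \/
  (exists l, [/\ wf l, {in used l, forall i, i \notin F}, size l = t &
     energy l <= (1 - gain nu * kappa) ^+ t * energy [::]]) by exact: H.
elim: t => [_|t IH tT]; first by right; exists [::]; split => //; rewrite expr0 mul1r.
have [|[l [wl lF sl el]]] := IH (ltnW tT); first by left.
have [tl|tl] := pselect (terminal kappa F l).
  by left; exists l; split => //; rewrite sl ltnW.
right; have [i [j [ij iF jF hk]]] : exists i j, [/\ i != j, i \notin used l ++ F,
    j \notin used l ++ F & kappa * energy l < evar l ((w i - w j) *~ 2)].
  apply: contrapT => h; apply: tl => i j ij iF jF; rewrite leNgt; apply/negP => hk.
  by apply: h; exists i, j.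
move: iF jF; rewrite !(mem_cat _ (used l)) !negb_or => /andP[il iF] /andP[jl jF].
exists ((i, j) :: l); split => //=.
- by move=> k; rewrite used_cons !inE => /or3P[/eqP ->|/eqP ->|/lF].
- by rewrite sl.
have -> : (1 - gain nu * kappa) ^+ t.+1 * energy [::] =
    (1 - gain nu * kappa) * ((1 - gain nu * kappa) ^+ t * energy [::]) by rewrite exprS mulrA.
apply: le_trans (energy_decrease (nu := nu) (kappa := kappa) _ _ _ _ _ _) _ => //; last first.
  by rewrite ler_wpM2l // subr_ge0.
move=> x s xO; have := cnt x s xO.
have := card_avoid (i :: j :: used l) [set h | x h == s].
rewrite /= size_used sl -(ler_nat R) natrD => h1 h2.
have : [set h in [set h | x h == s] | h \notin [:: i, j & used l]] =
    [set h | [&& h \notin used l, h != i, h != j & x h == s]].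
  by apply/setP => h; rewrite !inE !negb_or; do !case: (_ \in _); do !case: (_ == _).
move=> <-; have : ((2 * t).+2 <= 2 * T + 2)%N by rewrite addn2 !ltnS leq_mul2l ltnW.
rewrite -(ler_nat R); lra.
Qed.

Lemma wf_cat l l' : wf l -> wf l' -> {in used l, forall i, i \notin used l'} -> wf (l ++ l').
Proof.
elim: l => //= p l IH [h1 h2 h3 wl] wl' h.
have used_cat : used (l ++ l') =i used l ++ used l'.
  by move=> i; rewrite /used /unzip1 /unzip2 !map_cat !mem_cat orbACA.
split => //; rewrite ?used_cat ?(mem_cat _ (used l)) ?negb_or ?h2 ?h3 ?h //.
- by rewrite used_cons mem_head.
- by rewrite used_cons !inE eqxx orbT.
by apply: IH => // i il; apply: h; rewrite used_cons !inE il !orbT.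
Qed.

Hypotheses (p0_ge0 : forall a, 0 <= p0 a) (p0_sq : forall a, p0 a ^+ 2 = p0 a).

Definition mass : R := #|Om|%:R * \sum_a p0 a.

Lemma energy_nil : energy [::] = mass.
Proof.
rewrite /energy /mass mulr_natl -sumr_const; apply: eq_bigr => x _.
by apply: eq_bigr => a _ /=; rewrite p0_sq.
Qed.

(** The inner product of the profile with its translate by [z] is [energy l - evar l z / 2], at
    least half the energy. The translates by [Z] add up pointwise to at most 1, so all these inner
    products together are at most the mass. *)
Lemma separated_bound l (Z : seq G) :
  (forall y, \sum_(z <- Z) p0 (y - z) <= 1) ->
  (forall z, z \in Z -> evar l z <= energy l) ->
  (size Z)%:R * energy l <= 2 * mass.
Proof.
move=> cZ hZ; pose K z := \sum_(x in Om) \sum_a smooth l x a * smooth l x (a - z).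
have hK z : K z = energy l - evar l z / 2.
  rewrite /energy /evar mulr_suml -sumrB; apply: eq_bigr => x _; rewrite /var.
  have h := sum_shift (fun a => smooth l x a ^+ 2) z.
  have {h} -> : \sum_a smooth l x a ^+ 2 =
      (\sum_a smooth l x a ^+ 2 + \sum_a smooth l x (a - z) ^+ 2) / 2 by rewrite h; field.
  rewrite -big_split /= !mulr_suml -sumrB.
  by apply: eq_bigr => a _; field.
have h1 : (size Z)%:R * (energy l / 2) <= \sum_(z <- Z) K z.
  rewrite mulr_natl -iter_addr_0 -[X in iter X](count_predT Z) -big_const_seq.
  rewrite big_seq [leRHS]big_seq; apply: ler_sum => z /hZ; rewrite hK; lra.
suff : \sum_(z <- Z) K z <= mass by lra.
rewrite /K exchange_big /= /mass mulr_natl -sumr_const; apply: ler_sum => x _.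
rewrite exchange_big /= -(smooth_sum l x); apply: ler_sum => a _.
rewrite -mulr_sumr ler_piMr ?smooth_ge0 //; exact: smooth_cover.
Qed.

(* Two lists of pairs are extracted one after the other, so that the
   correlation bounds the concentration by the product of two l2 norms, hence
   by an energy rather than by its square root. *)
Lemma energy_inverse (nu kappa rho : R) (T : nat) c0 :
  0 < nu -> 0 < kappa -> gain nu * kappa <= 1 -> 0 < rho -> 0 < mass ->
  (forall x (s : bool), x \in Om ->
     nu * n%:R + (2 * T + 2)%:R <= #|[set h | x h == s]|%:R) ->
  rho * mass <= 4 * corr [::] [::] c0 ->
  (1 - gain nu * kappa) ^+ T < rho ^+ 2 / 16 ->
  exists W : {set 'I_n}, (n <= #|W| + 4 * T)%N /\
    forall (m : nat) i0 (Z : seq G), i0 \in W -> m%:R ^+ 2 * kappa <= 1 ->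
      (forall y, \sum_(z <- Z) p0 (y - z) <= 1) ->
      (forall z, z \in Z -> exists c : {ffun 'I_n -> int},
         [/\ forall i, i \notin W -> c i = 0, (wt c <= m)%N &
             z = lin (fun i => (w i - w i0) *~ 2) c]) ->
      (size Z)%:R * rho <= 8.
Proof.
move=> nu0 k0 gk rho0 mass0 cnt hcorr hT.
(* The weight [t = 4 / rho] makes the second term of [corr_le] absorb exactly half of the lower
   bound on the correlation, which leaves [energy l >= rho^2 mass / 16]. *)
have lower l : wf l -> ~ energy l <= (1 - gain nu * kappa) ^+ T * energy [::].
  move=> wl; rewrite energy_nil => h.
  have : corr l [::] c0 = corr [::] [::] c0 by apply: corr_wf; rewrite cats0.
  have r4 : 0 < 4 / rho by rewrite divr_gt0.
  have := corr_le l [::] c0 r4; rewrite energy_nil => h1 h2; rewrite h2 in h1.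
  have h3 : rho * (4 / rho * energy l) = 4 * energy l by field; rewrite gt_eqF.
  have h4 : rho * (mass / (4 / rho)) = mass * (rho ^+ 2 / 4) by field; rewrite gt_eqF.
  have := ler_wpM2l (ltW rho0) h1; have := ler_wpM2l (ltW rho0) hcorr.
  have : (1 - gain nu * kappa) ^+ T * mass < rho ^+ 2 / 16 * mass by rewrite ltr_pM2r.
  nra.
have [[l1 [wl1 _ sl1 tl1]]|[l1 [wl1 _ _ el1]]] := greedy [::] nu0 gk cnt; last by case: (lower _ wl1).
have [[l2 [wl2 l21 sl2 tl2]]|[l2 [wl2 _ _ el2]]] := greedy (used l1) nu0 gk cnt; last by case: (lower _ wl2).
have wl : wf (l2 ++ l1) by exact: wf_cat.
exists [set i | i \notin used l2 ++ used l1]; split.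
  have := card_avoid (used l2 ++ used l1) finset.setT.
  rewrite cardsT card_ord size_cat !size_used => h; apply: leq_trans h _.
  apply: leq_add; last by lia.
  by apply: subset_leq_card; apply/fintype.subsetP => h; rewrite !inE.
set W := [set _ | _] => m i0 Z i0W mk cZ hZ.
(* A sum of at most [m] differences has [evar] at most [m^2 kappa] times the energy, so at most the
   energy, as [separated_bound] requires. *)
have bound l F : terminal kappa F l -> {subset used l ++ F <= used l2 ++ used l1} ->
    (size Z)%:R * energy l <= 2 * mass.
  move=> tl lF; apply: separated_bound => // z /hZ[c [cW cm ->]].
  have [s [ss -> hs]] := lin_as_seq (fun i => (w i - w i0) *~ 2) c.
  have hW i : i \in W -> i \notin used l ++ F by rewrite inE; apply: contra => /lF.
  apply: le_trans (evar_sum (K := kappa * energy l) _) _.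
    move=> b /hs[i ci]; have iW : i \in W by apply: contraR ci => /cW ->.
    suff h : evar l ((w i - w i0) *~ 2) <= kappa * energy l by case=> ->; rewrite ?evarN.
    have [->|ii] := eqVneq i i0; last by apply: tl => //; exact: hW.
    by rewrite subrr mul0rz evar0 mulr_ge0 ?energy_ge0 // ltW.
  rewrite mulrA ler_piMl ?energy_ge0 //; apply: le_trans mk.
  by rewrite ler_wpM2r ?(ltW k0) // lerXn2r ?nnegrE // ss ler_nat.
have b1 : (size Z)%:R * energy l1 <= 2 * mass.
  by apply: bound tl1 _ => i; rewrite cats0 (mem_cat _ (used l2)) => ->; rewrite orbT.
have b2 : (size Z)%:R * energy l2 <= 2 * mass by exact: bound tl2 _.
have := corr_le l2 l1 c0 ltr01; rewrite mul1r divr1 (corr_wf _ wl) => hc.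
have : (size Z)%:R * (rho * mass) <= 8 * mass.
  apply: le_trans (ler_wpM2l _ (le_trans hcorr (ler_wpM2l _ hc))) _ => //; lra.
by rewrite mulrA ler_pM2r.
Qed.

End Energy.

(** * Concentration of integer vectors on a slice *)

HB.instance Definition _ (G1 G2 : finZmodType) := GRing.Zmodule.on (G1 * G2)%type.

Section Box.
Variables (R : realType) (G : finZmodType) (u : G) (h : nat).

Definition in_box (a : G) : bool := `[< exists e : int, (`|e| <= h)%N /\ a = u *~ e >].

Lemma in_boxP a : reflect (exists e : int, (`|e| <= h)%N /\ a = u *~ e) (in_box a).
Proof. exact: asboolP. Qed.

Definition half_box (s : int) (a : G) : bool :=
  `[< exists e : nat, (e <= h)%N /\ a = u *~ (s * e%:Z) >].

(** Subtracting from [e0] any [k <= h] with the sign of [e0] stays in the interval, so a half box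
    contributes in full; by reflection it has at least half the elements. Group elements are
    counted, so coinciding multiples do no harm. *)
Lemma box_dense e0 : (`|e0| <= h)%N ->
  \sum_a (in_box a)%:R <= 2 * \sum_a (in_box a)%:R * (in_box (u *~ e0 - a))%:R :> R.
Proof.
move=> he0.
have [s [s1 hs]] : exists s : int, (s = 1 \/ s = -1) /\
    forall k : nat, (k <= h)%N -> (absz (e0 - s * k%:Z)%R <= h)%N.
  by case: (lerP 0 e0) => e; [exists 1|exists (-1)]; split; auto; lia.
have half : \sum_a (in_box a)%:R <= 2 * \sum_a (half_box s a)%:R :> R.
  have e : \sum_a (half_box s a)%:R = \sum_a (half_box (- s) a)%:R :> R.
    rewrite (reindex_inj oppr_inj); apply: eq_bigr => a _; congr (nat_of_bool _)%:R.
    apply/asboolP/asboolP => -[k [hk ea]]; exists k; split => //.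
      by rewrite -[a]opprK ea mulNr mulrNz.
    by rewrite ea mulNr mulrNz opprK.
  rewrite mulr2n mulrDl mul1r {2}e -big_split ler_sum //= => a _.
  case: in_boxP => [[k [hk ->]]|_]; last by rewrite addr_ge0.
  have [k0|k0] : s * `|k|%N = k \/ - s * `|k|%N = k by case: s1 => ->; lia.
    have -> : half_box s (u *~ k) by apply/asboolP; exists `|k|%N; rewrite k0.
    by rewrite lerDl.
  have -> : half_box (- s) (u *~ k) by apply/asboolP; exists `|k|%N; rewrite k0.
  by rewrite lerDr.
apply: (le_trans half); rewrite ler_wpM2l // ler_sum // => a _.
rewrite /half_box; case: asboolP => [[k [hk ->]]|_]; last by rewrite mulr_ge0.
have -> : in_box (u *~ (s * k)) by apply/in_boxP; exists (s * k); split => //; case: s1 => ->; lia.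
rewrite -mulrzBr; suff -> : in_box (u *~ (e0 - s * k)) by rewrite mulr1.
by apply/in_boxP; exists (e0 - s * k); split => //; exact: hs.
Qed.

Lemma box_sum_gt0 : 0 < \sum_a (in_box a)%:R :> R.
Proof.
rewrite (bigD1 0) //= ltr_pwDl ?sumr_ge0 //.
by have -> : in_box 0 by apply/in_boxP; exists 0.
Qed.

Definition in_box2 (a : G * G) : bool := in_box a.1 && in_box a.2.

Lemma sum_prod (f g : G -> R) : \sum_(a : G * G) f a.1 * g a.2 = (\sum_a f a) * \sum_a g a.
Proof.
rewrite -(pair_bigA _ (fun a b => f a * g b)) /= mulr_suml.
by apply: eq_bigr => a _; rewrite mulr_sumr.
Qed.

Lemma natr_andb (b1 b2 : bool) : (b1 && b2)%:R = b1%:R * b2%:R :> R.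
Proof. by case: b1 b2 => [] []; rewrite ?mulr1 ?mulr0. Qed.

Lemma box2_sum_gt0 : 0 < \sum_a (in_box2 a)%:R :> R.
Proof.
under eq_bigr do rewrite natr_andb.
by rewrite (sum_prod (fun a => (in_box a)%:R) (fun a => (in_box a)%:R)) mulr_gt0 ?box_sum_gt0.
Qed.

Lemma box2_dense z : in_box2 z ->
  \sum_a (in_box2 a)%:R <= 4 * \sum_a (in_box2 a)%:R * (in_box2 (z - a))%:R :> R.
Proof.
case: z => z1 z2 /andP[/in_boxP[e1 [h1 /= ->]] /in_boxP[e2 [h2 /= ->]]].
under eq_bigr do rewrite natr_andb.
rewrite (sum_prod (fun a => (in_box a)%:R) (fun a => (in_box a)%:R)).
rewrite [X in _ <= _ * X](_ : _ = (\sum_a (in_box a)%:R * (in_box (u *~ e1 - a))%:R) *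
  \sum_a (in_box a)%:R * (in_box (u *~ e2 - a))%:R); last first.
  by rewrite -sum_prod; apply: eq_bigr => a _; rewrite !natr_andb mulrACA.
have d1 := box_dense h1; have d2 := box_dense h2.
have := ler_pM (ltW box_sum_gt0) (ltW box_sum_gt0) d1 d2; lra.
Qed.

End Box.

Definition nrm (z : int * int) : nat := maxn `|z.1| `|z.2|.

Lemma nrm_leP z (k : nat) : (nrm z <= k)%N <-> (`|z.1| <= k)%N /\ (`|z.2| <= k)%N.
Proof. by rewrite /nrm geq_max; split=> [/andP|[-> ->]]. Qed.

Lemma nrmD z z' : (nrm (z + z')%R <= nrm z + nrm z')%N.
Proof.
have /nrm_leP[h1 h2] := leqnn (nrm z); have /nrm_leP[h3 h4] := leqnn (nrm z').
by apply/nrm_leP; split; [move: h1 h3|move: h2 h4] => /=; lia.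
Qed.

Lemma nrmN z : nrm (- z) = nrm z.
Proof. by rewrite /nrm /= !abszN. Qed.

Lemma pairMz (A1 A2 : zmodType) (z : A1 * A2) (k : int) : z *~ k = (z.1 *~ k, z.2 *~ k).
Proof.
have e (m : nat) : z *+ m = (z.1 *+ m, z.2 *+ m).
  by elim: m => [|m IH]; rewrite ?mulr0n // !mulrS IH.
by case: k => k; rewrite ?NegzE ?mulrNz -!pmulrn e.
Qed.

Lemma nrmMz z k : nrm (z *~ k) = (`|k| * nrm z)%N.
Proof. by rewrite /nrm pairMz /= !mulrzz !abszM mulnC (mulnC `|z.2|)%N maxnMr mulnC. Qed.

Lemma nrm_sum (I : Type) (s : seq I) (f : I -> int * int) :
  (nrm (\sum_(i <- s) f i)%R <= \sum_(i <- s) nrm (f i))%N.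
Proof.
elim/big_rec2: _ => //= i a b _ h; apply: leq_trans (nrmD _ _) _.
by rewrite leq_add2l.
Qed.

Lemma nrm_lin (I : finType) (y : I -> int * int) (c : {ffun I -> int}) (M : nat) :
  (forall i, nrm (y i) <= M)%N -> (nrm (lin y c) <= wt c * M)%N.
Proof.
move=> h; apply: leq_trans (nrm_sum _ _) _; rewrite /wt big_distrl leq_sum //= => i _.
by rewrite nrmMz leq_mul2l h orbT.
Qed.

Definition separated (h : nat) (Z : seq (int * int)) : Prop :=
  uniq Z /\ {in Z &, forall z z', z != z' -> (h < nrm (z - z')%R)%N}.

Lemma sumvecs_swap n sbar i j x : (swap i j x \in sumvecs n sbar) = (x \in sumvecs n sbar).
Proof.
rewrite !inE; congr (_ == _); rewrite [RHS](reindex_inj (@perm_inj _ (tperm i j))) /=.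
by apply: eq_bigr => k _; rewrite ffunE.
Qed.

Lemma sum_le1 (R : realType) (T : eqType) (s : seq T) (f : T -> bool) : uniq s ->
  {in s &, forall z z', f z -> f z' -> z = z'} -> \sum_(z <- s) (f z)%:R <= 1 :> R.
Proof.
elim: s => [|z s IH] /=; first by rewrite big_nil.
move=> /andP[zs us] h; rewrite big_cons; case: (boolP (f z)) => fz; last first.
  by rewrite add0r IH // => a b sa sb; apply: h; rewrite inE ?sa ?sb orbT.
rewrite big_seq big1 ?addr0 // => a sa; case: (boolP (f a)) => // fa.
by move: zs; rewrite (h z a) ?mem_head ?inE ?sa ?orbT.
Qed.

Lemma Zp_intr_eq0 (M : nat) (e : int) : (`|e| < M.+2)%N -> (1 : 'I_M.+2) *~ e = 0 -> e = 0.
Proof.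
move=> he h; have {h} : (`|e|%N)%:R = 0 :> 'I_M.+2.
  case: e h {he} => k; first by [].
  by rewrite NegzE mulrNz => /eqP; rewrite oppr_eq0 => /eqP.
by rewrite Zp_nat => /(congr1 val) /=; rewrite modn_small // => /eqP; rewrite absz_eq0 => /eqP.
Qed.

(** Reduction to a finite group, where sums over all translates are finite and can be reindexed. *)
Definition red (M : nat) (z : int * int) : 'I_M.+2 * 'I_M.+2 := (1 *~ z.1, 1 *~ z.2).

Lemma red_is_zmod_morphism M : zmod_morphism (red M).
Proof. by move=> z z'; rewrite /red /= !mulrzBr. Qed.
HB.instance Definition _ M :=
  GRing.isZmodMorphism.Build _ _ (red M) (red_is_zmod_morphism M).

(** Swaps move the walk by twice a difference. Boxes of half-width [h] around [2z] and [2z'] that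
    meet give [|2(z - z')| <= 2h], so the factor 2 cancels against the two boxes. *)
Lemma red_diff (M h : nat) z (y : 'I_M.+2 * 'I_M.+2) z' :
  (2 * nrm z + 2 * nrm z' + 2 * h < M.+2)%N ->
  in_box2 1 h (y - red M z *~ 2) -> in_box2 1 h (y - red M z' *~ 2) -> (nrm (z - z')%R <= h)%N.
Proof.
have key (a b e e' : int) (t : 'I_M.+2) : (2 * `|a| + 2 * `|b| + 2 * h < M.+2)%N ->
    (`|e| <= h)%N -> (`|e'| <= h)%N ->
    t - 1 *~ a *~ 2 = 1 *~ e -> t - 1 *~ b *~ 2 = 1 *~ e' -> (absz (a - b)%R <= h)%N.
  move=> hM he he' e1 e2.
  suff : 2 * (a - b) + (e - e') = 0 by lia.
  apply: (@Zp_intr_eq0 M); first by lia.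
  have E : (1 : 'I_M.+2) *~ (e - e') = 1 *~ b *~ 2 - 1 *~ a *~ 2.
    by rewrite mulrzBr -e1 -e2 opprB addrC subrKA.
  by rewrite mulrzDr E mulrC mulrzA mulrzBr mulrzBl subrKA subrr.
move=> hM /andP[/in_boxP[e1 [h1 E1]] /in_boxP[e2 [h2 E2]]].
move=> /andP[/in_boxP[e3 [h3 E3]] /in_boxP[e4 [h4 E4]]].
have /nrm_leP[g1 g2] := leqnn (nrm z); have /nrm_leP[g3 g4] := leqnn (nrm z').
have {}E1 : y.1 - 1 *~ z.1 *~ 2 = 1 *~ e1 by rewrite -E1 pairMz.
have {}E2 : y.2 - 1 *~ z.2 *~ 2 = 1 *~ e2 by rewrite -E2 pairMz.
have {}E3 : y.1 - 1 *~ z'.1 *~ 2 = 1 *~ e3 by rewrite -E3 pairMz.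
have {}E4 : y.2 - 1 *~ z'.2 *~ 2 = 1 *~ e4 by rewrite -E4 pairMz.
apply/nrm_leP; split.
  by apply: key h1 h3 E1 E3; apply: leq_ltn_trans hM; rewrite !leq_add ?leq_mul.
by apply: key h2 h4 E2 E4; apply: leq_ltn_trans hM; rewrite !leq_add ?leq_mul.
Qed.

Section IntInverse.
Variables (R : realType) (n : nat) (sbar : int) (w : 'I_n -> int * int).

Definition iwalk (x : {ffun 'I_n -> bool}) : int * int := \sum_i w i *~ sgn (x i).

Lemma int_inverse (h T : nat) (nu kappa rho : R) (c0 : int * int) :
  0 < nu -> 0 < kappa -> gain nu * kappa <= 1 -> 0 < rho ->
  (0 < #|sumvecs n sbar|)%N ->
  (forall x (s : bool), x \in sumvecs n sbar ->
     nu * n%:R + (2 * T + 2)%:R <= #|[set k | x k == s]|%:R) ->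
  rho * #|sumvecs n sbar|%:R <=
    #|[set x in sumvecs n sbar | (nrm (iwalk x - c0)%R <= h)%N]|%:R ->
  (1 - gain nu * kappa) ^+ T < rho ^+ 2 / 16 ->
  exists W : {set 'I_n}, (n <= #|W| + 4 * T)%N /\
    forall (m : nat) i0 (Z : seq (int * int)), i0 \in W -> m%:R ^+ 2 * kappa <= 1 ->
      separated h Z ->
      (forall z, z \in Z -> exists c : {ffun 'I_n -> int},
         [/\ forall i, i \notin W -> c i = 0, (wt c <= m)%N &
             z = lin (fun i => w i - w i0) c]) ->
      (size Z)%:R * rho <= 8.
Proof.
move=> nu0 k0 gk rho0 Om0 cnt hconc hT.
(* The modulus has to be fixed before [m] is known; [m <= m^2 <= 1/kappa] makes [mm] a uniform bound
   for it. *)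
pose mm := Num.truncn kappa^-1; pose Wm := (\sum_i nrm (w i))%N.
(* [M] is so large that nothing below wraps around modulo [M + 2]. *)
pose M := (8 * (mm * (2 * Wm)) + 4 * h)%N.
pose w' := red M \o w.
pose p0 (a : 'I_M.+2 * 'I_M.+2) : R := (in_box2 1 h a)%:R.
have OmS := @sumvecs_swap n sbar.
have mass0 : 0 < mass (sumvecs n sbar) p0.
  by rewrite /mass mulr_gt0 ?ltr0n //; exact: box2_sum_gt0.
have walkE x : walk w' x = red M (iwalk x).
  by rewrite /walk /iwalk raddf_sum; apply: eq_bigr => i _; rewrite raddfMz.
(* Each [x] counted by the concentration hypothesis puts [walk x - c0] in the box, where the box
   convolved with itself is at least a quarter of its mass. *)
have hcorr : rho * mass (sumvecs n sbar) p0 <= 4 * corr w' (sumvecs n sbar) p0 [::] [::] (red M c0).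
  rewrite /mass mulrA; apply: le_trans (ler_wpM2r _ hconc) _.
    by apply: sumr_ge0.
  rewrite [leLHS]mulr_natl -sumr_const /corr [leRHS]mulr_sumr (eq_bigl _ _ (fun x => finset.in_set _ x)) big_mkcondr /=.
  apply: ler_sum => x _; case: ifP => [hx|_]; last first.
    by rewrite mulr_ge0 // sumr_ge0 // => a _; rewrite mulr_ge0.
  apply: box2_dense; rewrite walkE -raddfB; have /nrm_leP[h1 h2] := hx.
  by apply/andP; split; apply/in_boxP; [exists (iwalk x - c0).1|exists (iwalk x - c0).2].
have [a|a|W [cW hW]] := @energy_inverse R n _ w' _ p0 OmS _ _ nu kappa rho T _ nu0 k0 gk rho0 mass0 cnt hcorr hT.
- exact: ler0n.
- by rewrite /p0; case: (in_box2 _ _ _); rewrite ?expr1n ?expr0n.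
exists W; split => // m i0 Z i0W mk [uZ sZ] hZ.
rewrite -(size_map (fun z => red M z *~ 2)); apply: (hW m i0) => //; last first.
  move=> _ /mapP[z /hZ[c [c1 c2 ->]] ->]; exists c; split => //.
  rewrite /lin raddf_sum mulrz_suml; apply: eq_bigr => i _.
  by rewrite raddfMz raddfB -!mulrzA mulrC.
have leW i : (nrm (w i) <= Wm)%N by rewrite /Wm (bigD1 i) //= leq_addr.
have nz z : z \in Z -> (nrm z <= mm * (2 * Wm))%N.
  move=> /hZ[c [_ cm ->]]; apply: leq_trans (nrm_lin (M := (2 * Wm)%N) _ _) _.
    move=> i; apply: leq_trans (nrmD _ _) _; rewrite nrmN mul2n -addnn.
    by apply: leq_add.
  rewrite leq_mul2r; apply/orP; right; apply: leq_trans cm _.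
  rewrite /mm truncn_ge_nat ?invr_ge0 ?(ltW k0) // -[leRHS]mul1r ler_pdivlMr //.
  apply: le_trans mk; rewrite ler_pM2r // -natrX ler_nat.
  by case: (m) => // k; rewrite leq_pmulr.
move=> y; rewrite big_map; apply: sum_le1 => // z z' zZ z'Z b1 b2.
apply/eqP/contraT => ne; have := sZ z z' zZ z'Z ne; rewrite ltnNge => /negP[].
apply: red_diff b1 b2; move: (nz z zZ) (nz z' z'Z); rewrite /M.
by clear; move: (mm * _)%N (nrm z) (nrm z') => Q a b; lia.
Qed.

End IntInverse.

(** * Rounding to a coarse grid *)

Lemma nrm_sym z z' : nrm (z - z') = nrm (z' - z).
Proof. by rewrite -nrmN opprB. Qed.

Lemma separated_cover (h : nat) (A : seq (int * int)) :
  exists Z, [/\ separated h Z, {subset Z <= A} &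
    forall a, a \in A -> exists2 z, z \in Z & (nrm (a - z)%R <= h)%N].
Proof.
elim: A => [|a A [Z [[uZ sZ] ZA hZ]]]; first by exists [::].
have [[z zZ az]|far] := pselect (exists2 z, z \in Z & (nrm (a - z)%R <= h)%N).
  exists Z; split => //; first by move=> y /ZA yA; rewrite inE yA orbT.
  by move=> b; rewrite inE => /orP[/eqP ->|/hZ //]; exists z.
have {}far z : z \in Z -> (h < nrm (a - z)%R)%N.
  by move=> zZ; rewrite ltnNge; apply/negP => hz; apply: far; exists z.
exists (a :: Z); split.
- split=> /=.
    rewrite uZ andbT; apply/negP => /far.
    by rewrite subrr /nrm.
  move=> y z; rewrite !inE => /orP[/eqP ->|yZ] /orP[/eqP ->|zZ]; rewrite ?eqxx //.
  - by move=> _; exact: far.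
  - by move=> _; rewrite nrm_sym; exact: far.
  - exact: sZ.
- by move=> y; rewrite !inE => /orP[->//|/ZA ->]; rewrite orbT.
move=> b; rewrite inE => /orP[/eqP ->|/hZ[z zZ bz]].
  by exists a; rewrite ?mem_head // subrr.
by exists z; rewrite // inE zZ orbT.
Qed.

Lemma near_multiple (H K : nat) (a z : int) : (0 < H)%N ->
  (absz (a * H%:Z - z)%R <= K.+1 * H)%N ->
  exists2 i, (i < 2 * K + 5)%N & a = (z %/ H%:Z)%Z + i%:Z - (K.+2)%:Z.
Proof.
move=> H0 h; have e := divz_eq z H%:Z.
have r0 := @modz_ge0 z H%:Z; have r1 := @ltz_pmod z H%:Z.
set q := divz _ _ in e *; set r := modz _ _ in e r0 r1.
have {}r0 : 0 <= r by apply: r0; lia.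
have {}r1 : r < H%:Z by apply: r1; lia.
have h1 : (a - q) * H%:Z < (K%:Z + 2) * H%:Z by nia.
have h2 : - (K%:Z + 2) * H%:Z < (a - q) * H%:Z by nia.
have H0' : 0 < H%:Z by lia.
rewrite ltr_pM2r // in h1; rewrite ltr_pM2r // in h2.
by exists (absz (a - q + K.+2%:Z)); lia.
Qed.

Section Coarse.
Variables (R : realType) (I : finType) (x r : I -> int * int) (h H : nat).

Definition sep_bound (K : nat) (b : R) : Prop :=
  forall Z, separated h Z -> (forall z, z \in Z -> sums x K z) -> (size Z)%:R <= b.

(** Scaled by [H], a sum of at most [K] rounded vectors is within [K * H] of the corresponding sum
    of the [x i], and this one is within [h <= H] of a point of a separated net. So each point of
    the net accounts for boundedly many grid points. *)
Lemma coarse_count (K : nat) (b : R) : (0 < H)%N -> (h <= H)%N ->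
  (forall i, (nrm (r i *~ H - x i)%R <= H)%N) ->
  sep_bound K b -> card_le (sums r K) ((2 * K + 5)%:R ^+ 2 * b).
Proof.
move=> H0 hH rx hb s us hs.
have /choice [c hc] : forall z, exists c : {ffun I -> int}, z \in s ->
    (wt c <= K)%N /\ z = lin r c.
  by move=> z; have [/hs[c hc]|] := boolP (z \in s); [exists c|exists 0].
have [Z [sZ ZA hZ]] := separated_cover h [seq lin x (c z) | z <- s].
pose L := iota 0 (2 * K + 5).
pose cell (z : int * int) : seq (int * int) :=
  [seq ((z.1 %/ H%:Z)%Z + i%:Z - K.+2%:Z, (z.2 %/ H%:Z)%Z + j%:Z - K.+2%:Z) | i <- L, j <- L].
have sub : {subset s <= flatten [seq cell z | z <- Z]}.
  move=> z zs; have [cK ez] := hc z zs.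
  have [a aZ az] : exists2 a, a \in Z & (nrm (lin x (c z) - a)%R <= h)%N.
    by apply: hZ; exact: map_f.
  apply/flattenP; exists (cell a); first exact: map_f.
  have : (nrm (z *~ H - a)%R <= K.+1 * H)%N.
    have -> : z *~ H - a = lin (fun i => r i *~ H - x i) (c z) + (lin x (c z) - a).
      rewrite {1}ez /lin mulrz_suml addrA -big_split /=; congr (_ - _).
      apply: eq_bigr => i _; rewrite mulrzBl subrK -!mulrzA; congr (_ *~ _); exact: mulrC.
    apply: leq_trans (nrmD _ _) _; rewrite mulSn addnC; apply: leq_add.
      exact: leq_trans az hH.
    by apply: leq_trans (nrm_lin _ rx) _; rewrite leq_mul2r cK orbT.
  move=> /nrm_leP; rewrite pairMz /= !mulrzz => -[/near_multiple h1 /near_multiple h2].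
  have [i iK e1] := h1 H0; have [j jK e2] := h2 H0.
  by apply/allpairsP; exists (i, j); rewrite !mem_iota /= iK jK -e1 -e2 -surjective_pairing.
apply: le_trans (_ : (size (flatten [seq cell z | z <- Z]))%:R <= _).
  by rewrite ler_nat uniq_leq_size.
have -> : size (flatten [seq cell z | z <- Z]) = (size Z * (2 * K + 5) ^ 2)%N.
  elim: Z {sZ ZA hZ sub} => //= z Z IH; rewrite size_cat IH size_allpairs !size_iota.
  by rewrite mulSn -mulnn.
rewrite natrM natrX mulrC ler_wpM2l ?exprn_ge0 //; apply: hb => // z /ZA /mapP[y ys ->].
by exists (c y); split => //; case: (hc y ys).
Qed.

(* Translates of a separated set by multiples of a longest [x i] stay separated. *)
Lemma sep_growth (K J m : nat) (b : R) : (0 < J)%N ->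
  (exists i, (h < nrm (x i))%N) -> (J * (2 * K + 1) <= m)%N ->
  sep_bound m b -> sep_bound K (b / J%:R).
Proof.
move=> J0 [i0 hi0] Jm hb Z [uZ sZ] hZ.
pose i := [arg max_(i > i0) nrm (x i)].
have xM j : (nrm (x j) <= nrm (x i))%N by rewrite /i; case: arg_maxnP => // k _; apply.
set M := nrm (x i) in xM; have hM : (h < M)%N by exact: leq_trans (xM i0).
(* Two sums of [K] terms differ by at most [2 K M], so steps of length [(2 K + 1) M] leave a
   distance of at least [M > h]. *)
pose D := x i *~ (2 * K + 1)%N.
have ZM z : z \in Z -> (nrm z <= K * M)%N.
  move=> /hZ[c [cK ->]]; apply: leq_trans (nrm_lin _ xM) _.
  by rewrite leq_mul2r cK orbT.
have key (j j' : int) z z' : z \in Z -> z' \in Z -> (j, z) != (j', z') ->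
    (h < nrm (z + D *~ j - (z' + D *~ j'))%R)%N.
  move=> zZ z'Z ne; have -> : z + D *~ j - (z' + D *~ j') = (z - z') + D *~ (j - j').
    by rewrite mulrzBr opprD addrACA.
  have [jj|jj] := eqVneq j j'.
    rewrite jj subrr mulr0z addr0; apply: sZ => //.
    by apply: contraNneq ne => ->; rewrite jj.
  have h1 := nrmD ((z - z') + D *~ (j - j')) (z' - z).
  rewrite addrAC -[z' - z]opprB subrr add0r nrmN in h1.
  have h2 := nrmD z (- z'); rewrite nrmN in h2.
  have h3 := ZM _ zZ; have h4 := ZM _ z'Z.
  have h5 : ((2 * K + 1) * M <= nrm (D *~ (j - j')))%N.
    by rewrite /D !nrmMz -/M leq_pmull // lt0n absz_eq0 subr_eq0.
  move: (nrm (_ + _)) (nrm (D *~ _)) (nrm (z - z')) (nrm z) (nrm z') h1 h2 h3 h4 h5 hM.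
  clear; move=> a b c d e; lia.
pose Z' := [seq z + D *~ (Posz j) | j <- iota 0 J, z <- Z].
have sizeZ' : size Z' = (J * size Z)%N by rewrite size_allpairs size_iota.
rewrite ler_pdivlMr ?ltr0n // -natrM mulnC -sizeZ'; apply: hb.
  split.
    apply: allpairs_uniq => //; first exact: iota_uniq.
    move=> [j z] [j' z'] /allpairsP[[j1 z1] [_ /= zZ [-> ->]]].
    move=> /allpairsP[[j2 z2] [_ /= z'Z [-> ->]]] /= e.
    apply/eqP/contraT => ne; have := key j1 j2 z1 z2 zZ z'Z.
    have -> : (Posz j1, z1) != (Posz j2, z2) by [].
    by rewrite e subrr /nrm => /(_ isT).
  move=> y y' /allpairsP[[j z] [_ /= zZ ->]] /allpairsP[[j' z'] [_ /= z'Z ->]] ne.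
  by apply: key => //; apply: contraNneq ne => -[-> ->].
move=> y /allpairsP[[j z] [/= + zZ ->]]; rewrite mem_iota add0n => jJ.
apply: (sums_mono (m := (K + `|Posz j| * (`|Posz (2 * K + 1)| * 1))%N)).
  by rewrite muln1; apply: leq_trans Jm; move: jJ; clear; rewrite /=; nia.
apply: sumsD; first exact: hZ.
by apply: sumsMz; apply: sumsMz; exact: sums1.
Qed.

End Coarse.

Lemma torsion_free_int2 : torsion_free (int * int)%type.
Proof.
move=> z m m0 h; have := nrmMz z m; rewrite h /nrm => /esym/eqP.
rewrite muln_eq0 absz_eq0 (negPf m0) /= => /eqP e; case: z {h} e => a b /=.
rewrite /nrm /= => e; congr (_, _); clear -e; lia.
Qed.

Lemma nearest_pair (H' : nat) (z : int * int) : (0 < H')%N ->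
  exists r, (nrm (r *~ (2 * H')%N - z)%R <= H')%N.
Proof.
move=> H'0; have H0 : (2 * H')%N%:Z != 0 by lia.
have [q1 [e1 [h1 g1]]] := nearest_div z.1 H0.
have [q2 [e2 [h2 g2]]] := nearest_div z.2 H0.
exists (q1, q2); apply/nrm_leP; rewrite pairMz /= !mulrzz h1 h2; split; lia.
Qed.

Lemma nrm_eq0 z : nrm z = 0%N -> z = 0.
Proof. by case: z => a b; rewrite /nrm /= => e; congr (_, _); lia. Qed.

Section Assembly.
Variables (R : realType) (n : nat) (sbar : int) (w : 'I_n -> int * int).

(** The whole progression consists of sums of at most [K] rounded differences, so it inherits the
    count that [sep_growth] divides by [J]. The condition [h < H'] ensures that a difference with
    nonzero rounding is longer than [h]. *)
Lemma discrete_structure (h H' T K J m t l d : nat) (nu kappa rho : R) (c0 : int * int) :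
  0 < nu -> 0 < kappa -> gain nu * kappa <= 1 -> 0 < rho ->
  (0 < #|sumvecs n sbar|)%N ->
  (forall x (s : bool), x \in sumvecs n sbar ->
     nu * n%:R + (2 * T + 2)%:R <= #|[set k | x k == s]|%:R) ->
  rho * #|sumvecs n sbar|%:R <=
    #|[set x in sumvecs n sbar | (nrm (iwalk w x - c0)%R <= h)%N]|%:R ->
  (1 - gain nu * kappa) ^+ T < rho ^+ 2 / 16 ->
  (4 * T < n)%N -> (h < H')%N -> m%:R ^+ 2 * kappa <= 1 ->
  (0 < J)%N -> (J * (2 * K + 1) <= m)%N -> (t <= K)%N -> (d * l <= K)%N ->
  (gap_radius d t t l <= K)%N ->
  (2 * K + 5)%:R ^+ 2 * (8 / rho) < (2 ^ t)%:R ->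
  (2 * K + 5)%:R ^+ 2 * (8 / rho) < (l.+1 ^ d)%:R ->
  exists (W : {set 'I_n}) (i0 : 'I_n) (r : 'I_n -> int * int) (s : seq ((int * int) * nat)),
    [/\ (n <= #|W| + 4 * T)%N,
        forall i, (nrm (r i *~ (2 * H')%N - (w i - w i0))%R <= H')%N,
        (size s < d)%N /\ (forall i, i \in W -> ingap s (r i)),
        forall p, p \in s -> sums r K p.1 &
        card_le (ingap s) (Num.max 1 ((2 * K + 5)%:R ^+ 2 * (8 / rho / J%:R)))].
Proof.
move=> nu0 k0 gk rho0 Om0 cnt conc hT Tn hH mk J0 Jm tK dK rK bt bd.
have [W [cW hW]] := int_inverse nu0 k0 gk rho0 Om0 cnt conc hT.
have [i0 i0W] : exists i0, i0 \in W by apply/card_gt0P; clear -cW Tn; lia.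
have H'0 : (0 < H')%N by exact: leq_ltn_trans hH.
have /choice [r hr] : forall i, exists r, (nrm (r *~ (2 * H')%N - (w i - w i0))%R <= H')%N.
  by move=> i; exact: nearest_pair.
(* Extension by zero keeps ['I_n] as index type; [restrict] moves the coefficients back to [W]. *)
pose x i := if i \in W then w i - w i0 else 0.
pose y i := if i \in W then r i else 0.
have Km : (K <= m)%N by apply: leq_trans Jm; clear -J0; nia.
have restrict (V : zmodType) (f : 'I_n -> V) (c : {ffun 'I_n -> int}) :
    exists c' : {ffun 'I_n -> int}, [/\ forall i, i \notin W -> c' i = 0, (wt c' <= wt c)%N &
      lin (fun i => if i \in W then f i else 0) c = lin f c'].
  exists [ffun i => if i \in W then c i else 0]; split.
  - by move=> i /negPf iW; rewrite ffunE iW.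
  - by apply: leq_sum => i _; rewrite ffunE; case: ifP.
  - by apply: eq_bigr => i _; rewrite ffunE; case: ifP => _; rewrite ?mul0rz ?mulr0z.
have sepm : sep_bound x h m (8 / rho).
  move=> Z sZ hZ; rewrite ler_pdivlMr //; apply: (hW m i0) => // z /hZ[c [cm ->]].
  have [c' [h1 h2 h3]] := restrict _ (fun i => w i - w i0) c.
  by exists c'; split => //; exact: leq_trans cm.
have sepK : sep_bound x h K (8 / rho).
  by move=> Z sZ hZ; apply: sepm => // z /hZ; exact: sums_mono.
have xy i : (nrm (y i *~ (2 * H')%N - x i)%R <= 2 * H')%N.
  rewrite /x /y; case: ifP => _; last by rewrite mul0rz subr0.
  by apply: leq_trans (hr i) _; clear; lia.
have HH0 : (0 < 2 * H')%N by clear -H'0; lia.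
have hHH : (h <= 2 * H')%N by clear -hH; lia.
have cK := coarse_count HH0 hHH xy sepK.
have [s [s1 s2 s3 s4]] := family_in_gap torsion_free_int2 cK bt tK bd dK.
exists W, i0, r, s; split => //.
- by split => // i iW; have := s2 i; rewrite /y iW.
- move=> p /s4 /(sums_mono rK)[c [cw ->]]; have [c' [h1 h2 ->]] := restrict _ r c.
  by exists c'; split => //; exact: leq_trans cw.
(* If every rounded difference in [W] vanishes there is no direction to translate in, but the
   progression is the single point 0; this is the 1 in the maximum. *)
have [[i yi]|y0] := pselect (exists i, y i != 0).
  move=> z uz hz; rewrite le_max; apply/orP; right.
  apply: (coarse_count HH0 hHH xy (sep_growth J0 _ Jm sepm)) uz _.
    exists i; move: yi; rewrite /x /y; case: ifP => _; last by rewrite eqxx.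
    move=> ri; apply: leq_trans hH _.
    have h1 : (2 * H' <= nrm (r i *~ (2 * H')%N)%R)%N.
      rewrite nrmMz leq_pmulr // lt0n; apply: contra ri => /eqP.
      by move=> /nrm_eq0 ->.
    have h2 := nrmD (r i *~ (2 * H')%N - (w i - w i0)) (w i - w i0).
    by rewrite subrK in h2; move: (hr i) h1 h2; clear; lia.
  by move=> u /hz /s3; exact: sums_mono.
move=> z uz hz; rewrite le_max; apply/orP; left; rewrite lern1.
apply: (@uniq_leq_size _ z [:: 0]) => // u /hz /s3[c [_ ->]].
rewrite inE /lin big1 // => i _; rewrite (_ : y i = 0) ?mul0rz //.
by apply: contrapT => /eqP yi; apply: y0; exists i.
Qed.

End Assembly.

(** * Complex vectors and small ball probabilities *)

Local Open Scope complex_scope.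

Section ComplexFacts.
Variable R : realType.
Implicit Types (z : R[i]) (r : R).

Lemma ReD z z' : complex.Re (z + z') = complex.Re z + complex.Re z'.
Proof. by case: z z' => [a b] [c d]. Qed.
Lemma ImD z z' : complex.Im (z + z') = complex.Im z + complex.Im z'.
Proof. by case: z z' => [a b] [c d]. Qed.
Lemma ReN z : complex.Re (- z) = - complex.Re z.
Proof. by case: z. Qed.
Lemma ImN z : complex.Im (- z) = - complex.Im z.
Proof. by case: z. Qed.
Lemma Re_sum (I : finType) (f : I -> R[i]) :
  complex.Re (\sum_i f i) = \sum_i complex.Re (f i).
Proof. exact: (big_morph _ ReD). Qed.
Lemma Im_sum (I : finType) (f : I -> R[i]) :
  complex.Im (\sum_i f i) = \sum_i complex.Im (f i).
Proof. exact: (big_morph _ ImD). Qed.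

Lemma intcE (k : int) : k%:~R = (k%:~R : R)%:C.
Proof. by rewrite rmorph_int. Qed.
Lemma ReMz z (k : int) : complex.Re (z * k%:~R) = complex.Re z * k%:~R.
Proof. by case: z => a b; rewrite intcE /= mulr0 subr0. Qed.
Lemma ImMz z (k : int) : complex.Im (z * k%:~R) = complex.Im z * k%:~R.
Proof. by case: z => a b; rewrite intcE /= mulr0 add0r. Qed.

Lemma normr_cabs z : `|z| = (cabs z)%:C.
Proof. exact: normc_def. Qed.
Lemma cabsD z z' : cabs (z + z') <= cabs z + cabs z'.
Proof. by have := ler_normD z z'; rewrite !normr_cabs -rmorphD lecR. Qed.
Lemma cabsN z : cabs (- z) = cabs z.
Proof. by apply: complexI; rewrite -!normr_cabs normrN. Qed.
Lemma cabsM z z' : cabs (z * z') = cabs z * cabs z'.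
Proof. by have := normrM z z'; rewrite !normr_cabs -rmorphM => /complexI. Qed.
Lemma cabs_ge0 z : 0 <= cabs z.
Proof. exact: sqrtr_ge0. Qed.
Lemma cabs0 : cabs (0 : R[i]) = 0.
Proof. by apply: complexI; rewrite -normr_cabs normr0. Qed.
Lemma cabs_real r : cabs r%:C = `|r|.
Proof. by rewrite /cabs /= expr0n addr0 sqrtr_sqr. Qed.
Lemma cabs_conj z : cabs (z^*) = cabs z.
Proof. by case: z => a b; rewrite /cabs /= sqrrN. Qed.
Lemma cabs_sum (I : finType) (f : I -> R[i]) : cabs (\sum_i f i) <= \sum_i cabs (f i).
Proof.
elim/big_rec2: _ => [|i a b _ h]; first by rewrite cabs0.
by apply: le_trans (cabsD _ _) _; rewrite lerD2l.
Qed.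
Lemma Re_le_cabs z : `|complex.Re z| <= cabs z.
Proof. by rewrite -sqrtr_sqr ler_sqrt ?lerDl ?addr_ge0 ?sqr_ge0. Qed.
Lemma Im_le_cabs z : `|complex.Im z| <= cabs z.
Proof. by rewrite -sqrtr_sqr ler_sqrt ?lerDr ?addr_ge0 ?sqr_ge0. Qed.
Lemma cabs_le z r : `|complex.Re z| <= r -> `|complex.Im z| <= r -> cabs z <= 2 * r.
Proof.
move=> h1 h2; have r0 : 0 <= r by exact: le_trans h1.
rewrite -(@ger0_norm _ (2 * r)) ?mulr_ge0 // -sqrtr_sqr ler_sqrt ?sqr_ge0 //.
have := lerXn2r 2 (normr_ge0 _) r0 h1; have := lerXn2r 2 (normr_ge0 _) r0 h2.
rewrite !real_normK ?num_real //; nra.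
Qed.

End ComplexFacts.

Section SmallBall.
Variables (R : realType) (n : nat) (sbar : int).
Implicit Types (u v : 'I_n -> R[i]) (r : R) (z : R[i]).

Definition csum u (x : {ffun 'I_n -> bool}) : R[i] := \sum_(i < n) u i * (sgn (x i))%:~R.

Lemma smallball_prob_ge0 u r z : 0 <= smallball_prob sbar u r z.
Proof. by rewrite /smallball_prob divr_ge0. Qed.

Lemma smallball_prob_le1 u r z : smallball_prob sbar u r z <= 1.
Proof.
rewrite /smallball_prob; have [->|h] := posnP #|sumvecs n sbar|; first by rewrite invr0 mulr0.
rewrite ler_pdivrMr ?ltr0n // mul1r ler_nat; apply: subset_leq_card.
by apply/fintype.subsetP => x; rewrite finset.in_set => /andP[].
Qed.

Lemma smallball_prob_mono u v r r' z z' :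
  (forall x, x \in sumvecs n sbar -> cabs (csum u x - z) <= r -> cabs (csum v x - z') <= r') ->
  smallball_prob sbar u r z <= smallball_prob sbar v r' z'.
Proof.
move=> h; rewrite /smallball_prob ler_wpM2r ?invr_ge0 // ler_nat.
apply: subset_leq_card; apply/fintype.subsetP => x; rewrite finset.in_set => /andP[xO hx].
by rewrite finset.in_set xO; exact: (h x xO hx).
Qed.

Let probs u r := [set p : R | exists z : R[i], p = smallball_prob sbar u r z]%classic.

Lemma probs_nonempty u r : nonempty (probs u r).
Proof. by exists (smallball_prob sbar u r 0), 0. Qed.

Lemma probs_ub u r : has_ubound (probs u r).
Proof. by exists 1 => _ [z ->]; exact: smallball_prob_le1. Qed.

Lemma smallball_le_rho u r z : smallball_prob sbar u r z <= rho_star sbar r u.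
Proof. by apply: ub_le_sup; [exact: probs_ub|exists z]. Qed.

Lemma rho_star_le1 u r : rho_star sbar r u <= 1.
Proof. by apply: ge_sup; [exact: probs_nonempty|move=> _ [z ->]; exact: smallball_prob_le1]. Qed.

(** A center that is optimal up to a factor 2 replaces the question whether the supremum is
    attained. *)
Lemma rho_star_half u r : 0 < rho_star sbar r u ->
  exists z, rho_star sbar r u / 2 <= smallball_prob sbar u r z.
Proof.
move=> h; have h2 : 0 < rho_star sbar r u / 2 by rewrite divr_gt0.
have [|_ [z ->] hz] := @sup_adherent R (probs u r) _ h2.
  by split; [exact: probs_nonempty|exact: probs_ub].
by exists z; apply: ltW; move: hz; rewrite -/(rho_star _ _ _) /probs -/(rho_star _ _ _); lra.
Qed.

Lemma rho_star_mono u v r r' :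
  (forall z, exists z', smallball_prob sbar u r z <= smallball_prob sbar v r' z') ->
  rho_star sbar r u <= rho_star sbar r' v.
Proof.
move=> h; apply: ge_sup; first exact: probs_nonempty.
move=> _ [z ->]; have [z' hz] := h z; apply: le_trans hz _; exact: smallball_le_rho.
Qed.

Lemma csum_conj u x : csum (fun i => (u i)^*) x = (csum u x)^*.
Proof.
rewrite /csum rmorph_sum; apply: eq_bigr => i _.
by rewrite rmorphM /= rmorph_int.
Qed.

Lemma rho_star_conj u r : rho_star sbar r (fun i => (u i)^*) = rho_star sbar r u.
Proof.
have e z : smallball_prob sbar (fun i => (u i)^*) r z^* = smallball_prob sbar u r z.
  apply/eqP; rewrite eq_le; apply/andP; split; apply: smallball_prob_mono => x _;
  by rewrite csum_conj -rmorphB cabs_conj.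
apply/eqP; rewrite eq_le; apply/andP; split; apply: rho_star_mono => z.
  by exists z^*; rewrite -e conjcK.
by exists z^*; rewrite e.
Qed.

Lemma rho_star_gt0 u r : 0 <= r -> (0 < #|sumvecs n sbar|)%N -> 0 < rho_star sbar r u.
Proof.
move=> r0 h; have [x xO] := card_gt0P h.
apply: lt_le_trans (smallball_le_rho _ _ (csum u x)).
rewrite /smallball_prob divr_gt0 ?ltr0n //; apply/card_gt0P; exists x.
by rewrite finset.in_set xO subrr cabs0.
Qed.

Lemma rho_star_empty u r : #|sumvecs n sbar| = 0%N -> rho_star sbar r u = 0.
Proof.
move=> h; apply/eqP; rewrite eq_le; apply/andP; split.
  apply: ge_sup; first exact: probs_nonempty.
  by move=> _ [z ->]; rewrite /smallball_prob h invr0 mulr0.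
by apply: le_trans (smallball_le_rho u r 0); exact: smallball_prob_ge0.
Qed.

Lemma csum_dist u v x (e : R) : (forall i, cabs (u i - v i) <= e) ->
  cabs (csum u x - csum v x) <= n%:R * e.
Proof.
move=> h; rewrite /csum -sumrB; apply: le_trans (cabs_sum _) _.
rewrite mulr_natl -[X in _ *+ X](card_ord n) -sumr_const; apply: ler_sum => i _.
rewrite -mulrBl cabsM intcE cabs_real.
by case: (x i); rewrite /= ?normrN normr1 mulr1.
Qed.

Lemma rho_star_perturb u v r r' (e : R) : (forall i, cabs (u i - v i) <= e) ->
  r + n%:R * e <= r' -> rho_star sbar r u <= rho_star sbar r' v.
Proof.
move=> h hr; apply: rho_star_mono => z; exists z; apply: smallball_prob_mono => x _ hx.
have -> : csum v x - z = (csum u x - z) - (csum u x - csum v x) by rewrite opprB [RHS]addrC addrA subrK.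
apply: le_trans (cabsD _ _) _; rewrite cabsN; apply: le_trans hr.
by apply: lerD => //; exact: csum_dist.
Qed.

End SmallBall.

Section Discretize.
Variables (R : realType) (n : nat) (sbar : int).

Lemma slice_count (x : {ffun 'I_n -> bool}) (s : bool) : x \in sumvecs n sbar ->
  (n%:R - `|sbar|%:~R) / 2 <= #|[set k | x k == s]|%:R :> R.
Proof.
rewrite inE => /eqP hs.
have tot : (#|[set k | x k == true]| + #|[set k | x k == false]|)%N = n.
  rewrite -[RHS](card_ord n) -(cardsC [set k | x k == true]); congr (_ + _)%N.
  by apply: eq_card => k; rewrite !inE; case: (x k).
have diff : #|[set k | x k == true]|%:Z - #|[set k | x k == false]|%:Z = sbar.
  rewrite -hs (bigID (fun k => x k == true)) /=; congr (_ + _).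
    rewrite (eq_bigr (fun=> 1)) => [|k /eqP -> //].
    by rewrite sumr_const -natz; congr (_%:R); apply: eq_card => k; rewrite !inE.
  rewrite (eq_bigr (fun=> -1)) => [|k]; last by case: (x k).
  rewrite sumrN sumr_const -natz; congr (- _%:R); apply: eq_card => k; rewrite !inE [RHS]unfold_in /=.
  by case: (x k).
have : (n%:Z - `|sbar|) <= #|[set k | x k == s]|%:Z * 2.
  move: tot diff; case: s; move: #|[set k | x k == true]| #|[set k | x k == false]| => P M.
    by clear; lia.
  by clear; lia.
rewrite -(@ler_int R) intrB intrM => h.
by rewrite ler_pdivrMr.
Qed.

(** The error budget: [n] from the hypothesis, 1 for each of the [n] floors in the sum, and 1 for
    the floor of [b]. *)
Lemma floor_sum_dist (a : 'I_n -> R) (b : R) (x : {ffun 'I_n -> bool}) :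
  `|\sum_i a i * (sgn (x i))%:~R - b| <= n%:R ->
  (absz (\sum_i Num.floor (a i) * sgn (x i) - Num.floor b)%R <= 2 * n + 1)%N.
Proof.
move=> h; have fl (y : R) : `|(Num.floor y)%:~R - y| <= 1.
  by have := floor_itv y; rewrite intrD => /andP[h1 h2]; rewrite ler_norml; apply/andP; split; lra.
have h1 : `|\sum_i (Num.floor (a i))%:~R * (sgn (x i))%:~R - \sum_i a i * (sgn (x i))%:~R| <= n%:R :> R.
  rewrite -sumrB; apply: le_trans (ler_norm_sum _ _ _) _.
  rewrite -[leRHS]mulr1 mulr_natl -[X in _ *+ X](card_ord n) -sumr_const; apply: ler_sum => i _.
  rewrite -mulrBl normrM; apply: le_trans (_ : _ <= 1 * 1) _; last by rewrite mulr1.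
  by apply: ler_pM => //; case: (x i); rewrite /= ?normrN normr1.
have e : (\sum_i Num.floor (a i) * sgn (x i) - Num.floor b)%:~R =
   (\sum_i (Num.floor (a i))%:~R * (sgn (x i))%:~R - \sum_i a i * (sgn (x i))%:~R) +
   (\sum_i a i * (sgn (x i))%:~R - b) - ((Num.floor b)%:~R - b) :> R.
  rewrite intrB (_ : (\sum_i _)%:~R = \sum_i (Num.floor (a i))%:~R * (sgn (x i))%:~R :> R).
    by ring.
  by rewrite (rmorph_sum (intmul (1 : R))); apply: eq_bigr => i _; exact: intrM.
suff : (`|\sum_i Num.floor (a i) * sgn (x i) - Num.floor b| <= (2 * n + 1)%N%:Z)%R by clear; lia.
rewrite -(@ler_int R) intr_norm e; apply: le_trans (ler_normB _ _) _.
have h2 := ler_normD (\sum_i (Num.floor (a i))%:~R * (sgn (x i))%:~R - \sum_i a i * (sgn (x i))%:~R) (\sum_i a i * (sgn (x i))%:~R - b).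
have h3 := fl b.
have -> : (2 * n + 1)%N%:~R = 2 * n%:R + 1 :> R by rewrite -[_%:~R]/((2 * n + 1)%N%:R) natrD natrM.
by move: h h1 h2 h3; clear; lra.
Qed.

Definition fine (Q : R) (v : 'I_n -> R[i]) (i : 'I_n) : int * int :=
  (Num.floor (Q * complex.Re (v i)), Num.floor (Q * complex.Im (v i))).

Lemma fst_sum (I : finType) (f : I -> int * int) : (\sum_i f i).1 = \sum_i (f i).1.
Proof. exact: (big_morph (fun z : int * int => z.1)). Qed.
Lemma snd_sum (I : finType) (f : I -> int * int) : (\sum_i f i).2 = \sum_i (f i).2.
Proof. exact: (big_morph (fun z : int * int => z.2)). Qed.

Lemma fine_concentration (Q beta rho : R) (v : 'I_n -> R[i]) z : 0 <= Q -> Q * beta <= n%:R ->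
  (0 < #|sumvecs n sbar|)%N -> rho <= smallball_prob sbar v beta z ->
  exists c0, rho * #|sumvecs n sbar|%:R <=
    #|[set x in sumvecs n sbar | (nrm (iwalk (fine Q v) x - c0)%R <= 2 * n + 1)%N]|%:R.
Proof.
move=> Q0 Qb Om0 hrho.
exists (Num.floor (Q * complex.Re z), Num.floor (Q * complex.Im z)).
rewrite -ler_pdivlMr ?ltr0n //; apply: le_trans hrho _.
rewrite /smallball_prob ler_wpM2r ?invr_ge0 // ler_nat.
apply: subset_leq_card; apply/fintype.subsetP => x; rewrite finset.in_set => /andP[xO hx].
rewrite finset.in_set xO /=; apply/nrm_leP; rewrite /iwalk /= fst_sum snd_sum.
have part (y t : R) : `|y - t| <= beta -> `|Q * y - Q * t| <= n%:R.
  by move=> h; rewrite -mulrBr normrM ger0_norm //; apply: le_trans Qb; rewrite ler_wpM2l.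
split.
  under eq_bigr do rewrite pairMz /= mulrzz.
  apply: floor_sum_dist; under eq_bigr do rewrite -mulrA.
  rewrite -mulr_sumr; apply: part; apply: le_trans hx; apply: le_trans (Re_le_cabs _).
  by rewrite ReD ReN Re_sum; under [in leRHS]eq_bigr do rewrite ReMz.
under eq_bigr do rewrite pairMz /= mulrzz.
apply: floor_sum_dist; under eq_bigr do rewrite -mulrA.
rewrite -mulr_sumr; apply: part; apply: le_trans hx; apply: le_trans (Im_le_cabs _).
by rewrite ImD ImN Im_sum; under [in leRHS]eq_bigr do rewrite ImMz.
Qed.

End Discretize.

(** * From integer progressions to complex ones *)

Section GapConversion.
Variables (R : realType) (q : R).

Definition scale (z : int * int) : R[i] := (z.1%:~R / q) +i* (z.2%:~R / q).

Lemma scaleD z z' : scale (z + z') = scale z + scale z'.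
Proof. by rewrite /scale /= !intrD !mulrDl. Qed.

Lemma scaleMz z k : scale (z *~ k) = k%:~R * scale z.
Proof.
apply/eqP; rewrite mulrC eq_complex ReMz ImMz /scale pairMz /= !mulrzz !intrM.
by rewrite !(mulrAC _ k%:~R) !eqxx.
Qed.

Definition gap_gens (s : seq ((int * int) * nat)) : seq (R[i] * int * int) :=
  [seq (scale p.1, - p.2%:Z, p.2%:Z) | p <- s].

Lemma int_rangeP (a b z : int) : a <= b -> (z \in int_range a b) = (a <= z <= b).
Proof.
move=> ab; apply/mapP/idP => [[k]|/andP[h1 h2]].
  by rewrite mem_iota => h ->; move: ab h; clear; lia.
by exists `|z - a|%N; [rewrite mem_iota|]; move: ab h1 h2; clear; lia.
Qed.

Lemma int_range_norm (N : nat) (k : int) :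
  (k \in int_range (- N%:Z) N%:Z) = (`|k| <= N%:Z).
Proof. by rewrite int_rangeP; [rewrite ler_norml|clear; lia]. Qed.

Lemma gap_elemsP g s x :
  x \in gap_elems (scale g) (gap_gens s) <-> exists z, ingap s z /\ x = scale (g + z).
Proof.
elim: s x => [|p s IH] x.
  rewrite /= inE; split=> [/eqP ->|[z [-> ->]]]; last by rewrite addr0.
  by exists 0; rewrite addr0.
rewrite (_ : gap_elems _ _ = [seq x + k%:~R * scale p.1 |
  x <- gap_elems (scale g) (gap_gens s), k <- int_range (- p.2%:Z) p.2%:Z]) //.
split=> [/allpairsPdep[x' [k [/IH[z [gz ->]] hk ->]]]|[z [[k [hk gz]] ->]]].
  exists (z + p.1 *~ k); split; last by rewrite addrA [RHS]scaleD scaleMz.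
  by exists k; rewrite addrK -int_range_norm.
apply/allpairsPdep; exists (scale (g + (z - p.1 *~ k))), k; split => /=.
- by apply/IH; exists (z - p.1 *~ k).
- by rewrite int_range_norm.
by rewrite -scaleMz -scaleD -addrA subrK.
Qed.

Lemma gap_card_le g s (b : R) : card_le (ingap s) b ->
  (gap_card (scale g) (gap_gens s))%:R <= b.
Proof.
move=> hb; set L := undup (gap_elems (scale g) (gap_gens s)).
have /choice [f hf] : forall x, exists z, x \in L -> ingap s z /\ x = scale (g + z).
  move=> x; have [|_] := boolP (x \in L); last by exists 0.
  by rewrite mem_undup => /gap_elemsP[z hz]; exists z.
rewrite /gap_card -/L -(size_map f); apply: hb.
  rewrite map_inj_in_uniq ?undup_uniq // => x y /hf[_ {2}->] /hf[_ {2}->] e.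
  by rewrite e.
by move=> z /mapP[x /hf[h _] ->].
Qed.

Lemma gap_gens_wf s : gap_wf (gap_gens s).
Proof. by rewrite /gap_wf all_map; apply/allP => p _ /=; clear; lia. Qed.

End GapConversion.

(** Growth by more than [N^delta] at each of the [K + 1] scales would lift [f] from [N^(-B)] above
    1. *)
Lemma pigeonhole_scale (R : realType) (N B delta : R) (f : nat -> R) (K : nat) :
  1 <= N -> B <= delta * K.+1%:R -> N `^ (- B) <= f 0%N -> (forall k, f k <= 1) ->
  exists k, (k <= K)%N /\ f k.+1 <= N `^ delta * f k.
Proof.
move=> N1 hB f0 f1; apply: contrapT => h.
have N0 : 0 < N by exact: lt_le_trans N1.
have step k : (k <= K)%N -> N `^ delta * f k < f k.+1.
  by move=> kK; rewrite ltNge; apply/negP => hk; apply: h; exists k.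
have low k : (k <= K)%N -> N `^ (delta * k%:R - B) <= f k.
  elim: k => [_|k IH kK]; first by rewrite mulr0 add0r.
  apply: le_trans (ltW (step k (ltnW kK))).
  have -> : delta * k.+1%:R - B = delta + (delta * k%:R - B) by rewrite -natr1; ring.
  by rewrite powRD ?(gt_eqF N0) ?implybT // ler_wpM2l ?powR_ge0 // IH // ltnW.
have := step K (leqnn K); apply/negP; rewrite -leNgt; apply: le_trans (f1 _) _.
apply: le_trans (ler_wpM2l (powR_ge0 _ _) (low K (leqnn K))).
rewrite -powRD ?(gt_eqF N0) ?implybT //.
rewrite -[leLHS](powRr0 N) ler_powR //.
by have := hB; rewrite -natr1; lra.
Qed.

(** * Choice of parameters *)

Section Eventually.
Variable R : realType.

Definition ev (P : R -> Prop) : Prop := exists N0, forall N, N0 <= N -> 1 <= N -> P N.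

Lemma ev_and (P Q : R -> Prop) : ev P -> ev Q -> ev (fun N => P N /\ Q N).
Proof.
move=> [N0 h0] [N1 h1]; exists (Num.max N0 N1) => N.
by rewrite ge_max => /andP[a b] c; split; [exact: h0|exact: h1].
Qed.

Lemma ev_imp (P Q : R -> Prop) : (forall N, 1 <= N -> P N -> Q N) -> ev P -> ev Q.
Proof. by move=> h [N0 h0]; exists N0 => N a b; apply: h => //; exact: h0. Qed.

Lemma powR_add (N a b : R) : 1 <= N -> N `^ (a + b) = N `^ a * N `^ b.
Proof. by move=> h; rewrite powRD // (gt_eqF (lt_le_trans ltr01 h)) implybT. Qed.

Lemma powR_ge1 (N a : R) : 1 <= N -> 0 <= a -> 1 <= N `^ a.
Proof. by move=> h a0; rewrite -(powRr0 N); exact: ler_powR. Qed.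

Lemma powR_pos (N a : R) : 1 <= N -> 0 < N `^ a.
Proof. by move=> h; rewrite powR_gt0 // (lt_le_trans ltr01 h). Qed.

Lemma ev_pow (C a b : R) : a < b -> ev (fun N => C * N `^ a <= N `^ b).
Proof.
move=> ab; pose C' := Num.max C 1; exists (C' `^ (b - a)^-1) => N hN N1.
have ba : 0 < b - a by rewrite subr_gt0.
have C1 : 1 <= C' by rewrite le_max lexx orbT.
have -> : N `^ b = N `^ (b - a) * N `^ a by rewrite -powR_add // subrK.
rewrite ler_wpM2r ?powR_ge0 //; apply: le_trans (_ : C' <= _); first by rewrite le_max lexx.
have -> : C' = (C' `^ (b - a)^-1) `^ (b - a).
  by rewrite -powRrM mulVf ?gt_eqF // powRr1 // (le_trans ler01).
by apply: ge0_ler_powR => //; rewrite ?nnegrE ?powR_ge0 ?ltW // (lt_le_trans ltr01).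
Qed.

Lemma ln_le_powR (N a : R) : 1 <= N -> 0 < a -> ln N <= a^-1 * N `^ a.
Proof.
move=> N1 a0; rewrite mulrC ler_pdivlMr // mulrC -ln_powR.
have h := powR_pos a N1; have := @le_ln1Dx R (N `^ a - 1).
by rewrite addrCA subrr addr0 => h2; apply: le_trans (h2 _) _; lra.
Qed.

Lemma natr_truncn_le (y : R) : 0 <= y -> (Num.truncn y)%:R <= y.
Proof. by rewrite truncn_le. Qed.

Lemma ev_lnE (C a : R) : 0 < a -> ev (fun N => C * ln N + C <= N `^ a).
Proof.
move=> a0; have a2 : 0 < a / 2 by rewrite divr_gt0.
have := @ev_pow (Num.max C 0 * ((a / 2)^-1 + 1)) (a / 2) a; case; first by lra.
move=> N0 h; exists N0 => N hN N1; apply: le_trans (h N hN N1).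
have h1 := ln_le_powR N1 a2; have h2 := powR_ge1 N1 (ltW a2); have h3 := ln_ge0 N1.
have C0 : 0 <= Num.max C 0 by rewrite le_max lexx orbT.
have CC : C <= Num.max C 0 by rewrite le_max lexx.
apply: le_trans (_ : Num.max C 0 * (ln N + 1) <= _).
  by rewrite mulrDr mulr1 lerD // ler_wpM2r.
by rewrite -mulrA ler_wpM2l // mulrDl mul1r lerD.
Qed.

(** The 25 is the inverse of the exponent of [l]: it gives [(l+1)^(gap_dim B) >= N^(B+1)], more than
    the number of rounded sums. *)
Definition gap_dim (B : R) : nat := (Num.truncn (25 * (B + 1))).+1.

(** The numerical hypotheses of [discrete_structure] for [nu = eps / 8]. It is applied with half the
    concentration, which turns [8 / rho] into 16 times an inverse concentration, hence the 16. *)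
Definition good_parameters (alpha B eps N : R) : Prop :=
  exists (T K J m t l : nat) (kappa : R),
  [/\ 0 < kappa /\ gain (eps / 8) * kappa <= 1,
      eps / 8 * N + (2 * T + 2)%:R <= (N - ((1 - eps) * N + 1)) / 2,
      forall rho, N `^ (- B) / 2 <= rho -> (1 - gain (eps / 8) * kappa) ^+ T < rho ^+ 2 / 16,
      (4 * T)%:R <= N `^ (1 / 2 + alpha) /\ N `^ (1 / 2 + alpha) < N &
      [/\ m%:R ^+ 2 * kappa <= 1, (0 < J)%N, (J * (2 * K + 1) <= m)%N,
          [/\ (t <= K)%N, (gap_dim B * l <= K)%N & (gap_radius (gap_dim B) t t l <= K)%N] &
      [/\ (2 * K + 5)%:R ^+ 2 * 16 * N `^ B < (2 ^ t)%:R,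
          (2 * K + 5)%:R ^+ 2 * 16 * N `^ B < (l.+1 ^ gap_dim B)%:R,
          (2 * K + 5)%:R ^+ 2 * 16 * N `^ (alpha / 2 + 1 / 100) <= J%:R & K%:R <= N]]].

Section ScaleChoices.
Variables alpha B eps : R.
Hypotheses (al0 : 0 < alpha) (al1 : alpha < 1 / 2) (B0 : 0 < B) (eps0 : 0 < eps) (eps1 : eps <= 1).

Let hyps : [/\ 0 < alpha, alpha < 1 / 2, 0 < B, 0 < eps & eps <= 1].
Proof. by []. Qed.

Let nu := eps / 8.
Let g := gain nu.

(* The loss [N^(1/100)] in [kappa] pays for [ln (1 / rho)] in the number of
   steps; [K] exceeds [l] by more than the powers of [ln N] in [gap_radius]. *)
Let kappa (N : R) := N `^ (- (1 / 2 + alpha - 1 / 100)).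
Let T (N : R) := Num.truncn (N `^ (1 / 2 + alpha) / 4).
Let K (N : R) := Num.truncn (N `^ (1 / 20)).
Let l (N : R) := Num.truncn (N `^ (1 / 25)).
Let m (N : R) := Num.truncn (N `^ (1 / 4 + alpha / 2 - 1 / 200)).
Let t (N : R) := (Num.truncn (2 * (B + 1) * ln N)).+1.
Let J (N : R) := (Num.truncn (784 * N `^ (alpha / 2 + 11 / 100))).+1.

Lemma nu0 : 0 < nu. Proof. by rewrite /nu divr_gt0. Qed.

Lemma gain_kappa N : 1 <= N -> g * kappa N <= 1.
Proof.
have [ha ha' hB he he'] := hyps.
move=> N1; have k1 : kappa N <= 1.
  rewrite /kappa powRN invf_le1 ?powR_pos // powR_ge1 //; lra.
have g1 : g <= 1.
  rewrite /g /gain; have : (1 + nu^-1)^-1 <= 1.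
    have := nu0; move=> h; have h2 : 0 < nu^-1 by rewrite invr_gt0.
    by rewrite invf_le1; lra.
  lra.
have g0 := ltW (gain_gt0 nu0).
by apply: le_trans (ler_pM _ _ g1 k1) _; rewrite ?mulr1 // /kappa powR_ge0.
Qed.

Lemma few_exceptions : ev (fun N => N `^ (1 / 2 + alpha) * 8 <= eps * N).
Proof.
have [ha ha' hB he he'] := hyps.
have [|N0 h] := @ev_pow (8 / eps) (1 / 2 + alpha) 1; first by lra.
exists N0 => N hN N1; have := h N hN N1; rewrite powRr1 ?(le_trans ler01) // => h1.
have : eps * (8 / eps * N `^ (1 / 2 + alpha)) <= eps * N by rewrite ler_wpM2l // ltW.
have -> // : eps * (8 / eps * N `^ (1 / 2 + alpha)) = N `^ (1 / 2 + alpha) * 8.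
by field; rewrite gt_eqF.
Qed.

Lemma T_bound N : 1 <= N -> (4 * T N)%:R <= N `^ (1 / 2 + alpha).
Proof.
have [ha ha' hB he he'] := hyps.
move=> N1; have := @natr_truncn_le (N `^ (1 / 2 + alpha) / 4).
rewrite -/(T N) natrM => h; have := h (divr_ge0 (powR_ge0 _ _) _); lra.
Qed.

Lemma count_ok : ev (fun N => nu * N + (2 * T N + 2)%:R <= (N - ((1 - eps) * N + 1)) / 2).
Proof.
have [ha ha' hB he he'] := hyps.
apply: ev_imp few_exceptions => N N1 h; have := T_bound N1.
have h1 : 1 <= N `^ (1 / 2 + alpha) by apply: powR_ge1; lra.
rewrite natrD !natrM /nu; lra.
Qed.

(** [kappa * T] is about [N^(1/100) / 4], which outgrows every multiple of [ln N]; so the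
    exponential decay of the energy beats any fixed power of [N]. *)
Lemma energy_small : ev (fun N => forall rho, N `^ (- B) / 2 <= rho ->
  (1 - g * kappa N) ^+ T N < rho ^+ 2 / 16).
Proof.
have [ha ha' hB he he'] := hyps.
have g0 : 0 < g := gain_gt0 nu0.
have [|N0 h] := @ev_lnE (4 / g * (7 + g + 2 * B)) (1 / 100); first by lra.
exists N0 => N hN N1 rho hrho; have {h} h := h N hN N1.
have N0' : 0 < N := lt_le_trans ltr01 N1.
have k0 : 0 <= kappa N by exact: powR_ge0.
have k1 : kappa N <= 1 by rewrite /kappa powRN invf_le1 ?powR_pos // powR_ge1 //; lra.
have gk := gain_kappa N1.
have kT : N `^ (1 / 100) / 4 - 1 <= kappa N * (T N)%:R.
  have e : N `^ (1 / 100) = kappa N * N `^ (1 / 2 + alpha).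
    by rewrite /kappa -powR_add //; congr (_ `^ _); ring.
  have : N `^ (1 / 2 + alpha) / 4 <= (T N)%:R + 1.
    by rewrite natr1; exact/ltW/truncnS_gt.
  move=> /(ler_wpM2l k0); rewrite e; lra.
have h1 : (1 - g * kappa N) ^+ T N <= expR (- (g * (N `^ (1 / 100) / 4 - 1))).
  apply: le_trans (_ : expR (- (g * kappa N)) ^+ T N <= _).
    apply: lerXn2r; rewrite ?nnegrE ?expR_ge0 ?subr_ge0 //.
    by have := expR_ge1Dx (- (g * kappa N)); lra.
  rewrite -expRM_natr ler_expR; have := ler_wpM2l (ltW g0) kT; lra.
apply: le_lt_trans h1 _.
have e2 : 2 <= expR 1 :> R by have := expR_ge1Dx (1 : R); lra.
(* 64 is the 16 of the statement times the 4 from squaring [N^(-B) / 2]. *)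
have e7 : 64 < expR 7 :> R.
  have -> : 7 = 1 * 7%:R :> R by rewrite mul1r.
  rewrite expRM_natr; apply: lt_le_trans (_ : 2 ^+ 7 <= _).
    by rewrite -natrX ltr_nat.
  by apply: lerXn2r; rewrite ?nnegrE // expR_ge0.
have h2 : 7 + 2 * B * ln N <= g * (N `^ (1 / 100) / 4 - 1).
  have L0 := ln_ge0 N1.
  have : g * (4 / g * (7 + g + 2 * B) * ln N + 4 / g * (7 + g + 2 * B)) <= g * N `^ (1 / 100).
    by rewrite ler_wpM2l // ltW.
  have -> : g * (4 / g * (7 + g + 2 * B) * ln N + 4 / g * (7 + g + 2 * B)) =
     4 * (7 + g + 2 * B) * ln N + 4 * (7 + g + 2 * B) by field; rewrite gt_eqF.
  have : 0 <= (7 + g) * ln N by rewrite mulr_ge0 // addr_ge0 // ltW.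
  lra.
have hr : N `^ (- B) ^+ 2 / 4 <= rho ^+ 2.
  have -> : N `^ (- B) ^+ 2 / 4 = (N `^ (- B) / 2) ^+ 2 by field.
  have b0 : 0 <= N `^ (- B) / 2 by rewrite divr_ge0 // powR_ge0.
  by apply: lerXn2r; rewrite ?nnegrE // (le_trans b0).
apply: lt_le_trans (_ : N `^ (- B) ^+ 2 / 4 / 16 <= _); last by rewrite ler_pM2r // invr_gt0.
have -> : N `^ (- B) ^+ 2 = expR (- (2 * B * ln N)).
  by rewrite -powR_mulrn ?powR_ge0 // -powRrM /powR gt_eqF //; congr expR; ring.
apply: le_lt_trans (_ : expR (- (7 + 2 * B * ln N)) < _); first by rewrite ler_expR; lra.
rewrite opprD expRD -mulrA mulrC -mulrA ltr_pM2l ?expR_gt0 // expRN.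
by rewrite -invfM -natrM ltf_pV2 ?posrE ?expR_gt0.
Qed.

Lemma m_kappa N : 1 <= N -> (m N)%:R ^+ 2 * kappa N <= 1.
Proof.
have [ha ha' hB he he'] := hyps.
move=> N1; have h : (m N)%:R <= N `^ (1 / 4 + alpha / 2 - 1 / 200).
  by apply: natr_truncn_le; exact: powR_ge0.
apply: le_trans (_ : N `^ (1 / 4 + alpha / 2 - 1 / 200) ^+ 2 * kappa N <= _).
  rewrite ler_wpM2r ?powR_ge0 //; apply: lerXn2r => //; rewrite nnegrE ?powR_ge0 //.
rewrite -powR_mulrn ?powR_ge0 // -powRrM /kappa -powR_add //.
by rewrite [X in N `^ X](_ : _ = 0) ?powRr0 //; field.
Qed.

Lemma K_le N : (K N)%:R <= N `^ (1 / 20).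
Proof. by apply: natr_truncn_le; exact: powR_ge0. Qed.

Lemma twoK N : 1 <= N -> (2 * K N + 5)%:R <= 7 * N `^ (1 / 20).
Proof.
have [ha ha' hB he he'] := hyps.
move=> N1; have := K_le N; have : 1 <= N `^ (1 / 20) by apply: powR_ge1; lra.
rewrite natrD natrM; lra.
Qed.

(** [J * K] needs the exponent [alpha/2 + 16/100], while [m] provides [alpha/2 + 49/200]. The
    constant 2355 is [785 * 3]. *)
Lemma J_ok : ev (fun N => (J N * (2 * K N + 1) <= m N)%N).
Proof.
have [ha ha' hB he he'] := hyps.
have [|N0 h] := @ev_pow 2355 (alpha / 2 + 16 / 100) (1 / 4 + alpha / 2 - 1 / 200); first by lra.
exists N0 => N hN N1; rewrite truncn_ge_nat ?powR_ge0 //; apply: le_trans (h N hN N1).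
have h1 : 1 <= N `^ (alpha / 2 + 11 / 100) by apply: powR_ge1; lra.
have h2 : (J N)%:R <= 785 * N `^ (alpha / 2 + 11 / 100).
  rewrite /J -natr1; have := @natr_truncn_le (784 * N `^ (alpha / 2 + 11 / 100)).
  by rewrite mulr_ge0 ?powR_ge0 // => /(_ isT); lra.
have h3 : (2 * K N + 1)%:R <= 3 * N `^ (1 / 20).
  have := K_le N; have : 1 <= N `^ (1 / 20) by apply: powR_ge1; lra.
  rewrite natrD natrM; lra.
have -> : N `^ (alpha / 2 + 16 / 100) = N `^ (alpha / 2 + 11 / 100) * N `^ (1 / 20).
  by rewrite -powR_add //; congr (_ `^ _); field.
rewrite natrM; apply: le_trans (ler_pM _ _ h2 h3) _ => //.
by rewrite mulrACA -natrM.
Qed.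

(** 784 is [16 * 7^2], with 7 from [twoK]; the exponent [11/100] adds the [1/10] of the squared
    [N^(1/20)] to the [1/100] of the pigeonhole. *)
Lemma J_large N : 1 <= N ->
  (2 * K N + 5)%:R ^+ 2 * 16 * N `^ (alpha / 2 + 1 / 100) <= (J N)%:R.
Proof.
have [ha ha' hB he he'] := hyps.
move=> N1; apply: le_trans (_ : 784 * N `^ (alpha / 2 + 11 / 100) <= _); last first.
  exact/ltW/truncnS_gt.
have h : (2 * K N + 5)%:R ^+ 2 <= 49 * N `^ (1 / 10).
  apply: le_trans (_ : (7 * N `^ (1 / 20)) ^+ 2 <= _).
    by apply: lerXn2r; rewrite ?nnegrE ?mulr_ge0 ?powR_ge0 // twoK.
  rewrite exprMn -natrX -powR_mulrn ?powR_ge0 // -powRrM (_ : 1 / 20 * 2%:R = 1 / 10) //.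
  by field.
have -> : N `^ (alpha / 2 + 11 / 100) = N `^ (1 / 10) * N `^ (alpha / 2 + 1 / 100).
  by rewrite -powR_add //; congr (_ `^ _); field.
rewrite !mulrA ler_wpM2r ?powR_ge0 //; lra.
Qed.

Lemma t_large N : 1 <= N -> N `^ (B + 1) <= (2 ^ t N)%:R.
Proof.
have [ha ha' hB he he'] := hyps.
move=> N1; have N0' : 0 < N := lt_le_trans ltr01 N1.
have ht : 2 * (B + 1) * ln N <= (t N)%:R by exact/ltW/truncnS_gt.
have e2 : expR (1 / 2) <= 2 :> R.
  have := expR_ge1Dx (- (1 / 2) : R); rewrite expRN => h.
  have : (2 : R)^-1 <= (expR (1 / 2))^-1 by lra.
  by rewrite lef_pV2 ?posrE ?expR_gt0.
rewrite natrX; apply: le_trans (_ : expR (1 / 2) ^+ t N <= _); last first.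
  by apply: lerXn2r; rewrite ?nnegrE // expR_ge0.
rewrite -expRM_natr /powR gt_eqF // ler_expR; lra.
Qed.

Lemma l_large N : 1 <= N -> N `^ (B + 1) <= ((l N).+1 ^ (gap_dim B))%:R.
Proof.
move=> N1; have [ha ha' hB he he'] := hyps.
have hl : N `^ (1 / 25) <= (l N).+1%:R by exact/ltW/truncnS_gt.
rewrite natrX; apply: le_trans (_ : N `^ (1 / 25) ^+ (gap_dim B) <= _); last first.
  by apply: lerXn2r; rewrite ?nnegrE ?powR_ge0.
rewrite -powR_mulrn ?powR_ge0 // -powRrM; apply: ler_powR => //.
have : 25 * (B + 1) <= (gap_dim B)%:R by exact/ltW/truncnS_gt.
lra.
Qed.

Lemma sums_small : ev (fun N => (2 * K N + 5)%:R ^+ 2 * 16 * N `^ B < N `^ (B + 1)).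
Proof.
have [ha ha' hB he he'] := hyps.
have [|N0 h] := @ev_pow 785 (1 / 10 + B) (B + 1); first by lra.
exists N0 => N hN N1; apply: lt_le_trans (h N hN N1).
have p := powR_pos (1 / 10 + B) N1.
apply: le_lt_trans (_ : 784 * N `^ (1 / 10 + B) < _); last by rewrite ltr_pM2r //; lra.
have hK : (2 * K N + 5)%:R ^+ 2 <= 49 * N `^ (1 / 10).
  apply: le_trans (_ : (7 * N `^ (1 / 20)) ^+ 2 <= _).
    by apply: lerXn2r; rewrite ?nnegrE ?mulr_ge0 ?powR_ge0 // twoK.
  rewrite exprMn -natrX -powR_mulrn ?powR_ge0 // -powRrM (_ : 1 / 20 * 2%:R = 1 / 10) //.
  by field.
rewrite powR_add // mulrA ler_wpM2r ?powR_ge0 //; lra.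
Qed.

(** [N^(1/500)] stands in for the logarithm in [t], so the dominant term [t^2 l] has exponent
    [1/250 + 1/25], below the [1/20] of [K]. *)
Lemma radius_ok : ev (fun N => [/\ (gap_radius (gap_dim B) (t N) (t N) (l N) <= K N)%N,
  (t N <= K N)%N & ((gap_dim B) * l N <= K N)%N]).
Proof.
have [ha ha' hB he he'] := hyps.
have [|N0 h0] := @ev_lnE (2 * (B + 1)) (1 / 500); first by lra.
rewrite /gap_radius; move: (gap_const (gap_dim B)) => G.
have [|N2 h2] := @ev_pow (G + 2 + (gap_dim B))%:R (1 / 250 + 1 / 25) (1 / 20); first by lra.
exists (Num.max N0 N2) => N; rewrite ge_max => /andP[/h0 {}h0 /h2 {}h2] N1.
have {}h0 := h0 N1; have {}h2 := h2 N1.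
have ht : (t N)%:R <= N `^ (1 / 500).
  have L0 := ln_ge0 N1; rewrite /t -natr1.
  have := @natr_truncn_le (2 * (B + 1) * ln N).
  rewrite mulr_ge0 //; last by lra.
  by move=> /(_ isT); lra.
have hl : (l N)%:R <= N `^ (1 / 25) by apply: natr_truncn_le; exact: powR_ge0.
set P := N `^ (1 / 250 + 1 / 25) in h2.
have p1 : N `^ (1 / 500) <= P by apply: ler_powR => //; lra.
have p2 : N `^ (1 / 25) <= P by apply: ler_powR => //; lra.
have p3 : N `^ (1 / 500) * (N `^ (1 / 500) * N `^ (1 / 25)) <= P.
  by rewrite -!powR_add //; apply: ler_powR => //; lra.
have P0 : 0 <= P by exact: powR_ge0.
have G0 : 0 <= G%:R :> R by [].
have D0 : 0 <= (gap_dim B)%:R :> R by [].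
rewrite !natrD in h2.
split; rewrite truncn_ge_nat ?powR_ge0 //; apply: le_trans h2.
- rewrite !(natrD, natrM).
  have q1 : G%:R * (t N)%:R <= G%:R * P.
    by rewrite ler_wpM2l // (le_trans ht).
  have q2 : (t N)%:R * ((t N)%:R * (l N)%:R) <= P.
    by apply: le_trans p3; apply: ler_pM => //; rewrite ?mulr_ge0 //; apply: ler_pM.
  have := mulr_ge0 D0 P0; lra.
- have := mulr_ge0 D0 P0; have := mulr_ge0 G0 P0; lra.
- rewrite natrM; have : (gap_dim B)%:R * (l N)%:R <= (gap_dim B)%:R * P by rewrite ler_wpM2l // (le_trans hl).
  have := mulr_ge0 G0 P0; lra.
Qed.

Lemma eventual_parameters : ev (good_parameters alpha B eps).
Proof.
have [ha ha' hB he he'] := hyps.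
have := ev_and few_exceptions (ev_and count_ok (ev_and energy_small
  (ev_and J_ok (ev_and sums_small radius_ok)))).
apply: ev_imp => N N1 [h1 [h2 [h3 [h4 [h5 [h6 h7 h8]]]]]].
exists (T N), (K N), (J N), (m N), (t N), (l N), (kappa N); split => //.
- by split; [exact: powR_pos|exact: gain_kappa].
- split; first exact: T_bound.
  have := powR_pos (1 / 2 + alpha) N1.
  have : eps * N <= N by rewrite ler_piMl // (le_trans ler01).
  lra.
split => //; first exact: m_kappa.
split; [exact: lt_le_trans h5 (t_large N1)|exact: lt_le_trans h5 (l_large N1)|exact: J_large|].
apply: le_trans (K_le N) _; rewrite -[leRHS]powRr1 ?(le_trans ler01) //.
by apply: ler_powR => //; lra.
Qed.

End ScaleChoices.
End Eventually.

(** * Structure at a fixed scale *)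

Section Vectors.
Variables (R : realType) (n : nat).
Implicit Types (u v : 'I_n -> R[i]).

Lemma sqr_cabsD (z z' : R[i]) : cabs (z + z') ^+ 2 <= 2 * cabs z ^+ 2 + 2 * cabs z' ^+ 2.
Proof.
have h : cabs (z + z') ^+ 2 <= (cabs z + cabs z') ^+ 2.
  have h1 := cabs_ge0 z; have h2 := cabs_ge0 z'.
  by apply: lerXn2r; rewrite ?nnegrE ?addr_ge0 ?cabsD ?cabs_ge0.
have := sqr_ge0 (cabs z - cabs z'); nra.
Qed.

Lemma cvnorm_perturb u v (e : R) : \sum_i cabs (v i) ^+ 2 = 1 ->
  (forall i, cabs (u i - v i) <= e) -> n%:R * e ^+ 2 <= 1 / 8 ->
  1 / 2 <= cvnorm u /\ cvnorm u <= 2.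
Proof.
move=> v1 h ne.
have he i : cabs (u i - v i) ^+ 2 <= e ^+ 2.
  by apply: lerXn2r (h i); rewrite nnegrE ?cabs_ge0 // (le_trans (cabs_ge0 _) (h i)).
have sum_e : \sum_(i < n) e ^+ 2 = n%:R * e ^+ 2 by rewrite sumr_const card_ord mulr_natl.
have up : \sum_i cabs (u i) ^+ 2 <= 2 * (\sum_i cabs (v i) ^+ 2) + 2 * (\sum_(i < n) e ^+ 2).
  rewrite !mulr_sumr -big_split; apply: ler_sum => i _ /=.
  have := sqr_cabsD (v i) (u i - v i); rewrite (addrC (v i)) subrK; have := he i; lra.
have lo : \sum_i cabs (v i) ^+ 2 <= 2 * (\sum_i cabs (u i) ^+ 2) + 2 * (\sum_(i < n) e ^+ 2).
  rewrite !mulr_sumr -big_split; apply: ler_sum => i _ /=.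
  have := sqr_cabsD (u i) (- (u i - v i)); rewrite opprB (addrC (u i)) subrK -opprB cabsN.
  have := he i; lra.
rewrite v1 sum_e in up lo.
rewrite /cvnorm; set S := \sum_i _ in up lo *.
have sq (a : R) : 0 <= a -> Num.sqrt (a ^+ 2) = a by move=> a0; rewrite sqrtr_sqr ger0_norm.
split.
  by rewrite -[leLHS](sq (1 / 2)); [apply: ler_wsqrtr|]; lra.
rewrite -[leRHS](sq 2) //; apply: ler_wsqrtr; lra.
Qed.

Lemma cinner_perturb u v w (e M : R) : cinner v w = 0 ->
  (forall i, cabs (u i - v i) <= e) -> (forall i, cabs (w i) <= M) ->
  cabs (cinner u w) <= n%:R * (e * M).
Proof.
move=> vw h hM; rewrite -[cinner u w]subr0 -vw /cinner -sumrB.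
apply: le_trans (cabs_sum _) _.
rewrite mulr_natl -[X in _ *+ X](card_ord n) -sumr_const; apply: ler_sum => i _.
by rewrite -mulrBl cabsM cabs_conj ler_pM ?cabs_ge0.
Qed.

(** [cinner] conjugates its second argument, whereas cofactor expansion is bilinear; so it is the
    conjugate of the cofactor vector that is orthogonal to the rows. *)
Lemma cinner_conj (y w : 'I_n -> R[i]) :
  cinner (fun i => (y i)^*) w = (\sum_i w i * y i)^*.
Proof.
rewrite /cinner rmorph_sum; apply: eq_bigr => i _.
by rewrite rmorphM mulrC.
Qed.

End Vectors.

(** An off-diagonal entry of the product of [X] with its adjugate. *)
Lemma cofactor_orthogonal (A : comNzRingType) n (X : 'M[A]_n.+1) (i : 'I_n) :
  \sum_j X (lift ord0 i) j * cofactor X ord0 j = 0.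
Proof.
have := congr1 (fun Y : 'M_n.+1 => Y (lift ord0 i) ord0) (mul_mx_adj X).
rewrite !mxE /= mulr0n => h; rewrite -[RHS]h.
by apply: eq_bigr => j _; rewrite [in RHS]mxE.
Qed.

Section Rounding.
Variable R : realType.

(** A coarse cell has side [1/q] and holds [2 H'] fine units: rounding to the grid costs [1/q], and
    the floor costs one fine unit, at most [1/q]. *)
Lemma scale_close (q H' : nat) (z w : int * int) (y : R[i]) :
  (0 < q)%N -> (0 < H')%N ->
  (nrm (z *~ (2 * H')%N - w)%R <= 2 * H')%N ->
  w = (Num.floor (q%:R * (2 * H')%:R * complex.Re y), Num.floor (q%:R * (2 * H')%:R * complex.Im y)) ->
  `|complex.Re (scale q%:R z - y)| <= 2 / q%:R /\ `|complex.Im (scale q%:R z - y)| <= 2 / q%:R.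
Proof.
move=> q0 H0 /nrm_leP hz ew.
have qR : 0 < q%:R :> R by rewrite ltr0n.
have HR : 1 <= (2 * H')%:R :> R by rewrite ler1n; lia.
have key (a : int) (t : R) :
    (absz (a * (2 * H')%N%:Z - Num.floor (q%:R * (2 * H')%:R * t))%R <= 2 * H')%N ->
    `|a%:~R / q%:R - t| <= 2 / q%:R.
  move=> h; pose P : R := q%:R * (2 * H')%:R; rewrite -/P in h.
  have h1 : `|a%:~R * (2 * H')%:R - (Num.floor (P * t))%:~R| <= (2 * H')%:R :> R.
    have : `|a * (2 * H')%N%:Z - Num.floor (P * t)| <= (2 * H')%N%:Z by move: h; clear; lia.
    by rewrite -(@ler_int R) intr_norm intrB intrM.
  have /andP[f1 f2] := floor_itv (P * t); rewrite intrD in f2.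
  have h2 : `|a%:~R * (2 * H')%:R - P * t| <= 2 * (2 * H')%:R.
    move: h1; rewrite !ler_norml => /andP[g1 g2]; apply/andP; split; lra.
  have -> : a%:~R / q%:R - t = (a%:~R * (2 * H')%:R - P * t) / P.
    by rewrite /P; field; rewrite ?pnatr_eq0 -?lt0n ?muln_gt0 ?q0 ?H0.
  have P0 : 0 < P by rewrite /P mulr_gt0 // (lt_le_trans ltr01).
  rewrite normrM normfV (gtr0_norm P0) ler_pdivrMr //.
  by rewrite /P mulrA mulfVK ?gt_eqF.
move: hz; rewrite ew pairMz /= !mulrzz => -[h1 h2].
by rewrite ReD ReN ImD ImN /=; split; apply: key.
Qed.

Lemma small_rat_scale (q : nat) (z : int * int) (M : R) : (0 < q)%N ->
  q%:R <= M -> (nrm z)%:R <= M -> small_rat_c M (scale q%:R z).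
Proof.
move=> q0 qM zM; have /nrm_leP[h1 h2] := leqnn (nrm z).
have key (a : int) : (`|a| <= nrm z)%N -> small_rat M (a%:~R / q%:R).
  move=> ha; exists a, q; split; first by rewrite eqz_nat -lt0n.
  split; last by split => //; rewrite ger0_norm.
  by apply: le_trans zM; rewrite -abszE ler_nat.
by split; apply: key.
Qed.

End Rounding.

Lemma structure_at_scale (R : realType) (n : nat) (sbar : int) (v : 'I_n.+1 -> R[i])
    (alpha B eps beta : R) :
  let N : R := n.+1%:R in
  0 < eps -> good_parameters alpha B eps N ->
  `|sbar|%:~R <= (1 - eps) * N + 1 -> 0 < beta -> beta <= 1 / 64 ->
  N `^ (- B) <= rho_star sbar beta v ->
  exists (q K : nat) (g : int * int) (i0 : 'I_n.+1) (r : 'I_n.+1 -> int * int)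
    (s : seq ((int * int) * nat)),
    [/\ (0 < q)%N /\ q%:R <= (32 * beta)^-1,
        forall i, cabs (scale q%:R (g + r i) - v i) <= 256 * beta,
        (size s <= gap_dim B)%N /\
          N - N `^ (1 / 2 + alpha) <= #|[set i | `[< ingap s (r i) >]]|%:R,
        r i0 = 0 /\ (K%:R <= N /\ forall p, p \in s -> sums r K p.1) &
        card_le (ingap s) (Num.max 1 ((rho_star sbar beta v)^-1 / N `^ (alpha / 2 + 1 / 100)))].
Proof.
move=> N eps0 [T [K [J [m [t [l [kappa [[k0 gk] cnt esm [T1 T2] [mk J0 Jm [tK dK rK] [bt bd JJ KN]]]]]]]]]].
move=> hsbar beta0 beta64 hrho.
have N1 : 1 <= N by rewrite ler1n.
have NB := powR_pos (- B) N1.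
set f := rho_star sbar beta v in hrho *.
have f0 : 0 < f by exact: lt_le_trans hrho.
have Om0 : (0 < #|sumvecs n.+1 sbar|)%N.
  by rewrite lt0n; apply: contraTneq f0 => h; rewrite /f rho_star_empty ?ltxx.
have [z hz] := rho_star_half f0.
(* [beta <= 1/64] makes the truncated number at least 2, so truncation loses at most a factor 2 and
   the grid step [1/q] is between [32 beta] and [64 beta]. *)
pose q := Num.truncn (32 * beta)^-1.
have ib : 0 < (32 * beta)^-1 by rewrite invr_gt0 mulr_gt0.
have ib2 : 2 <= (32 * beta)^-1.
  have h : 2 * (32 * beta) <= 1 by lra.
  by rewrite -[leRHS]mul1r ler_pdivlMr // mulr_gt0.
have q0 : (0 < q)%N by rewrite truncn_gt0; lra.
have qle : q%:R <= (32 * beta)^-1 by exact/natr_truncn_le/ltW.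
have qge : (64 * beta)^-1 <= q%:R.
  have h := truncnS_gt (32 * beta)^-1; rewrite -/q -(natr1 q) in h.
  have q1 : 1 <= q%:R :> R by rewrite ler1n.
  have -> : (64 * beta)^-1 = (32 * beta)^-1 / 2 by field; rewrite gt_eqF.
  lra.
have qR : 0 < q%:R :> R by rewrite ltr0n.
(* With [32 N] fine units in a coarse cell, [beta] is at most [N] fine units, and the resulting box
   radius [2 N + 1] stays below [H']. *)
pose H' := (16 * n.+1)%N; have H'0 : (0 < H')%N by [].
pose Q : R := q%:R * (2 * H')%:R.
have Qb : Q * beta <= n.+1%:R.
  have : q%:R * (32 * beta) <= 1 by rewrite -ler_pdivlMr ?mulr_gt0 // mul1r.
  have -> : Q * beta = q%:R * (32 * beta) * n.+1%:R.
    by rewrite /Q /H' mulnA natrM; ring.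
  by move=> h; rewrite ler_piMl.
have Q0 : 0 <= Q by rewrite /Q mulr_ge0.
have [c0 conc] := fine_concentration Q0 Qb Om0 hz.
rewrite -/f in hz conc.
have rho0 : 0 < f / 2 by rewrite divr_gt0.
have hrho2 : N `^ (- B) / 2 <= f / 2 by rewrite ler_pM2r ?invr_gt0.
have cnt' x (b : bool) : x \in sumvecs n.+1 sbar ->
    eps / 8 * n.+1%:R + (2 * T + 2)%:R <= #|[set k | x k == b]|%:R.
  move=> xO; apply: le_trans (slice_count R b xO); apply: le_trans cnt _.
  by rewrite ler_pM2r ?invr_gt0 // lerD2l lerN2.
have small : (2 * K + 5)%:R ^+ 2 * (8 / (f / 2)) <= (2 * K + 5)%:R ^+ 2 * 16 * N `^ B.
  have -> : 8 / (f / 2) = 16 * f^-1 by field; rewrite gt_eqF.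
  rewrite mulrA ler_wpM2l ?mulr_ge0 ?sqr_ge0 //.
  by rewrite -[N `^ B]invrK -powRN lef_pV2 // posrE.
have T4 : (4 * T < n.+1)%N by rewrite -(ltr_nat R); exact: le_lt_trans T1 T2.
have hH : (2 * n.+1 + 1 < H')%N by rewrite /H'; clear; lia.
have nu0 : 0 < eps / 8 by rewrite divr_gt0.
have [W [i0 [r [s [W1 r1 [s1 s2] s3 s4]]]]] :=
  discrete_structure nu0 k0 gk rho0 Om0 cnt' conc (esm _ hrho2) T4 hH mk J0 Jm tK dK rK
    (le_lt_trans small bt) (le_lt_trans small bd).
have [g hg] := nearest_pair (fine Q v i0) H'0.
exists q, K, g, i0, r, s; split => //.
- move=> i; have gi : (nrm ((g + r i) *~ (2 * H')%N - fine Q v i)%R <= 2 * H')%N.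
    have -> : (g + r i) *~ (2 * H')%N - fine Q v i =
      (g *~ (2 * H')%N - fine Q v i0) + (r i *~ (2 * H')%N - (fine Q v i - fine Q v i0)).
      by rewrite mulrzDl opprB addrACA addKr.
    by apply: leq_trans (nrmD _ _) _; rewrite [leqRHS]mul2n -addnn; exact: leq_add hg (r1 i).
  have [e1 e2] := scale_close q0 H'0 gi erefl.
  have e3 : 2 / q%:R <= 128 * beta.
    rewrite ler_pdivrMr //; have : 1 <= 64 * beta * q%:R.
      by rewrite mulrC -ler_pdivrMr ?mulr_gt0 // mul1r.
    lra.
  apply: le_trans (cabs_le (le_trans e1 e3) (le_trans e2 e3)) _; lra.
- split; first exact: ltnW.
  have h : (n.+1 <= #|[set i | `[< ingap s (r i) >]]| + 4 * T)%N.
    apply: leq_trans W1 _; rewrite leq_add2r; apply: subset_leq_card.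
    by apply/fintype.subsetP => i iW; rewrite finset.in_set; apply/asboolP; exact: s2.
  by move: h; rewrite -(ler_nat R) natrD; move: T1; rewrite -/N; clear; lra.
- split.
    (* A multiple of [2 H'] of norm at most [H'] is zero. So the base point of the progression is
       the entry of index [i0], which later gives its rationality. *)
    have := r1 i0; rewrite subrr subr0 nrmMz => h; apply: nrm_eq0.
    move: h; rewrite -[leqRHS]mul1n; case: (nrm (r i0)) => // k.
    by rewrite /H'; clear; lia.
  by split.
move=> u uu hu; apply: le_trans (s4 u uu hu) _; rewrite ge_max le_max lexx /=.
rewrite le_max; apply/orP; right.
have -> : (2 * K + 5)%:R ^+ 2 * (8 / (f / 2) / J%:R) = f^-1 * ((2 * K + 5)%:R ^+ 2 * 16 / J%:R).
  have fn0 : f != 0 by rewrite gt_eqF.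
  have Jn0 : J%:R != 0 :> R by rewrite pnatr_eq0 -lt0n.
  by field; rewrite fn0 Jn0.
rewrite ler_pM2l ?invr_gt0 // ler_pdivrMr ?ltr0n // [leRHS]mulrC ler_pdivlMr ?powR_pos //.
Qed.

(** * The normalized cofactor vector *)

Section UnitNormal.
Variables (R : realType) (n : nat) (X : 'M[R[i]]_n.+1).
Hypothesis X0 : exists i, cofactor X ord0 i != 0.
Let c : R := Num.sqrt (\sum_i cabs (cofactor X ord0 i) ^+ 2).
Let v : 'I_n.+1 -> R[i] := fun i => cofactor X ord0 i / c%:C.

Lemma cofactor_norm_gt0 : 0 < c.
Proof.
have [i hi] := X0; rewrite sqrtr_gt0 (bigD1 i) //=; apply: ltr_pwDl.
  rewrite exprn_gt0 // lt0r cabs_ge0 andbT; apply: contra hi => /eqP h.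
  by rewrite -normr_eq0 normr_cabs h.
by apply: sumr_ge0 => j _; exact: sqr_ge0.
Qed.

Lemma unit_normal_norm : \sum_i cabs ((v i)^*) ^+ 2 = 1.
Proof.
have c0 := cofactor_norm_gt0.
have e i : cabs ((v i)^*) ^+ 2 = cabs (cofactor X ord0 i) ^+ 2 / c ^+ 2.
  by rewrite cabs_conj /v cabsM -fmorphV cabs_real ger0_norm ?invr_ge0 ?ltW // exprMn exprVn.
under eq_bigr do rewrite e.
rewrite -mulr_suml [c ^+ 2]sqr_sqrtr ?divff //; last first.
  by apply: sumr_ge0 => j _; exact: sqr_ge0.
by rewrite gt_eqF // -sqrtr_gt0.
Qed.

Lemma unit_normal_orthogonal (i : 'I_n) :
  cinner (fun j => (v j)^*) (fun j => X (lift ord0 i) j) = 0.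
Proof.
rewrite cinner_conj; under eq_bigr do rewrite /v mulrA.
by rewrite -mulr_suml cofactor_orthogonal mul0r conjc0.
Qed.

End UnitNormal.

(** * Inequalities at the chosen scale *)

Section Numerics.
Variables (R : realType) (N A B gam beta : R) (k : nat).
Let E := 5 * B + 5 + gam.
Hypotheses (N2000 : 2000 <= N) (A4 : 4 <= A) (B0 : 0 < B) (gam0 : 0 < gam).
Hypothesis kA : k%:R <= A / (10 * B + 10 + 2 * gam).
Hypothesis betaE : beta = N `^ (- A + k%:R * E).

Let hyps : [/\ 2000 <= N, 4 <= A, 0 < B & 0 < gam]. Proof. by []. Qed.
Let N1 : 1 <= N. Proof. by apply: le_trans N2000; rewrite ler1n. Qed.

(** The denominator [10 B + 10 + 2 gam] is [2 E], so [k E <= A/2] and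
    [beta <= N^(-A/2) <= N^(-2)]. *)
Lemma beta_sqr : beta * N ^+ 2 <= 1.
Proof.
have [h1 h2 h3 h4] := hyps.
rewrite betaE -powR_mulrn ?(le_trans ler01) // -powR_add // -[leRHS](powRr0 N).
apply: ler_powR => //.
have D0 : 0 < 10 * B + 10 + 2 * gam by lra.
have := kA; rewrite ler_pdivlMr // => h5.
have : k%:R * E * 2 <= A by rewrite /E; move: h5; lra.
by move: h2 (k%:R * E) => h2 x h6; lra.
Qed.

Lemma beta_gt0 : 0 < beta.
Proof. by rewrite betaE powR_pos. Qed.

Lemma beta_small : beta <= 1 / 64.
Proof.
have [h1 _ _ _] := hyps; have := beta_sqr; have b0 := beta_gt0.
have : 64 <= N ^+ 2 by nra.
move=> h2 h3; have : beta * 64 <= beta * N ^+ 2 by rewrite ler_pM2l.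
lra.
Qed.

Lemma beta_ge : beta^-1 <= N `^ A.
Proof.
have [h1 h2 h3 h4] := hyps.
rewrite betaE -powRN; apply: ler_powR => //.
have : 0 <= k%:R * E by rewrite mulr_ge0 // /E; lra.
lra.
Qed.

Lemma error_norm : N * (256 * beta) ^+ 2 <= 1 / 8.
Proof.
have [h1 _ _ _] := hyps; have h2 := beta_sqr; have b0 := beta_gt0.
have h3 : beta * N <= 1 / 2000.
  have : beta * N * 2000 <= beta * N ^+ 2 by rewrite expr2 mulrA ler_wpM2l // mulr_ge0; lra.
  lra.
have h4 : beta <= 1 / 2000 by apply: le_trans h3; rewrite ler_peMr // ltW.
have -> : N * (256 * beta) ^+ 2 = (256 * (beta * N)) * (256 * beta) by ring.
have : (256 * (beta * N)) * (256 * beta) <= 1 / 4 * (1 / 4).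
  by apply: ler_pM; rewrite ?mulr_ge0 //; lra.
lra.
Qed.

(** [256 beta] is the rounding error of one entry, and [2 N^gam] bounds an entry of [X], a sign plus
    an entry of [F]. *)
Lemma inner_bound :
  N * (256 * beta * (2 * N `^ gam)) <= beta * N `^ (5 * B + 4 + gam).
Proof.
have [h1 h2 h3 h4] := hyps; have b0 := beta_gt0; have p0 := powR_pos gam N1.
have -> : N `^ (5 * B + 4 + gam) = N `^ gam * N `^ (5 * B + 4).
  by rewrite -powR_add //; congr (_ `^ _); ring.
have h5 : 512 * N <= N `^ (5 * B + 4).
  apply: le_trans (_ : N ^+ 2 <= _); first by nra.
  by rewrite -powR_mulrn ?(le_trans ler01) //; apply: ler_powR => //; lra.
have -> : N * (256 * beta * (2 * N `^ gam)) = beta * (N `^ gam * (512 * N)) by ring.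
by rewrite ler_pM2l // ler_pM2l.
Qed.

(** The spare power of [N] between the exponents [5B+4+gam] and [5B+5+gam] absorbs the rounding of
    all coordinates, so the concentration of [u] is controlled by that of [v] at the next scale. *)
Lemma radius_step :
  beta * N `^ (5 * B + 4 + gam) + N * (256 * beta) <= N `^ (- A + k.+1%:R * E).
Proof.
have [h1 h2 h3 h4] := hyps; have b0 := beta_gt0.
have -> : N `^ (- A + k.+1%:R * E) = beta * (N * N `^ (5 * B + 4 + gam)).
  rewrite betaE -{3}(powRr1 (le_trans ler01 N1)) -!powR_add //; congr (_ `^ _).
  by rewrite -natr1 /E; ring.
have h5 : N <= N `^ (5 * B + 4 + gam).
  by rewrite -{1}(powRr1 (le_trans ler01 N1)); apply: ler_powR => //; lra.
have -> : beta * N `^ (5 * B + 4 + gam) + N * (256 * beta) =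
  beta * (N `^ (5 * B + 4 + gam) + 256 * N) by ring.
rewrite ler_pM2l //; nra.
Qed.

End Numerics.

Unset Implicit Arguments.

Theorem theorem3p2 :
  forall R : realType,
  (* ||u|| ~ 1 : absolute constants *)
  exists c1 c2 : R, 0 < c1 /\ 0 < c2 /\
  forall alpha B : R, 0 < alpha -> alpha < 1 / 2 -> 0 < B ->
  (* constants of O_{alpha,B}(1) (rank) and O_{alpha,B}(.) (size) *)
  exists (r0 : nat) (C0 : R), 0 < C0 /\
  forall eps gam : R, 0 < eps -> eps <= 1 -> 0 < gam ->
  (* A sufficiently large *)
  exists A0 : R, forall A : R, A0 <= A ->
  (* n sufficiently large; the matrix size is N = n.+1 *)
  exists n0 : nat, forall n : nat, (n0 <= n.+1)%N ->
  let Nr : R := (n.+1)%:R in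
  forall (s : int) (Xn : 'M[int]_(n.+1)) (F : 'M[R[i]]_(n.+1)),
    `|s|%:~R <= (1 - eps) * Nr ->
    (forall i j, Xn i j = 1 \/ Xn i j = -1) ->
    (forall i, \sum_j Xn i j = s - 1 \/ \sum_j Xn i j = s + 1) ->
    (forall i j, cabs (F i j) <= Nr `^ gam) ->
    let X : 'M[R[i]]_(n.+1) := map_mx (fun z : int => z%:~R) Xn + F in
    (exists i, cofactor X ord0 i != 0) ->
    let c : R := Num.sqrt (\sum_i cabs (cofactor X ord0 i) ^+ 2) in
    let v : 'I_(n.+1) -> R[i] := fun i => cofactor X ord0 i / c%:C in
    forall sbar : int, (sbar = s - 1 \/ sbar = s + 1) ->
    Nr `^ (- B) <= rho_star sbar (Nr `^ (- A)) v ->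
    exists (u : 'I_(n.+1) -> R[i]) (k : nat),
      k%:R <= A / (10 * B + 10 + 2 * gam) /\
      let beta : R := Nr `^ (- A + k%:R * (5 * B + 5 + gam)) in
      (* (1) *)
      (c1 <= cvnorm u /\ cvnorm u <= c2) /\
      (forall i : 'I_n,
          cabs (cinner u (fun j => X (lift ord0 i) j))
            <= beta * Nr `^ (5 * B + 4 + gam)) /\
      (* (2) and (3) *)
      exists (g0 : R[i]) (gens : seq (R[i] * int * int)),
        gap_wf gens /\ (gap_rank gens <= r0)%N /\
        (gap_card g0 gens)%:R
          <= Num.max 1 (C0 * (rho_star sbar (beta * Nr `^ (5 * B + 4 + gam)) u)^-1
                          / Nr `^ (alpha / 2)) /\
        Nr - Nr `^ (1 / 2 + alpha)
          <= (#|[set i : 'I_(n.+1) | u i \in gap_elems g0 gens]|)%:R /\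
        (forall i, small_rat_c (Nr `^ (A + 1)) (u i)) /\
        small_rat_c (Nr `^ (A + 1)) g0 /\
        (forall t, t \in gens -> small_rat_c (Nr `^ (A + 1)) t.1.1).
Proof.
move=> R; exists (1 / 2), 2; split; first by rewrite divr_gt0.
split=> // alpha B al0 al1 B0; exists (gap_dim B), 1; split=> // eps gam eps0 eps1 gam0.
have E0 : 0 < 5 * B + 5 + gam by lra.
(* The product gives [A / (2 E) >= 100 B], enough scales for a loss of [N^(1/100)]; the 4 serves
   [beta_sqr]. *)
exists (4 + 200 * (5 * B + 5 + gam) * B) => A hA.
have A4 : 4 <= A.
  have : 0 <= 200 * (5 * B + 5 + gam) * B by rewrite !mulr_ge0 // ltW.
  by move=> h; apply: le_trans hA; rewrite lerDl.
have [N0 hN0] := eventual_parameters al0 al1 B0 eps0 eps1.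
exists (Num.truncn N0 + 2000)%N => n hn Nr s Xn F hs hX hrow hF X X0 c v sbar hsb hrho.
have N2000 : 2000 <= Nr by rewrite ler_nat; apply: leq_trans hn; exact: leq_addl.
have N1 : 1 <= Nr by rewrite ler1n.
have good : good_parameters alpha B eps Nr.
  apply: hN0 => //; apply: le_trans (ltW (truncnS_gt N0)) _; rewrite ler_nat.
  by apply: leq_trans hn; rewrite -addn1 leq_add2l.
have hsb1 : `|sbar|%:~R <= (1 - eps) * Nr + 1.
  apply: le_trans (_ : (`|s| + 1)%:~R <= _); last by rewrite intrD lerD2r.
  by rewrite ler_int; case: hsb => ->; clear; lia.
pose rad (k : nat) := Nr `^ (- A + k%:R * (5 * B + 5 + gam)).
pose Kn := Num.truncn (A / (10 * B + 10 + 2 * gam)).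
have D0 : 0 < 10 * B + 10 + 2 * gam by lra.
have hKn : B <= 1 / 100 * Kn.+1%:R.
  have h1 := truncnS_gt (A / (10 * B + 10 + 2 * gam)); rewrite -/Kn in h1.
  have : 100 * B <= A / (10 * B + 10 + 2 * gam).
    rewrite ler_pdivlMr //; apply: le_trans hA.
    by move: B0 gam0; clear; nra.
  by move: h1; move: (A / _) (Kn.+1%:R) => x y h1; clear -h1; lra.
have f0 : Nr `^ (- B) <= rho_star sbar (rad 0%N) v by rewrite /rad mul0r addr0.
have [k [kK fk]] := pigeonhole_scale (f := fun k => rho_star sbar (rad k) v) N1 hKn f0
  (fun k => rho_star_le1 _ _ _).
rewrite /= in fk.
have kA : k%:R <= A / (10 * B + 10 + 2 * gam).
  by rewrite -truncn_ge_nat // divr_ge0 // ltW // (lt_le_trans _ A4).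
set beta := rad k in fk *; have betaE : beta = Nr `^ (- A + k%:R * (5 * B + 5 + gam)) by [].
have b0 := beta_gt0 N2000 betaE.
pose v' i := (v i)^*.
have rho_v' r : rho_star sbar r v' = rho_star sbar r v by exact: rho_star_conj.
have fbeta : Nr `^ (- B) <= rho_star sbar beta v'.
  rewrite rho_v'; apply: le_trans f0 _; apply: rho_star_mono => z; exists z.
  apply: smallball_prob_mono => x _ h; apply: le_trans h _.
  by apply: ler_powR => //; rewrite mul0r lerD2l mulr_ge0 // ltW.
have [q [K [g [i0 [r [gs [[q0 qle] hu [hgs hcount] [ri0 [KN hgen]] hcard]]]]]]] :=
  structure_at_scale eps0 good hsb1 b0 (beta_small N2000 A4 B0 gam0 kA betaE) fbeta.
rewrite rho_v' in hcard.
have v'1 : \sum_i cabs (v' i) ^+ 2 = 1 by exact: unit_normal_norm.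
pose u i : R[i] := scale q%:R (g + r i).
have hu' i : cabs (u i - v' i) <= 256 * beta by exact: hu.
have f_gt0 : 0 < rho_star sbar beta v.
  by rewrite -rho_v'; apply: lt_le_trans fbeta; exact: powR_pos.
(* Here the choice of [k] enters: the extra [N^(1/100)] in the bound on the size cancels against
   this factor. *)
have rhou : rho_star sbar (beta * Nr `^ (5 * B + 4 + gam)) u <= Nr `^ (1 / 100) * rho_star sbar beta v.
  apply: le_trans fk; rewrite -rho_v'; apply: rho_star_perturb hu' _.
  exact: radius_step.
have qA : 32 * q%:R <= Nr `^ A.
  apply: le_trans (beta_ge N2000 A4 B0 gam0 betaE).
  by move: qle; rewrite invfM ler_pdivlMl.
have NA : Nr `^ (A + 1) = Nr `^ A * Nr by rewrite powR_add // powRr1 // (le_trans ler01).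
have qR : 0 < q%:R :> R by rewrite ltr0n.
have nrm_u i : (nrm (g + r i))%:R <= 2 * q%:R :> R.
  have v1 : cabs (v' i) <= 1.
    rewrite -(@ler_pXn2r _ 2) ?nnegrE ?cabs_ge0 // expr1n -v'1 (bigD1 i) //= lerDl.
    by apply: sumr_ge0 => j _; exact: sqr_ge0.
  have u2 : cabs (u i) <= 2.
    rewrite -[u i](subrK (v' i)); apply: le_trans (cabsD _ _) _; apply: le_trans (lerD (hu' i) v1) _.
    have := error_norm N2000 A4 B0 gam0 kA betaE => h.
    have : (256 * beta) ^+ 2 <= 1.
      by apply: le_trans (_ : Nr * (256 * beta) ^+ 2 <= _); [rewrite ler_peMl ?sqr_ge0|apply: le_trans h _; rewrite ler_pdivrMr // mul1r ler1n].
    move=> h1; have : 256 * beta <= 1.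
      by rewrite -(@ler_pXn2r _ 2) ?nnegrE ?mulr_ge0 ?(ltW b0) // expr1n.
    by clear; lra.
  have key (a : int) : `|a%:~R / q%:R| <= 2 :> R -> (`|a|%N)%:R <= 2 * q%:R :> R.
    rewrite normrM normfV (gtr0_norm qR) ler_pdivrMr // => h.
    by apply: le_trans h; rewrite -intr_norm -abszE.
  have h1 := key _ (le_trans (Re_le_cabs (u i)) u2).
  have h2 := key _ (le_trans (Im_le_cabs (u i)) u2).
  by rewrite /nrm; case: leqP.
have qNA : q%:R <= Nr `^ (A + 1).
  rewrite NA; have : Nr `^ A <= Nr `^ A * Nr by rewrite ler_peMr ?powR_ge0.
  by move: qA qR; clear; lra.
have rat_u i : small_rat_c (Nr `^ (A + 1)) (u i).
  apply: small_rat_scale => //; apply: le_trans (nrm_u i) _.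
  rewrite NA; have : Nr `^ A <= Nr `^ A * Nr by rewrite ler_peMr ?powR_ge0.
  by move: qA qR; clear; lra.
exists u, k; split; first by exact: kA.
rewrite /= -betaE; split; last split.
- apply: cvnorm_perturb v'1 hu' _; exact: (error_norm N2000 A4 B0 gam0 kA betaE).
- move=> i; apply: le_trans (inner_bound N2000 A4 B0 gam0 betaE).
  have orth : cinner v' (fun j => X (lift ord0 i) j) = 0 by exact: unit_normal_orthogonal.
  apply: (cinner_perturb orth hu') => j.
  rewrite /X !mxE; apply: le_trans (cabsD _ _) _.
  have x1 : cabs ((Xn (lift ord0 i) j)%:~R : R[i]) = 1.
    by rewrite intcE cabs_real; case: (hX (lift ord0 i) j) => ->; rewrite ?rmorphN ?normrN normr1.
  rewrite x1; have := hF (lift ord0 i) j; have := powR_ge1 N1 (ltW gam0).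
  by rewrite -/Nr; move: (Nr `^ gam) (cabs _) => a b; clear; lra.
exists (scale q%:R g), (gap_gens q%:R gs).
split; first exact: gap_gens_wf.
split; first by rewrite /gap_rank size_map.
split.
  apply: le_trans (gap_card_le _ _ hcard) _; rewrite ge_max le_max lexx /= le_max; apply/orP; right.
  have ru0 : 0 < rho_star sbar (beta * Nr `^ (5 * B + 4 + gam)) u.
    apply: rho_star_gt0; first by rewrite mulr_ge0 ?powR_ge0 // ltW.
    by rewrite lt0n; apply: contraTneq f_gt0 => h; rewrite rho_star_empty ?ltxx.
  have h : (Nr `^ (1 / 100) * rho_star sbar beta v)^-1 <=
      (rho_star sbar (beta * Nr `^ (5 * B + 4 + gam)) u)^-1.
    by rewrite lef_pV2 ?posrE ?mulr_gt0 ?powR_pos.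
  have a0 : 0 <= (Nr `^ (alpha / 2))^-1 by rewrite invr_ge0 powR_ge0.
  rewrite [in leRHS]mul1r; apply: le_trans (ler_wpM2r a0 h).
  rewrite (powR_add (alpha / 2) (1 / 100) N1) !invfM.
  by rewrite mulrA mulrAC [X in X / _ <= _]mulrC.
split.
  apply: le_trans hcount _; rewrite ler_nat; apply: subset_leq_card.
  apply/fintype.subsetP => i; rewrite !finset.in_set => /asboolP h.
  by apply/gap_elemsP; exists (r i).
split; first exact: rat_u.
split; first by have := rat_u i0; rewrite /u ri0 addr0.
move=> _ /mapP[p pgs ->] /=.
apply: small_rat_scale => //.
have [cc [cw ->]] := hgen p pgs.
pose M := (\max_i nrm (r i))%N.
have hM i : (nrm (r i) <= M)%N by exact: leq_bigmax.
(* Since [r i0 = 0], each [r j] is the difference of two numerators of entries of [u], both of norm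
   at most [2 q]. *)
have MR : M%:R <= 4 * q%:R :> R.
  have [|j] := @bigop.eq_bigmax _ (fun i => nrm (r i)); first by rewrite card_ord.
  rewrite -/M => ->.
  have := nrmD (g + r j) (- (g + r i0)); rewrite ri0 addr0 addrAC subrr add0r nrmN -(ler_nat R) natrD.
  have := nrm_u j; have := nrm_u i0; rewrite ri0 addr0; move: (nrm _) (nrm _) (nrm _) => a b d.
  by clear; lra.
(* A generator is a sum of at most [K <= N] of the [r i], each of norm at most [4 q <= N^A]; this
   extra factor [N] fits the exponent [A + 1]. *)
apply: le_trans (_ : (K * M)%:R <= _).
  by rewrite ler_nat; apply: leq_trans (nrm_lin _ hM) _; rewrite leq_mul2r cw orbT.
rewrite natrM NA mulrC; apply: ler_pM => //; apply: le_trans MR _.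
by move: qA qR; clear; lra.
Qed.
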